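(* Let $(\vartheta_0,D_6,D_5)$ be one of the triples $(0.924,4,6)$, $(0.739,6,8)$, $(0.643,6,12)$, $(0.584,10,16)$, $(0.544,12,20)$, $(0.516,14,26)$, and suppose some $\vartheta>\vartheta_0$ satisfies both conditions (A) and (B) below. Then at least one of the following holds: (i) there exist absolute constants $C$, $c>0$, an odd integer $b\le C$ and an even integer $d$ with $0<|d|\le D_6$ such that $P^-(p+d)>p^c$ and $\Omega(p+d)=b$ for infinitely many primes $p$; (ii) $\liminf_{n\to\infty}(p_{n+1}-p_n)\le D_5$.
   Context: $p_n$ is the $n$-th prime; $P^-(n)$ is the smallest prime factor of $n$; $\Omega(n)$ is the number of prime factors of $n$ counted with multiplicity and $\lambda(n)=(-1)^{\Omega(n)}$. Condition (A): for every $\varepsilon>0$, $A>0$, $\sum_{q\le N^{\vartheta-\varepsilon}}\max_{a:(a,q)=1}\bigl|\sum_{p\le N,\,p\equiv a\ (\mathrm{mod}\ q)}\log p-\frac{N}{\varphi(q)}\bigr|\ll_{\varepsilon,A}\frac{N}{(\log N)^A}$ ($p$ over primes). Condition (B): for every $\varepsilon>0$, $A>0$, $\sum_{q\le N^{\vartheta-\varepsilon}}\max_{y\le N}\max_a\bigl|\sum_{n\le y,\,n\equiv a\ (\mathrm{mod}\ q)}\lambda(n)\bigr|\ll_{\varepsilon,A}\frac{N}{(\log N)^A}$. *)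

(* Defs.v *)
From Stdlib Require Import Reals ZArith List.
From Coquelicot Require Import Rbar Lim_seq.
From mathcomp Require Import all_boot.
Set Implicit Arguments. Open Scope R_scope. Unset Strict Implicit. Unset Printing Implicit Defensive.

Fixpoint sum1 (n : nat) (f : nat -> R) : R :=
  match n with O => 0 | S m => (sum1 m f + f (S m)) end.

(* maximum of a finite family of reals (used only on nonnegative values) *)
Definition maxR (l : list R) : R := fold_right Rmax 0 l.

Definition bigOmega (n : nat) : nat := \sum_(p <- primes n) logn p n.

Definition liouville (n : nat) : R := ((-1) ^ bigOmega n).

Definition sum_q_le (X : R) (F : nat -> R) : R :=
  sum1 (Z.to_nat (up X)) (fun q => if Rle_dec (INR q) X then F q else 0).

Definition condA (theta : R) : Prop :=
  forall eps A : R, (0 < eps) -> (0 < A) ->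
  exists K : R, forall N : nat, (2 <= N)%N ->
    (sum_q_le (Rpower (INR N) (theta - eps)) (fun q =>
       maxR (map (fun a => Rabs (
          sum1 N (fun p => if prime p && (p %% q == a %% q)%N
                           then ln (INR p) else 0)
          - INR N / INR (totient q)))
        (filter (fun a => coprime a q) (seq.iota 0 q))))
     <= K * INR N / Rpower (ln (INR N)) A).

Definition condB (theta : R) : Prop :=
  forall eps A : R, (0 < eps) -> (0 < A) ->
  exists K : R, forall N : nat, (2 <= N)%N ->
    (sum_q_le (Rpower (INR N) (theta - eps)) (fun q =>
       maxR (map (fun y =>
         maxR (map (fun a => Rabs (
            sum1 y (fun n => if (n %% q == a %% q)%N then liouville n else 0)))
           (seq.iota 0 q)))
        (seq.iota 0 N.+1)))
     <= K * INR N / Rpower (ln (INR N)) A).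

Lemma next_prime_ex (m : nat) : exists p, (m < p)%N && prime p.
Proof. case: (prime_above m) => p H1 H2; exists p; by rewrite H1 H2. Qed.
Definition next_prime (m : nat) : nat := ex_minn (next_prime_ex m).

(* p_n, the n-th prime: p_1 = 2, p_2 = 3, ... (p_0 := 1 is unused) *)
Definition nth_prime (n : nat) : nat := iter n next_prime 1%N.

(* Main.v *)
(* The proof is the Goldston-Pintz-Yildirim method, played against parity.

   Fix an admissible tuple h_1, ..., h_k of diameter D5 with a member h_m within D6 of every other
   one.  If (i) and (ii) both fail then, for all large n, at most one n + h_i with i <> m is prime,
   and when one is, n + h_m either has lambda(n + h_m) = 1 or has a prime factor at most N^c, with
   c > 0 as small as we please.  Hence, for z < n <= N in a suitable residue class modulo W = w!,
       sum_(i <> m) 1_P(n + h_i) <= (1 + lambda(n + h_m)) / 2 + #{p <= N^c : p | n + h_m}.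
   Multiply by a Selberg weight (sum_(d | prod_i (n + h_i)) l_d)^2 of level N^tau with
   theta_0 < tau < theta, and sum over n.  The left side is evaluated by (A), the lambda-term is
   negligible by (B), and the last term is O(c^2) times the main term because l_d is smooth in
   log d.  What is left is (k - 1) tau B0 <= A0, where A0 and B0 are the two quadratic forms of the
   sieve in the three coefficients of the cut-off polynomial; the coefficients chosen below violate
   this for every tau > theta_0.

   Squarefree moduli are represented by sets A of primes, with nm A the product of A; sums
   over them are controlled by comparison with sums over integers coprime to W. *)
Require Import Defs.
From Stdlib Require Import Reals ZArith List Classical.
From Coquelicot Require Import Rbar Lim_seq.
From mathcomp Require Import all_boot all_order all_algebra.
From mathcomp Require Import ring lra zify.
From mathcomp Require Import reals_stdlib.Rstruct.
Import Order.TTheory GRing.Theory Num.Theory.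
Set Implicit Arguments. Unset Strict Implicit. Unset Printing Implicit Defensive.
Local Open Scope ring_scope.
Local Notation R := Rdefinitions.R.
Bind Scope ring_scope with Rdefinitions.RbaseSymbolsImpl.R.

(** * The Selberg diagonalisation *)

(** The majorant of the prime count has mean 1/2 instead of 1. This 1/2 cancels the one in tau/2,
    which is forced because the square of a divisor sum must have moduli at most N^tau. Only
    one-sided bounds are needed, from above for the total weight and from below at primes, so no
    asymptotic formula and no singular series occurs: in the class modulo W only primes above w
    matter, and each local discrepancy costs a relative O(1/w). Nonnegative polynomial coefficients
    make all functions monotone, which permits block-by-block comparison with integer sums. The
    factor c^2 arises by conditioning on a prime p dividing n + h_m: the form turns into one in
    differences y(S) - y(pS), of size log p / log N, and the sum of (log p)^2 / p up to N^c is O((c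
    log N)^2). A jump of the cut-off at 0 would spoil this, hence the ramp there. The Chebyshev
    bound used for that sum follows from (A) with q = 1. The order of choice is tau, then w and the
    ramp, then c, and N last. *)

Lemma set_ind_U1 (T : finType) (Pr : {set T} -> Prop) :
  Pr set0 -> (forall (p : T) (S : {set T}), p \notin S -> Pr S -> Pr (p |: S)) -> forall S, Pr S.
Proof.
move=> P0 PS S; move: {2}#|S| (erefl #|S|) => n; elim: n S => [|n IH] S hS.
  by rewrite (cards0_eq hS).
have [p pS] : exists p, p \in S by apply/card_gt0P; rewrite hS.
rewrite -(setD1K pS); apply: PS; first by rewrite !inE eqxx.
by apply: IH; move: hS; rewrite (cardsD1 p) pS => -[].
Qed.

Lemma sum_subsetU1 (V : nmodType) (T : finType) (p : T) (S : {set T})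
    (F : {set T} -> V) : p \notin S ->
  \sum_(A : {set T} | A \subset p |: S) F A =
  \sum_(A : {set T} | A \subset S) F A + \sum_(A : {set T} | A \subset S) F (p |: A).
Proof.
move=> pS; rewrite (bigID (fun A : {set T} => p \notin A)) /=; congr (_ + _).
  apply: eq_bigl => A; apply/andP/idP => [[AS pA]|AS].
    by apply/subsetP => x xA; have := subsetP AS x xA; rewrite !inE => /predU1P[xp|//]; rewrite -xp xA in pA.
  split; first by rewrite (subset_trans AS) // subsetUr.
  by apply: contra pS; apply: (subsetP AS).
rewrite (reindex_onto (fun A => p |: A) (fun A => A :\ p)) /=; last first.
  by move=> A /andP[_]; rewrite negbK => /setD1K.
apply: eq_bigl => A; rewrite setU11 /= andbT.
apply/andP/idP => [[AS /eqP hA]|AS].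
  apply/subsetP => x xA; have := subsetP AS x; rewrite !inE xA orbT => /(_ isT) /predU1P[xp|//].
  by rewrite -hA xp !inE eqxx in xA.
split; first by rewrite setUS.
by rewrite setU1K //; apply: contra pS; apply: (subsetP AS).
Qed.

Lemma sum_subset_set0 (V : nmodType) (T : finType) (F : {set T} -> V) :
  \sum_(A : {set T} | A \subset set0) F A = F set0.
Proof. by rewrite (eq_bigl (pred1 set0)) ?big_pred1_eq // => A; rewrite subset0. Qed.

Lemma prod_setU1 (F : comPzSemiRingType) (T : finType) (p : T) (S : {set T}) (f : T -> F) :
  p \notin S -> \prod_(i in p |: S) f i = f p * \prod_(i in S) f i.
Proof. by move=> pS; rewrite big_setU1. Qed.

Lemma prod_setU_disj (F : comPzSemiRingType) (T : finType) (A B : {set T}) (f : T -> F) :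
  [disjoint A & B] ->
  \prod_(i in A :|: B) f i = \prod_(i in A) f i * \prod_(i in B) f i.
Proof. by move=> AB; rewrite -bigU //; apply: eq_bigl => x; rewrite !inE. Qed.

(** Finite Euler product: a divisor sum of a multiplicative function factors over the primes. *)
Lemma sum_subset_prod (F : comPzSemiRingType) (T : finType) (S : {set T}) (f : T -> F) :
  \sum_(A : {set T} | A \subset S) \prod_(p in A) f p = \prod_(p in S) (1 + f p).
Proof.
elim/set_ind_U1: S => [|p S pS IH]; first by rewrite sum_subset_set0 !big_set0.
rewrite sum_subsetU1 // prod_setU1 // mulrDl mul1r -IH; congr (_ + _).
rewrite mulr_sumr; apply: eq_bigr => A AS; rewrite prod_setU1 //.
by apply: contra pS; apply: (subsetP AS).
Qed.

Lemma sum_superset (V : nmodType) (T : finType) (R P : {set T}) (F : {set T} -> V) :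
  R \subset P ->
  \sum_(A : {set T} | (A \subset P) && (R \subset A)) F A =
  \sum_(B : {set T} | B \subset P :\: R) F (R :|: B).
Proof.
move=> RP; rewrite (reindex_onto (fun B => R :|: B) (fun A => A :\: R)) /=; last first.
  move=> A /andP[_ RA]; apply/setP => x; rewrite !inE.
  by case: (boolP (x \in R)) => //= /(subsetP RA) ->.
apply: eq_bigl => B; rewrite subsetUl andbT subUset RP /=.
apply/andP/idP => [[BP /eqP <-]|].
  by rewrite setDUl setDv set0U setSD.
rewrite subsetD => /andP[BP BR]; split=> //; apply/eqP.
by rewrite setDUl setDv set0U; apply/setDidPl.
Qed.

(** Union and intersection of sets of primes are lcm and gcd of squarefree integers. *)
Lemma prod_lcm_gcd (F : comPzSemiRingType) (T : finType) (A B : {set T}) (f : T -> F) :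
  \prod_(p in A :|: B) f p * \prod_(p in A :&: B) f p =
  \prod_(p in A) f p * \prod_(p in B) f p.
Proof.
have -> : A :|: B = A :|: (B :\: A) by apply/setP => x; rewrite !inE; case: (x \in A).
rewrite prod_setU_disj; last by rewrite disjoint_sym -setI_eq0 setIDAC setDE -setIA setICr setI0.
rewrite -mulrA; congr (_ * _); rewrite mulrC setIC.
rewrite -prod_setU_disj ?setID //; apply/pred0P => x; rewrite !inE.
by case: (x \in A); rewrite ?andbF.
Qed.

(* [1/g = 1 + 1/h] at every prime, so [1/g(A :&: B)] is the sum of [1/h(R)] over
   the common divisors [R], which diagonalises the quadratic form. *)
Lemma selberg_diagonal (F : fieldType) (T : finType) (P : {set T}) (g h : T -> F)
    (l : {set T} -> F) :
  {in P, forall p, g p != 0} -> {in P, forall p, (g p)^-1 = 1 + (h p)^-1} ->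
  \sum_(A : {set T} | A \subset P) \sum_(B : {set T} | B \subset P)
     l A * l B * \prod_(p in A :|: B) g p =
  \sum_(R : {set T} | R \subset P) (\prod_(p in R) (h p)^-1) *
     (\sum_(A : {set T} | (A \subset P) && (R \subset A)) l A * \prod_(p in A) g p) ^+ 2.
Proof.
move=> g0 gh.
have prodg0 (A : {set T}) : A \subset P -> \prod_(p in A) g p != 0.
  by move=> AP; apply/prodf_neq0 => p pA; apply: g0; apply: (subsetP AP).
have key (A B : {set T}) : A \subset P -> B \subset P -> l A * l B * \prod_(p in A :|: B) g p =
   \sum_(R : {set T} | R \subset P) if (R \subset A) && (R \subset B) then
      (\prod_(p in R) (h p)^-1) * (l A * \prod_(p in A) g p) * (l B * \prod_(p in B) g p)
      else 0.
  move=> AP BP; have AB : A :&: B \subset P by rewrite (subset_trans _ AP) // subsetIl.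
  have := prod_lcm_gcd A B g => e.
  have -> : \prod_(p in A :|: B) g p =
     (\prod_(p in A) g p * \prod_(p in B) g p) * \prod_(p in A :&: B) (1 + (h p)^-1).
    rewrite -e -mulrA.
    rewrite -(eq_bigr _ (fun p (hp : p \in A :&: B) => gh p (subsetP AB p hp))).
    by rewrite prodfV divff ?mulr1 // prodg0.
  rewrite -sum_subset_prod !mulr_sumr -big_mkcondr /=.
  apply: eq_big => [R|R _]; last by ring.
  rewrite -subsetI; case: (boolP (R \subset A :&: B)) => [RAB|]; rewrite ?andbF ?andbT //.
  by rewrite (subset_trans RAB AB).
rewrite (eq_bigr _ (fun (A : {set T}) (hA : A \subset P) => eq_bigr _ (fun (B : {set T}) (hB : B \subset P) => key A B hA hB))).
under eq_bigr do rewrite exchange_big /=.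
rewrite exchange_big /=; apply: eq_bigr => R RP.
rewrite expr2 mulr_suml mulr_sumr big_mkcondr /=; apply: eq_bigr => A AP.
case: (boolP (R \subset A)) => RA /=; last by rewrite big1.
rewrite !mulr_sumr -big_mkcondr /=; apply: eq_bigr => B _; ring.
Qed.

(** Selberg's inversion. With these weights the inner sum of [selberg_diagonal] at R becomes, up to
    sign, the product of [h] over R times [y R], so that the [y] can be prescribed freely. The sign
    in the first product is the Moebius function. *)
Definition selberg_weight (F : fieldType) (T : finType) (P : {set T}) (g h : T -> F)
    (y : {set T} -> F) (A : {set T}) : F :=
  \prod_(p in A) (- (g p)^-1) *
  \sum_(S : {set T} | (S \subset P) && (A \subset S)) (\prod_(p in S) h p) * y S.

(** The multiplicative function [u] is kept general because the same weights enter two forms. For u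
    = g every factor 1 - u/g vanishes and only S = R survives; for another density a genuine inner
    sum remains. *)
Lemma sum_selberg_weight (F : fieldType) (T : finType) (P : {set T}) (g h u : T -> F)
    (y : {set T} -> F) (R : {set T}) : R \subset P ->
  \sum_(A : {set T} | (A \subset P) && (R \subset A))
     selberg_weight P g h y A * \prod_(p in A) u p =
  \sum_(S : {set T} | (S \subset P) && (R \subset S)) (\prod_(p in S) h p) * y S *
     (\prod_(p in R) (- (u p / g p)) * \prod_(p in S :\: R) (1 - u p / g p)).
Proof.
move=> RP; rewrite /selberg_weight.
transitivity (\sum_(A : {set T} | (A \subset P) && (R \subset A))
   \sum_(S : {set T} | (S \subset P) && (R \subset S)) if A \subset S then
     \prod_(p in S) h p * y S * \prod_(p in A) (- (u p / g p)) else 0).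
  apply: eq_bigr => A /andP[AP RA]; rewrite mulrAC -big_split /= mulr_sumr.
  rewrite -big_mkcondr /=; apply: eq_big => [S|S _].
    case: (boolP (A \subset S)) => AS; rewrite ?andbF // !andbT.
    by rewrite (subset_trans RA AS) andbT.
  rewrite mulrC; congr (_ * _); apply: eq_bigr => p _; ring.
rewrite exchange_big /=; apply: eq_bigr => S /andP[SP RS].
rewrite -big_mkcondr /= -mulr_sumr; congr (_ * _).
rewrite (eq_bigl (fun A : {set T} => (A \subset S) && (R \subset A))); last first.
  move=> A; case: (boolP (A \subset S)) => AS; rewrite ?andbF // ?andbT.
  by rewrite (subset_trans AS SP).
rewrite sum_superset // -(sum_subset_prod (S :\: R) (fun p => - (u p / g p))) mulr_sumr.
apply: eq_bigr => B; rewrite subsetD => /andP[BS BR].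
by rewrite prod_setU_disj // disjoint_sym.
Qed.

Lemma selberg_form (F : fieldType) (T : finType) (P : {set T}) (g h : T -> F)
    (y : {set T} -> F) :
  {in P, forall p, g p != 0} -> {in P, forall p, h p != 0} ->
  {in P, forall p, (g p)^-1 = 1 + (h p)^-1} ->
  \sum_(A : {set T} | A \subset P) \sum_(B : {set T} | B \subset P)
     selberg_weight P g h y A * selberg_weight P g h y B * \prod_(p in A :|: B) g p =
  \sum_(R : {set T} | R \subset P) (\prod_(p in R) h p) * y R ^+ 2.
Proof.
move=> g0 h0 gh; rewrite (selberg_diagonal _ g0 gh); apply: eq_bigr => R RP.
have hR0 : \prod_(p in R) h p != 0 by apply/prodf_neq0 => p pR; apply/h0/(subsetP RP).
rewrite sum_selberg_weight // (bigD1 R) ?RP ?subxx //= [X in _ + X]big1 => [|S /andP[/andP[SP RS] SR]].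
  rewrite addr0 setDv big_set0 mulr1 prodfV.
  have e : (\prod_(p in R) (- (g p / g p))) ^+ 2 = 1.
    rewrite -prodrXl; apply: big1 => p pR.
    by rewrite divff ?g0 ?(subsetP RP) // sqrrN expr1n.
  by rewrite exprMn e mulr1; field.
have /set0Pn[p pSR] : S :\: R != set0.
  by rewrite setD_eq0; apply: contra SR => SR; rewrite eqEsubset SR.
rewrite (bigD1 p pSR) /= divff ?g0 ?subrr ?mul0r ?mulr0 //.
by move: pSR; rewrite inE => /andP[_ /(subsetP SP)].
Qed.

(** Weights adapted to the density [g] are measured against another density [g']. The form is still
    diagonal, but in averages of [y] over supersets of R. In the application h (1 - g'/g) equals
    1/(p - 1), so the cut-off function gets integrated once. *)
Lemma selberg_form_cross (F : fieldType) (T : finType) (P : {set T})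
    (g h g' h' : T -> F) (y : {set T} -> F) :
  {in P, forall p, g' p != 0} -> {in P, forall p, (g' p)^-1 = 1 + (h' p)^-1} ->
  \sum_(A : {set T} | A \subset P) \sum_(B : {set T} | B \subset P)
     selberg_weight P g h y A * selberg_weight P g h y B * \prod_(p in A :|: B) g' p =
  \sum_(R : {set T} | R \subset P) \prod_(p in R) ((h' p)^-1 * (g' p / g p * h p) ^+ 2) *
     (\sum_(U : {set T} | U \subset P :\: R) \prod_(p in U) (h p * (1 - g' p / g p)) * y (R :|: U)) ^+ 2.
Proof.
move=> g0 gh; rewrite (selberg_diagonal _ g0 gh); apply: eq_bigr => R RP.
rewrite sum_selberg_weight // sum_superset // big_split /= -mulrA; congr (_ * _).
rewrite prodrXl -exprMn mulr_sumr.
transitivity ((\prod_(p in R) (-1) * \sum_(B : {set T} | B \subset P :\: R) \prod_(p in R) (g' p / g p * h p) *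
 (\prod_(p in B) (h p * (1 - g' p / g p)) * y (R :|: B))) ^+ 2); last first.
  by rewrite exprMn -prodrXl big1 ?mul1r // => p _; rewrite sqrrN expr1n.
congr (_ ^+ 2); rewrite mulr_sumr; apply: eq_bigr => B; rewrite subsetD => /andP[BP BR].
have -> : (R :|: B) :\: R = B by rewrite setDUl setDv set0U; apply/setDidPl.
rewrite prod_setU_disj 1?disjoint_sym //.
have -> : \prod_(p in R) - (g' p / g p) = \prod_(p in R) (-1) * \prod_(p in R) (g' p / g p).
  by rewrite -big_split /=; apply: eq_bigr => p _; rewrite mulN1r.
rewrite !big_split /=; ring.
Qed.

(** If [p0] already divides the product, the conditions for A and for A with [p0] added hold
    together and their weights add up. The result is again a Selberg weight, for the primes other
    than [p0], with [y] replaced by its difference in [p0]. For smooth [y] this difference is small,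
    which is what makes small prime factors of n + h_m rare under the weight. *)
Lemma selberg_weight_merge (F : fieldType) (T : finType) (P : {set T}) (g h : T -> F)
    (y : {set T} -> F) (p0 : T) (A : {set T}) :
  p0 \in P -> g p0 != 0 -> h p0 != 0 -> (g p0)^-1 = 1 + (h p0)^-1 ->
  A \subset P :\ p0 ->
  selberg_weight P g h y A + selberg_weight P g h y (p0 |: A) =
  selberg_weight (P :\ p0) g h (fun S => y S - y (p0 |: S)) A.
Proof.
move=> p0P g0 h0 gh AP; rewrite /selberg_weight.
have p0A : p0 \notin A by apply/negP => /(subsetP AP); rewrite !inE eqxx.
have AP' : A \subset P by rewrite (subset_trans AP) // subsetDl.
have p0D : p0 \notin P :\ p0 :\: A by rewrite !inE eqxx andbF.
rewrite prod_setU1 //; set X := \prod_(_ in A) _; set s1 := \sum_(_ | _) _; set s2 := \sum_(_ | _) _.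
have -> : X * s1 + - (g p0)^-1 * X * s2 = X * (s1 + - (g p0)^-1 * s2) by ring.
congr (_ * _); rewrite /s1 /s2 {X s1 s2}.
rewrite !sum_superset //; last by rewrite subUset sub1set p0P.
have -> : P :\: (p0 |: A) = P :\ p0 :\: A by rewrite setDDl.
have -> : P :\: A = p0 |: (P :\ p0 :\: A).
  apply/setP => x; rewrite !inE; case: eqP => [->|] //=; by rewrite p0A p0P.
rewrite sum_subsetU1 // -addrA mulr_sumr -!big_split /=; apply: eq_bigr => B BD.
have p0B : p0 \notin A :|: B.
  by rewrite inE (negbTE p0A) /=; apply: contra p0D; apply: (subsetP BD).
have -> : A :|: (p0 |: B) = p0 |: (A :|: B) by rewrite setUCA.
have -> : p0 |: A :|: B = p0 |: (A :|: B) by rewrite setUA.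
(* The coefficient of [y (p0 |: S)] is h - h/g at [p0], and 1/g = 1 + 1/h makes this -1. *)
rewrite prod_setU1 // gh; field => //.
Qed.

(** * Sums over integers coprime to a modulus *)

Definition lg (n : nat) : R := ln (INR n).

Lemma INR_gt0 (n : nat) : (0 < n)%N -> Rlt 0 (INR n).
Proof. by move=> n0; apply: lt_0_INR; apply/ssrnat.ltP. Qed.

Lemma ln_le_subr1 (x : R) : Rlt 0 x -> ln x <= x - 1.
Proof.
move=> x0; have := exp_ineq1_le (ln x); rewrite exp_ln // => /RleP.
rewrite RplusE R1E; lra.
Qed.

Lemma lg1 : lg 1 = 0.
Proof. exact: ln_1. Qed.

Lemma lgM (a b : nat) : (0 < a)%N -> (0 < b)%N -> lg (a * b) = lg a + lg b.
Proof. by move=> a0 b0; rewrite /lg mult_INR ln_mult //; apply: INR_gt0. Qed.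

Lemma lg_le (a b : nat) : (0 < a)%N -> (a <= b)%N -> lg a <= lg b.
Proof.
move=> a0; rewrite leq_eqVlt => /predU1P[->//|ab]; apply/ltW/RltP.
by apply: ln_increasing; [apply: INR_gt0 | apply: lt_INR; apply/ssrnat.ltP].
Qed.

Lemma lg_lt (a b : nat) : (0 < a)%N -> (a < b)%N -> lg a < lg b.
Proof.
move=> a0 ab; apply/RltP.
by apply: ln_increasing; [apply: INR_gt0 | apply: lt_INR; apply/ssrnat.ltP].
Qed.

Lemma lg_ge0 (a : nat) : (0 < a)%N -> 0 <= lg a.
Proof. by move=> a0; rewrite -lg1; apply: lg_le. Qed.

Lemma lgS_le (i : nat) : (0 < i)%N -> lg i.+1 - lg i <= i%:R^-1.
Proof.
move=> i0; have pi := INR_gt0 i0; have pS := INR_gt0 (ltn0Sn i).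
have -> : lg i.+1 - lg i = ln (Rdiv (INR i.+1) (INR i)).
  by rewrite /lg /Rdiv ln_mult ?ln_Rinv //; apply: Rinv_0_lt_compat.
apply: (le_trans (ln_le_subr1 _)); first exact: Rdiv_lt_0_compat.
rewrite RdivE !INRE -natr1.
have : (i%:R : R) != 0 by rewrite pnatr_eq0 -lt0n.
by move=> h; rewrite mulrDl divff // mul1r addrAC subrr add0r.
Qed.

Lemma lgS_ge (i : nat) : (0 < i)%N -> i.+1%:R^-1 <= lg i.+1 - lg i.
Proof.
move=> i0; have pi := INR_gt0 i0; have pS := INR_gt0 (ltn0Sn i).
rewrite -lerN2 opprB.
have -> : lg i - lg i.+1 = ln (Rdiv (INR i) (INR i.+1)).
  by rewrite /lg /Rdiv ln_mult ?ln_Rinv //; apply: Rinv_0_lt_compat.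
apply: (le_trans (ln_le_subr1 _)); first exact: Rdiv_lt_0_compat.
rewrite RdivE !INRE.
have : (i.+1%:R : R) != 0 by rewrite pnatr_eq0.
move=> h; rewrite -[X in _ - X](divff h) -mulrBl -natr1.
by rewrite opprD addrA subrr add0r mulN1r.
Qed.

(** This and the next inequality are the mean value theorem for x^(j+1). Together with [lgS_le] and
    [lgS_ge] they replace integration: sums of powers of logarithms over i are compared with
    telescoping sums. *)
Lemma subrX_ge (a b : R) (j : nat) : 0 <= b -> b <= a ->
  j.+1%:R * b ^+ j * (a - b) <= a ^+ j.+1 - b ^+ j.+1.
Proof.
move=> b0 ba; elim: j => [|j IH]; first by rewrite !expr1 expr0 mulr1 mul1r.
have -> : a ^+ j.+2 - b ^+ j.+2 = a * (a ^+ j.+1 - b ^+ j.+1) + b ^+ j.+1 * (a - b).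
  by rewrite [a ^+ j.+2]exprS [b ^+ j.+2]exprS; ring.
have h : b * (j.+1%:R * b ^+ j * (a - b)) <= a * (a ^+ j.+1 - b ^+ j.+1).
  by apply: ler_pM => //; rewrite mulr_ge0 ?subr_ge0 // mulr_ge0 ?exprn_ge0.
have -> : j.+2%:R * b ^+ j.+1 * (a - b) = b * (j.+1%:R * b ^+ j * (a - b)) + b ^+ j.+1 * (a - b).
  by rewrite -[in LHS]natr1 exprS; ring.
lra.
Qed.

Lemma subrX_le (a b : R) (j : nat) : 0 <= b -> b <= a ->
  a ^+ j.+1 - b ^+ j.+1 <= j.+1%:R * a ^+ j * (a - b).
Proof.
move=> b0 ba; elim: j => [|j IH]; first by rewrite !expr1 expr0 mulr1 mul1r.
have -> : a ^+ j.+2 - b ^+ j.+2 = a * (a ^+ j.+1 - b ^+ j.+1) + b ^+ j.+1 * (a - b).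
  by rewrite [a ^+ j.+2]exprS [b ^+ j.+2]exprS; ring.
have h : a * (a ^+ j.+1 - b ^+ j.+1) <= a * (j.+1%:R * a ^+ j * (a - b)).
  by apply: ler_wpM2l => //; apply: le_trans ba.
have h2 : b ^+ j.+1 * (a - b) <= a ^+ j.+1 * (a - b).
  by apply: ler_wpM2r; rewrite ?subr_ge0 // lerXn2r ?nnegrE //; apply: le_trans ba.
have -> : j.+2%:R * a ^+ j.+1 * (a - b) = a * (j.+1%:R * a ^+ j * (a - b)) + a ^+ j.+1 * (a - b).
  by rewrite -[in LHS]natr1 exprS; ring.
lra.
Qed.

Lemma sum_block (V : nmodType) (W : nat) (f : nat -> V) (N : nat) :
  (forall n, f (n + W)%N = f n) ->
  \sum_(N <= n < N + W) f n = \sum_(0 <= n < W) f n.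
Proof.
move=> per; elim: N => [|N IH]; first by rewrite add0n.
case: W per IH => [|W] per IH; first by rewrite !big_geq // !addn0.
rewrite -IH addSn big_nat_recr /=; last by rewrite addnS ltnS leq_addr.
by rewrite per addrC -big_ltn // addnS ltnS leq_addr.
Qed.

Lemma coprime_addWl (n W : nat) : coprime (n + W) W = coprime n W.
Proof. by rewrite coprime_sym /coprime gcdnDr gcdnC. Qed.

Lemma card_coprime_block (W N : nat) : (0 < W)%N ->
  \sum_(N <= n < N + W | coprime n W) (1 : R) = (totient W)%:R.
Proof.
move=> W0; rewrite big_mkcond sum_block => [|n]; last by rewrite coprime_addWl.
rewrite totient_count_coprime big_mkord natr_sum big_mkcond /=.
rewrite big_mkord; apply: eq_bigr => i _; by rewrite coprime_sym; case: coprime.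
Qed.

(** The class of test functions used throughout. Monotonicity allows a block of W consecutive
    integers to be replaced by one of its ends, and the class is stable under shifts, squares and
    sums over sets of primes. *)
Definition nneg_nondec (G : R -> R) : Prop :=
  (forall x, 0 <= G x) /\ (forall x y, x <= y -> G x <= G y).

Definition msum (W Z : nat) (G : R -> R) (t : R) : R :=
  \sum_(0 <= m < Z | coprime m W) G (t - lg m) / m%:R.

(** Truncated power; exponent 0 gives the indicator of s >= 0, which serves as the size condition on
    divisors. *)
Definition pw (j : nat) (s : R) : R := if 0 <= s then s ^+ j else 0.

Lemma pw_nneg_nondec (j : nat) : nneg_nondec (pw j).
Proof.
split=> [x|x y xy]; rewrite /pw.
  by case: ifP => // x0; rewrite exprn_ge0.
case: (leP 0 x) => x0; last by case: ifP => // y0; rewrite exprn_ge0.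
by rewrite (le_trans x0 xy) lerXn2r ?nnegrE // (le_trans x0 xy).
Qed.

Lemma nneg_nondec_shift (G : R -> R) (C : R) :
  nneg_nondec G -> nneg_nondec (fun s => G (s - C)).
Proof. by case=> G0 Gm; split=> // x y xy; apply: Gm; rewrite lerB. Qed.

Lemma msum_block_le (W i : nat) (G : R -> R) (t : R) :
  (0 < W)%N -> (0 < i)%N -> nneg_nondec G ->
  \sum_(i * W <= m < i * W + W | coprime m W) G (t - lg m) / m%:R <=
  (totient W)%:R * (G (t - lg (i * W)) / (i * W)%:R).
Proof.
move=> W0 i0 [G0 Gm]; rewrite -(card_coprime_block (i * W) W0) mulr_suml.
rewrite big_nat_cond [leRHS]big_nat_cond; apply: ler_sum => m /andP[/andP[im _] _].
have iW0 : (0 < i * W)%N by rewrite muln_gt0 i0.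
rewrite mul1r ler_pM ?invr_ge0 //.
  by apply: Gm; rewrite lerB // lg_le.
by rewrite lef_pV2 ?posrE ?ltr0n ?ler_nat // (leq_trans iW0).
Qed.

Lemma msum_block_ge (W i : nat) (G : R -> R) (t : R) :
  (1 < W)%N -> nneg_nondec G ->
  (totient W)%:R * (G (t - lg (i.+1 * W)) / (i.+1 * W)%:R) <=
  \sum_(i * W <= m < i * W + W | coprime m W) G (t - lg m) / m%:R.
Proof.
move=> W1 [G0 Gm]; rewrite -(card_coprime_block (i * W) (ltnW W1)) mulr_suml.
rewrite big_nat_cond [leRHS]big_nat_cond; apply: ler_sum => m /andP[/andP[_ mi] co].
have m0 : (0 < m)%N.
  by case: m co {mi} => //; rewrite /coprime gcd0n => /eqP W1'; rewrite W1' in W1.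
have mi' : (m <= i.+1 * W)%N by rewrite mulSn addnC ltnW.
rewrite mul1r ler_pM ?invr_ge0 //.
  by apply: Gm; rewrite lerB // lg_le.
by rewrite lef_pV2 ?posrE ?ltr0n ?ler_nat // (leq_trans m0).
Qed.

Lemma sum_blocks (V : nmodType) (W n : nat) (P : pred nat) (f : nat -> V) :
  \sum_(0 <= m < n * W | P m) f m =
  \sum_(0 <= i < n) \sum_(i * W <= m < i * W + W | P m) f m.
Proof.
elim: n => [|n IH]; first by rewrite mul0n !big_geq.
rewrite big_nat_recr //= -IH mulSn addnC -big_cat_nat ?leq_addr //.
Qed.

(** Every block of length W contains [totient W] integers coprime to W, and each term is bounded
    below by the right end of its block. The resulting telescoping sum starts at W, whence the loss
    [lg W], and by [t < lg Z] it ends outside the support of [pw]. *)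
Lemma msum_pw_ge (W Z j : nat) (C t : R) : (1 < W)%N -> t < lg Z -> 0 <= C -> (0 < Z)%N ->
  (totient W)%:R / W%:R / j.+1%:R * pw j.+1 (t - C - lg W) <=
  msum W Z (fun s => pw j (s - C)) t.
Proof.
move=> W1 tZ C0 Z0; have W0 := ltnW W1.
have Gn := nneg_nondec_shift C (pw_nneg_nondec j).
set n := (Z %/ W)%N.
have nZ : (n * W <= Z)%N by rewrite leq_trunc_div.
apply: (@le_trans _ _ (msum W (n * W) (fun s => pw j (s - C)) t)); last first.
  rewrite /msum [leRHS](big_cat_nat (leq0n _) nZ) //= lerDl.
  by apply: sumr_ge0 => m _; rewrite divr_ge0 //; apply: (proj1 Gn).
rewrite /msum sum_blocks.
set u := fun i : nat => t - C - lg W - lg i.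
apply: (@le_trans _ _ (\sum_(0 <= i < n) (totient W)%:R / W%:R / j.+1%:R *
    (pw j.+1 (u i.+1) - pw j.+1 (u i.+2)))).
  rewrite -mulr_sumr ler_wpM2l ?divr_ge0 //.
  have -> : \sum_(0 <= i < n) (pw j.+1 (u i.+1) - pw j.+1 (u i.+2)) =
     - \sum_(0 <= i < n) (pw j.+1 (u i.+2) - pw j.+1 (u i.+1)).
    by rewrite -sumrN; apply: eq_bigr => i _; rewrite opprB.
  rewrite (telescope_sumr (fun i => pw j.+1 (u i.+1))) // opprB /u lg1 subr0.
  rewrite lerBrDr gerDl /pw leNgt.
  have -> // : 0 <= t - C - lg W - lg n.+1 = false.
    apply/negbTE; rewrite -ltNge.
    have : lg Z <= lg W + lg n.+1.
      rewrite -lgM // lg_le // mulnC ltnW // /n ltn_ceil //.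
    lra.
  by rewrite ltxx.
apply: ler_sum_nat => i _.
apply: le_trans (msum_block_ge i t W1 Gn).
rewrite lgM // natrM invfM.
have -> : t - (lg i.+1 + lg W) - C = u i.+1 by rewrite /u; ring.
have -> : (totient W)%:R * (pw j (u i.+1) * (i.+1%:R^-1 * W%:R^-1)) =
  (totient W)%:R / W%:R / j.+1%:R * (j.+1%:R * pw j (u i.+1) / i.+1%:R) :> R.
  have : (j.+1%:R : R) != 0 by rewrite pnatr_eq0.
  have : (i.+1%:R : R) != 0 by rewrite pnatr_eq0.
  have : (W%:R : R) != 0 by rewrite pnatr_eq0 -lt0n.
  move: (W%:R : R) (i.+1%:R : R) (j.+1%:R : R) (pw j _) => x1 x2 x3 x4.
  by move=> *; field; do ?[apply/andP; split].
rewrite ler_wpM2l ?divr_ge0 //.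
have d1 : u i.+1 - u i.+2 <= i.+1%:R^-1.
  by rewrite /u /=; move: (i.+1%:R^-1) (lgS_le (ltn0Sn i)) => x; lra.
have d2 : u i.+2 <= u i.+1.
  by rewrite /u; have := lg_le (ltn0Sn i) (leqnSn i.+1); lra.
rewrite /pw; case: (leP 0 (u i.+1)) => u1; last first.
  by rewrite (lt_geF (le_lt_trans d2 u1)) subr0 mulr0 mul0r.
case: (leP 0 (u i.+2)) => u2.
  apply: (le_trans (subrX_le j u2 d2)).
  by rewrite ler_wpM2l // mulr_ge0 ?exprn_ge0.
rewrite subr0 exprSr -mulrA; apply: (@le_trans _ _ (u i.+1 ^+ j / i.+1%:R)).
  by rewrite ler_wpM2l ?exprn_ge0 //; move: (i.+1%:R^-1) d1 => x; lra.
by rewrite ler_peMl // ?divr_ge0 ?exprn_ge0 // ler1n.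
Qed.

(** From the third block on the sum telescopes. The first two blocks contain very small m, so they
    are bounded crudely by 2W times the value at t, and this bound is absorbed by enlarging the
    argument of the final power. *)
Lemma msum_pw_le (W Z j : nat) (C t : R) : (0 < W)%N -> 0 <= t -> 0 <= C ->
  msum W Z (fun s => if 0 <= s then (s + C) ^+ j else 0) t <=
  (totient W)%:R / W%:R / j.+1%:R *
  (t + C + (2 * W * W)%:R / (totient W)%:R) ^+ j.+1.
Proof.
move=> W0 t0 C0; set G := fun s : R => _; set c : R := (totient W)%:R / W%:R.
have phi0 : (0 < (totient W)%:R :> R) by rewrite ltr0n totient_gt0.
have W0' : (0 < W%:R :> R) by rewrite ltr0n.
have c0 : 0 < c by rewrite divr_gt0.
have Gn : nneg_nondec G.
  split=> [x|x y xy]; rewrite /G.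
    by case: ifP => // x0; rewrite exprn_ge0 // addr_ge0.
  case: (leP 0 x) => x0; last by case: ifP => // y0; rewrite exprn_ge0 // addr_ge0.
  rewrite (le_trans x0 xy) lerXn2r ?nnegrE ?addr_ge0 ?(le_trans x0 xy) //.
  by rewrite lerD2r.
have [G0 Gm] := Gn.
(* Z + 2 blocks certainly reach Z and always leave two blocks to split off; the surplus terms are
   nonnegative. *)
pose n := Z.
have nZ : (Z <= n.+2 * W)%N by rewrite /n; nia.
apply: (@le_trans _ _ (msum W (n.+2 * W) G t)).
  rewrite /msum [leRHS](big_cat_nat (leq0n _) nZ) //= lerDl.
  by apply: sumr_ge0 => m _; rewrite divr_ge0.
rewrite /msum sum_blocks big_ltn // big_ltn // addrA.
have first2 : \sum_(0 * W <= m < 0 * W + W | coprime m W) G (t - lg m) / m%:R +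
  \sum_(1 * W <= m < 1 * W + W | coprime m W) G (t - lg m) / m%:R <= (2 * W)%:R * (t + C) ^+ j.
  rewrite mul0n add0n mul1n -big_cat_nat ?leq_addr //=.
  apply: (@le_trans _ _ (\sum_(0 <= m < W + W) (t + C) ^+ j)); last first.
    by rewrite sumr_const_nat subn0 addnn -mul2n mulr_natl.
  rewrite big_mkcond /=; apply: ler_sum => m _.
  have tC : 0 <= (t + C) ^+ j by rewrite exprn_ge0 // addr_ge0.
  case: ifP => // _; case: m => [|m]; first by rewrite invr0 mulr0.
  have h : G (t - lg m.+1) <= (t + C) ^+ j.
    apply: (@le_trans _ _ (G t)); first by apply: Gm; rewrite gerBl lg_ge0.
    by rewrite /G t0.
  apply: le_trans h; rewrite ler_piMr // invf_le1 ?ler1n ?ltr0n //.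
have rest : \sum_(2 <= i < n.+2) \sum_(i * W <= m < i * W + W | coprime m W) G (t - lg m) / m%:R
   <= c / j.+1%:R * (t + C) ^+ j.+1.
  pose H s := if 0 <= s then (s + C) ^+ j.+1 else 0 : R.
  apply: (@le_trans _ _ (\sum_(2 <= i < n.+2) c / j.+1%:R *
      (- (H (t - lg (i * W)) - H (t - lg (i.-1 * W)))))).
    apply: ler_sum_nat => i /andP[i2 _].
    have i0 : (0 < i)%N by apply: leq_trans i2.
    apply: (le_trans (msum_block_le t W0 i0 Gn)).
    have -> : (totient W)%:R * (G (t - lg (i * W)) / (i * W)%:R) =
      c / j.+1%:R * (j.+1%:R * G (t - lg (i * W)) / i%:R).
      rewrite /c natrM.
      have : (j.+1%:R : R) != 0 by rewrite pnatr_eq0.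
      have : (i%:R : R) != 0 by rewrite pnatr_eq0 -lt0n.
      have : (W%:R : R) != 0 by rewrite pnatr_eq0 -lt0n.
      move: (W%:R : R) (i%:R : R) (j.+1%:R : R) (G _) => x1 x2 x3 x4.
      by move=> *; field; do ?[apply/andP; split].
    rewrite ler_wpM2l ?divr_ge0 ?(ltW c0) // opprB.
    have i1 : (0 < i.-1)%N by case: i i2 {i0} => [|[]].
    have d : i%:R^-1 <= (t - lg (i.-1 * W)) - (t - lg (i * W)).
      rewrite !lgM //; have := lgS_ge i1; rewrite prednK //; lra.
    have di : 0 <= (i%:R^-1 : R) by rewrite invr_ge0.
    rewrite /H /G; set s := t - lg (i * W) in d *; set s' := t - lg (i.-1 * W) in d *.
    case: (leP 0 s) => s0; last first.
      rewrite mulr0 mul0r subr0; case: ifP => // s'0; rewrite exprn_ge0 // addr_ge0 //.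
    have s's : s <= s' by lra.
    rewrite (le_trans s0 s's); apply: le_trans (subrX_ge j (addr_ge0 s0 C0) _); last by rewrite lerD2r.
    have sC : 0 <= s + C by apply: addr_ge0.
    have sX : 0 <= j.+1%:R * (s + C) ^+ j by rewrite mulr_ge0 ?exprn_ge0.
    by apply: ler_wpM2l => //; move: (i%:R^-1) (s) (s') d => x y z; lra.
  rewrite -mulr_sumr ler_wpM2l ?divr_ge0 ?(ltW c0) // sumrN.
  rewrite (big_addn 0 n.+2 2) /= subn2 /=.
  under eq_bigr do rewrite addn2 /=.
  rewrite (telescope_sumr (fun i => H (t - lg (i.+1 * W)))) // opprB mul1n.
  have h1 : 0 <= H (t - lg (n.+1 * W)).
    by rewrite /H; case: ifP => // x0; rewrite exprn_ge0 // addr_ge0.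
  have h2 : H (t - lg W) <= (t + C) ^+ j.+1.
    rewrite /H; case: ifP => x0; last by rewrite exprn_ge0 // addr_ge0.
    by have lW := lg_ge0 W0; apply: lerXn2r; rewrite ?nnegrE; lra.
  lra.
apply: (le_trans (lerD first2 rest)).
(* [b] is chosen with c * b = 2 W. The crude bound for the first two blocks then becomes c times (t
   + C)^j b, and [subrX_ge] fits it between the powers of t + C and of t + C + b. *)
set b := (2 * W * W)%:R / (totient W)%:R.
have b0 : 0 <= b by rewrite divr_ge0.
have := subrX_ge j (addr_ge0 t0 C0) (_ : t + C <= t + C + b); rewrite lerDl => /(_ b0) h.
have -> : (2 * W)%:R * (t + C) ^+ j = c / j.+1%:R * (j.+1%:R * (t + C) ^+ j * b).
  have : (j.+1%:R : R) != 0 by rewrite pnatr_eq0.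
  move: (gt_eqF phi0) (gt_eqF W0') => /negbT ? /negbT ?.
  rewrite /c /b !natrM; move: (j.+1%:R : R) ((t + C) ^+ j) => x1 x2 ?.
  by field; do ?[apply/andP; split].
rewrite -mulrDr ler_wpM2l ?divr_ge0 ?(ltW c0) //.
move: h; have -> : t + C + b - (t + C) = b by ring.
move: (_ ^+ j.+1) (_ ^+ j.+1) (_ * b) => x1 x2 x3; lra.
Qed.

(** * Sums over sets of primes *)

(** Each prime of A is assigned to [f] or to [f'], which runs through the ordered coprime
    factorisations of a squarefree integer. *)
Lemma sum_subset_prodD (F : comPzSemiRingType) (T : finType) (P : {set T})
    (f f' : T -> F) (Psi : {set T} -> F) :
  \sum_(A : {set T} | A \subset P) \prod_(p in A) (f p + f' p) * Psi A =
  \sum_(B : {set T} | B \subset P) \sum_(C : {set T} | C \subset P :\: B)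
     \prod_(p in B) f p * \prod_(p in C) f' p * Psi (B :|: C).
Proof.
elim/set_ind_U1: P Psi => [|p S pS IH] Psi.
  by rewrite !sum_subset_set0 set0D sum_subset_set0 !big_set0 mulr1 set0U.
rewrite !sum_subsetU1 // IH.
have pin (B : {set T}) : B \subset S -> p \notin B.
  by move=> BS; apply: contra pS; apply: (subsetP BS).
have -> : \sum_(A : {set T} | A \subset S) \prod_(q in p |: A) (f q + f' q) * Psi (p |: A) =
   (f p + f' p) * \sum_(A : {set T} | A \subset S) \prod_(q in A) (f q + f' q) * Psi (p |: A).
  by rewrite mulr_sumr; apply: eq_bigr => A AS; rewrite prod_setU1 ?pin // mulrA.
rewrite (IH (fun A => Psi (p |: A))) mulrDl addrCA [RHS]addrC; congr (_ + _).
  rewrite mulr_sumr; apply: eq_bigr => B BS.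
  have -> : (p |: S) :\: (p |: B) = S :\: B.
    apply/setP => x; rewrite !inE; case: eqP => //= ->; by rewrite (negbTE pS) andbF.
  rewrite mulr_sumr; apply: eq_bigr => C _.
  by rewrite prod_setU1 ?pin // setUA !mulrA.
rewrite mulr_sumr -big_split /=; apply: eq_bigr => B BS.
have -> : (p |: S) :\: B = p |: (S :\: B).
  by apply/setP => x; rewrite !inE; case: eqP => //= ->; rewrite pin.
rewrite sum_subsetU1 ?inE ?(negbTE pS) ?andbF //; congr (_ + _).
rewrite mulr_sumr; apply: eq_bigr => C CS.
rewrite prod_setU1; last by rewrite pin // (subset_trans CS) // subsetDl.
by rewrite [B :|: (p |: C)]setUCA -!mulrA [RHS]mulrCA.
Qed.

Definition nm (z : nat) (A : {set 'I_z}) : nat := (\prod_(p in A) p)%N.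

Definition prset (z w : nat) : {set 'I_z} := [set p : 'I_z | prime p & (w < p)%N].

(** The sum of f(n) G(t - log n) over squarefree n with prime factors in P. For a density f close to
    k/p it behaves like a k-fold antiderivative of G. *)
Definition wsum (z : nat) (P : {set 'I_z}) (f : 'I_z -> R) (G : R -> R) (t : R) : R :=
  \sum_(A : {set 'I_z} | A \subset P) \prod_(p in A) f p * G (t - lg (nm A)).

Lemma prset_prime (z w : nat) (p : 'I_z) : p \in prset z w -> prime p.
Proof. by rewrite inE => /andP[]. Qed.

Lemma nm_gt0 (z w : nat) (A : {set 'I_z}) : A \subset prset z w -> (0 < nm A)%N.
Proof.
move=> AP; rewrite /nm; elim/big_ind: _ => // [x y x0 y0|p pA].
  by rewrite muln_gt0 x0.
by apply/prime_gt0/(@prset_prime _ w)/(subsetP AP).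
Qed.

Lemma nm0 (z : nat) : nm (set0 : {set 'I_z}) = 1%N.
Proof. by rewrite /nm big_set0. Qed.

Lemma nm_setU1 (z : nat) (p : 'I_z) (A : {set 'I_z}) :
  p \notin A -> nm (p |: A) = (p * nm A)%N.
Proof. by move=> pA; rewrite /nm big_setU1. Qed.

Lemma nm_setU (z : nat) (A B : {set 'I_z}) :
  [disjoint A & B] -> nm (A :|: B) = (nm A * nm B)%N.
Proof. by move=> AB; rewrite /nm -bigU //; apply: eq_bigl => x; rewrite !inE. Qed.

Lemma lg_nmU (z w : nat) (A B : {set 'I_z}) :
  A \subset prset z w -> B \subset prset z w -> [disjoint A & B] ->
  lg (nm (A :|: B)) = lg (nm A) + lg (nm B).
Proof. by move=> AP BP AB; rewrite nm_setU // lgM // (@nm_gt0 _ w). Qed.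

Lemma lg_nm_ge0 (z w : nat) (A : {set 'I_z}) : A \subset prset z w -> 0 <= lg (nm A).
Proof. by move=> AP; apply/lg_ge0/nm_gt0/AP. Qed.

Lemma prime_dvd_nm (z w : nat) (A : {set 'I_z}) (p : 'I_z) :
  A \subset prset z w -> p \in prset z w -> (p %| nm A)%N = (p \in A).
Proof.
move=> AP pP; have pp := prset_prime pP.
apply/idP/idP => [|pA]; last by rewrite /nm (bigD1 p pA) dvdn_mulr.
rewrite /nm; elim/set_ind_U1: A AP => [|q S qS IH] AP; first by rewrite big_set0 dvdn1 => /eqP p1; rewrite p1 in pp.
have [qP SP] : q \in prset z w /\ S \subset prset z w.
  by move: AP; rewrite subUset sub1set => /andP.
rewrite big_setU1 //= Euclid_dvdM // => /orP[|/(IH SP) pS]; last by rewrite !inE pS orbT.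
by rewrite dvdn_prime2 ?(prset_prime qP) // !inE => pq; rewrite -val_eqE /= pq.
Qed.

Lemma nm_inj (z w : nat) (A B : {set 'I_z}) :
  A \subset prset z w -> B \subset prset z w -> nm A = nm B -> A = B.
Proof.
move=> AP BP e; apply/setP => p.
case: (boolP (p \in prset z w)) => pP.
  by rewrite -(prime_dvd_nm AP pP) -(prime_dvd_nm BP pP) e.
rewrite (negbTE (contra (subsetP AP p) pP)).
by rewrite (negbTE (contra (subsetP BP p) pP)).
Qed.

Lemma coprime_fact (p w : nat) : prime p -> coprime p w`! = (w < p)%N.
Proof.
move=> pp; rewrite prime_coprime // ltnNge; congr (~~ _).
apply/idP/idP => [|pw]; last by rewrite dvdn_fact // prime_gt0.
elim: w => [|w IH]; first by rewrite dvdn1 => /eqP p1; rewrite p1 in pp.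
rewrite factS Euclid_dvdM // => /orP[/dvdn_leq-> //|/IH pw]; exact: leqW.
Qed.

Lemma coprime_nm (z w M : nat) (A : {set 'I_z}) :
  {in A, forall p : 'I_z, coprime p M} -> coprime (nm A) M.
Proof.
move=> h; rewrite /nm; elim/big_ind: _ => // [|x y cx cy].
  by rewrite /coprime gcd1n.
by rewrite coprimeMl cx.
Qed.

Lemma coprime_nm_fact (z w : nat) (A : {set 'I_z}) :
  A \subset prset z w -> coprime (nm A) w`!.
Proof.
move=> AP; apply: (@coprime_nm z w) => p pA.
by have := subsetP AP p pA; rewrite inE => /andP[pp wp]; rewrite coprime_fact.
Qed.

Lemma prod_div_nm (z : nat) (A : {set 'I_z}) :
  \prod_(p in A) (p%:R^-1 : R) = (nm A)%:R^-1.
Proof. by rewrite prodfV /nm natr_prod. Qed.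

Lemma prodr_ge0_in (T : finType) (A P : {set T}) (f : T -> R) :
  {in P, forall p, 0 <= f p} -> A \subset P -> 0 <= \prod_(p in A) f p.
Proof. by move=> f0 AP; apply: prodr_ge0 => p pA; apply/f0/(subsetP AP). Qed.

Lemma wsum_nneg_nondec (z : nat) (P : {set 'I_z}) (f : 'I_z -> R) (G : R -> R) :
  {in P, forall p, 0 <= f p} -> nneg_nondec G -> nneg_nondec (wsum P f G).
Proof.
move=> f0 [G0 Gm]; split=> [x|x y xy].
  by apply: sumr_ge0 => A AP; rewrite mulr_ge0 ?(prodr_ge0_in f0).
by apply: ler_sum => A AP; rewrite ler_wpM2l ?(prodr_ge0_in f0) // Gm // lerB.
Qed.

Lemma wsum_neg (z w : nat) (P : {set 'I_z}) (f : 'I_z -> R) (G : R -> R) :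
  P \subset prset z w -> (forall x, x < 0 -> G x = 0) ->
  forall x, x < 0 -> wsum P f G x = 0.
Proof.
move=> PP GN x x0; apply: big1 => A AP; rewrite GN ?mulr0 //.
have := lg_nm_ge0 (subset_trans AP PP); lra.
Qed.

Lemma wsum_le (z : nat) (P : {set 'I_z}) (f f' : 'I_z -> R) (G G' : R -> R) (t : R) :
  {in P, forall p, 0 <= f p <= f' p} -> (forall x, 0 <= G x <= G' x) ->
  wsum P f G t <= wsum P f' G' t.
Proof.
move=> ff GG; apply: ler_sum => A AP.
have f0 : {in P, forall p, 0 <= f p} by move=> p /ff /andP[].
have [G0 G1] := andP (GG (t - lg (nm A))).
apply: ler_pM => //; first exact: (prodr_ge0_in f0).
by apply: ler_prod => p pA; apply/ff/(subsetP AP).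
Qed.

Lemma wsum_subset (z : nat) (P P' : {set 'I_z}) (f : 'I_z -> R) (G : R -> R) (t : R) :
  P' \subset P -> {in P, forall p, 0 <= f p} -> (forall x, 0 <= G x) ->
  wsum P' f G t <= wsum P f G t.
Proof.
move=> PP f0 G0; rewrite /wsum [leRHS](bigID (fun A : {set 'I_z} => A \subset P')) /=.
rewrite (eq_bigl (fun A : {set 'I_z} => (A \subset P) && (A \subset P'))); last first.
  move=> A /=; case: (boolP (A \subset P')) => AP; rewrite ?andbF // andbT.
  by rewrite (subset_trans AP PP).
by rewrite lerDl sumr_ge0 // => A /andP[AP _]; rewrite mulr_ge0 ?(prodr_ge0_in f0).
Qed.

Lemma wsum_add (z w : nat) (P : {set 'I_z}) (f f' : 'I_z -> R) (G : R -> R) (t : R) :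
  P \subset prset z w ->
  wsum P (fun p => f p + f' p) G t =
  \sum_(B : {set 'I_z} | B \subset P) \prod_(p in B) f p *
     wsum (P :\: B) f' G (t - lg (nm B)).
Proof.
move=> PP; rewrite /wsum sum_subset_prodD; apply: eq_bigr => B BP.
rewrite mulr_sumr; apply: eq_bigr => C; rewrite subsetD => /andP[CP CB].
rewrite (@lg_nmU _ w) ?(subset_trans _ PP) 1?disjoint_sym // -mulrA; congr (_ * (_ * G _)).
ring.
Qed.

(** Forgetting that the two factors are coprime only adds nonnegative terms. This is how the
    dimension is raised by one unit at a time. *)
Lemma wsum_add_le (z w : nat) (P : {set 'I_z}) (f f' : 'I_z -> R) (G : R -> R) (t : R) :
  P \subset prset z w -> {in P, forall p, 0 <= f p} -> {in P, forall p, 0 <= f' p} ->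
  (forall x, 0 <= G x) ->
  wsum P (fun p => f p + f' p) G t <= wsum P f (wsum P f' G) t.
Proof.
move=> PP f0 f'0 G0; rewrite (wsum_add _ _ _ _ PP); apply: ler_sum => B BP.
by rewrite ler_wpM2l ?(prodr_ge0_in f0) // wsum_subset // subsetDl.
Qed.

Lemma wsum_prod_le (z w : nat) (P : {set 'I_z}) (f : 'I_z -> R) (G : R -> R) (t : R) :
  P \subset prset z w -> {in P, forall p, 0 <= f p} -> nneg_nondec G ->
  wsum P f G t <= \prod_(p in P) (1 + f p) * G t.
Proof.
move=> PP f0 [G0 Gm]; rewrite -sum_subset_prod mulr_suml; apply: ler_sum => A AP.
rewrite ler_wpM2l ?(prodr_ge0_in f0) // Gm // gerBl.
exact: (lg_nm_ge0 (subset_trans AP PP)).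
Qed.

(** The bound prod (1 + e) <= 1 / (1 - sum e), with the division cleared so that the sum may have
    any size. *)
Lemma prod_add1_le (T : finType) (P : {set T}) (e : T -> R) :
  {in P, forall p, 0 <= e p} ->
  \prod_(p in P) (1 + e p) * (1 - \sum_(p in P) e p) <= 1.
Proof.
elim/set_ind_U1: P => [|p S pS IH] e0; first by rewrite !big_set0 subr0 mulr1.
have eS : {in S, forall q, 0 <= e q} by move=> q qS; apply: e0; rewrite !inE qS orbT.
have ep : 0 <= e p by apply: e0; rewrite !inE eqxx.
have h := IH eS.
have P0 : 0 <= \prod_(q in S) (1 + e q).
  by apply: prodr_ge0 => q /eS; lra.
rewrite prod_setU1 // big_setU1 //=.
have s0 : 0 <= \sum_(q in S) e q by apply: sumr_ge0.
move: (\prod_(_ in _) _) (\sum_(_ in _) _) P0 s0 h => X s X0 s0 h.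
apply: le_trans h.
have -> : (1 + e p) * X * (1 - (e p + s)) = X * (1 - s) - X * (e p * s + e p * e p) by ring.
by rewrite gerBl mulr_ge0 // addr_ge0 // mulr_ge0.
Qed.

Lemma sum_subset_mem (z : nat) (P : {set 'I_z}) (p : 'I_z) (F : {set 'I_z} -> R) :
  p \in P ->
  \sum_(A : {set 'I_z} | A \subset P) (if p \in A then F A else 0) =
  \sum_(A : {set 'I_z} | A \subset P :\ p) F (p |: A).
Proof.
move=> pP; rewrite -{1}(setD1K pP) sum_subsetU1 ?inE ?eqxx // big1 ?add0r => [|A AP].
  by apply: eq_bigr => A _; rewrite setU11.
by case: ifP => // /(subsetP AP); rewrite !inE eqxx.
Qed.

(* The pairs [(B, C)] sharing a prime [p] contribute at most [f p * f' p] times the full double sum. *)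
Lemma wsum_add_ge (z w : nat) (P : {set 'I_z}) (f f' : 'I_z -> R) (G : R -> R) (t : R) :
  P \subset prset z w -> {in P, forall p, 0 <= f p} -> {in P, forall p, 0 <= f' p} ->
  nneg_nondec G ->
  (1 - \sum_(p in P) f p * f' p) * wsum P f (wsum P f' G) t <=
  wsum P (fun p => f p + f' p) G t.
Proof.
move=> PP f0 f'0 [G0 Gm]; rewrite (wsum_add _ _ _ _ PP).
pose Phi (B C : {set 'I_z}) := \prod_(p in B) f p * (\prod_(p in C) f' p * G (t - lg (nm B) - lg (nm C))).
have Phi0 (B C : {set 'I_z}) : B \subset P -> C \subset P -> 0 <= Phi B C.
  by move=> BP CP; rewrite mulr_ge0 ?(prodr_ge0_in f0) // mulr_ge0 ?(prodr_ge0_in f'0).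
have full : wsum P f (wsum P f' G) t =
   \sum_(B : {set 'I_z} | B \subset P) \sum_(C : {set 'I_z} | C \subset P) Phi B C.
  by apply: eq_bigr => B _; rewrite /wsum mulr_sumr.
have disj : \sum_(B : {set 'I_z} | B \subset P) \prod_(p in B) f p *
     wsum (P :\: B) f' G (t - lg (nm B)) =
   \sum_(B : {set 'I_z} | B \subset P) \sum_(C : {set 'I_z} | C \subset P)
     if [disjoint C & B] then Phi B C else 0.
  apply: eq_bigr => B _; rewrite /wsum mulr_sumr -big_mkcondr /=.
  by apply: eq_bigl => C; rewrite subsetD.
rewrite mulrBl mul1r disj {1}full lerBlDr -lerBlDl -!sumrB.
under eq_bigr do rewrite -sumrB.
apply: (@le_trans _ _ (\sum_(B : {set 'I_z} | B \subset P) \sum_(C : {set 'I_z} | C \subset P)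
   \sum_(p in P) if p \in B then if p \in C then Phi B C else 0 else 0)).
  apply: ler_sum => B BP; apply: ler_sum => C CP.
  have pos p : 0 <= (if p \in B then if p \in C then Phi B C else 0 else 0).
    by case: ifP => // _; case: ifP => // _; apply: Phi0.
  case: ifP => [_|/negbT]; first by rewrite subrr sumr_ge0.
  rewrite -setI_eq0 => /set0Pn[p]; rewrite inE => /andP[pC pB].
  by rewrite subr0 (bigD1 p) ?(subsetP BP) //= pB pC lerDl sumr_ge0.
rewrite [leRHS]mulr_suml.
under eq_bigr do rewrite exchange_big /=.
rewrite exchange_big /=; apply: ler_sum => p pP.
under eq_bigr => B _.
  have -> : \sum_(C : {set 'I_z} | C \subset P) (if p \in B then if p \in C then Phi B C else 0 else 0) =
    if p \in B then \sum_(C : {set 'I_z} | C \subset P) (if p \in C then Phi B C else 0) else 0.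
    by case: ifP => // _; rewrite big1.
  over.
rewrite sum_subset_mem //.
under eq_bigr do rewrite sum_subset_mem //.
rewrite full mulr_sumr.
have sub (F : {set 'I_z} -> R) : (forall A : {set 'I_z}, A \subset P -> 0 <= F A) ->
  \sum_(A : {set 'I_z} | A \subset P :\ p) F A <= \sum_(A : {set 'I_z} | A \subset P) F A.
  move=> F0; rewrite [leRHS](bigID (fun A : {set 'I_z} => A \subset P :\ p)) /=.
  rewrite (eq_bigl (fun A : {set 'I_z} => (A \subset P) && (A \subset P :\ p))); last first.
    move=> A /=; case: (boolP (A \subset P :\ p)) => AP; rewrite ?andbF // andbT.
    by rewrite (subset_trans AP) // subsetDl.
  by rewrite lerDl sumr_ge0 // => A /andP[AP _]; apply: F0.
have fp := f0 p pP; have f'p := f'0 p pP.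
apply: (@le_trans _ _ (\sum_(B : {set 'I_z} | B \subset P :\ p)
   f p * f' p * \sum_(C : {set 'I_z} | C \subset P) Phi B C)); last first.
  by apply: sub => B BP; apply: mulr_ge0; [exact: mulr_ge0 | apply: sumr_ge0 => C CP; apply: Phi0].
apply: ler_sum => B BP; have pB : p \notin B by apply/negP => /(subsetP BP); rewrite !inE eqxx.
have BP' : B \subset P by rewrite (subset_trans BP) // subsetDl.
apply: (@le_trans _ _ (\sum_(C : {set 'I_z} | C \subset P :\ p) f p * f' p * Phi B C)); last first.
  by rewrite mulr_sumr; apply: sub => C CP; apply: mulr_ge0; [exact: mulr_ge0 | exact: Phi0].
apply: ler_sum => C CP; have pC : p \notin C by apply/negP => /(subsetP CP); rewrite !inE eqxx.
have CP' : C \subset P by rewrite (subset_trans CP) // subsetDl.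
rewrite /Phi !prod_setU1 // !nm_setU1 // !lgM; last first.
- exact/(@nm_gt0 _ w)/(subset_trans BP').
- exact/prime_gt0/(@prset_prime _ w)/(subsetP PP).
- exact/(@nm_gt0 _ w)/(subset_trans CP').
- exact/prime_gt0/(@prset_prime _ w)/(subsetP PP).
have lp : 0 <= lg p by apply/lg_ge0/prime_gt0/(@prset_prime _ w)/(subsetP PP).
have -> : f p * \prod_(i in B) f i * (f' p * \prod_(i in C) f' i *
   G (t - (lg p + lg (nm B)) - (lg p + lg (nm C)))) =
   (f p * f' p) * (\prod_(i in B) f i * (\prod_(i in C) f' i *
   G (t - (lg p + lg (nm B)) - (lg p + lg (nm C))))) by ring.
rewrite ler_wpM2l ?mulr_ge0 // ler_wpM2l ?(prodr_ge0_in f0) // ler_wpM2l ?(prodr_ge0_in f'0) //.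
apply: Gm; lra.
Qed.

(** Distinct sets have distinct products, all coprime to w!, so a sum over sets is part of a sum
    over integers; the vanishing of [F] from Z on makes the latter finite. *)
Lemma sum_nm_le (z w Z : nat) (P : {set 'I_z}) (F : nat -> R) :
  P \subset prset z w -> (forall m, 0 <= F m) -> (forall m, (Z <= m)%N -> F m = 0) ->
  \sum_(A : {set 'I_z} | A \subset P) F (nm A) <=
  \sum_(0 <= m < Z | coprime m w`!) F m.
Proof.
move=> PP F0 FZ.
apply: (@le_trans _ _ (\sum_(A : {set 'I_z} | A \subset P) \sum_(0 <= m < Z) if nm A == m then F m else 0)).
  apply: ler_sum => A AP; case: (leqP Z (nm A)) => h.
    by rewrite FZ // sumr_ge0 // => m _; case: ifP.
  rewrite (bigD1_seq (nm A)) ?mem_index_iota ?iota_uniq //= eqxx lerDl.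
  by rewrite sumr_ge0 // => m _; case: ifP.
rewrite exchange_big /= [leRHS]big_mkcond; apply: ler_sum => m _.
case: (pickP (fun A : {set 'I_z} => (A \subset P) && (nm A == m))) => [A0 /andP[AP /eqP e]|none].
  rewrite (bigD1 A0) //= e eqxx big1 => [|A /andP[AP' AA]].
    by rewrite addr0 -e coprime_nm_fact ?(subset_trans AP PP).
  case: eqP => // e'; case/eqP: AA; apply: (@nm_inj z w); rewrite ?(subset_trans _ PP) //.
  by rewrite e.
rewrite big1 => [|A AP]; first by case: ifP.
by have := none A; rewrite AP /= => ->.
Qed.

Lemma wsum_inv_le (z w Z : nat) (P : {set 'I_z}) (G : R -> R) (t : R) :
  P \subset prset z w -> (0 < Z)%N -> t < lg Z -> (forall x, 0 <= G x) ->
  (forall x, x < 0 -> G x = 0) ->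
  wsum P (fun p => p%:R^-1) G t <= msum w`! Z G t.
Proof.
move=> PP Z0 tZ G0 GN; rewrite /wsum /msum.
under eq_bigr do rewrite prod_div_nm mulrC.
apply: (sum_nm_le (F := fun m => G (t - lg m) / m%:R)) PP _ _ => m; first by rewrite divr_ge0.
by move=> Zm; rewrite GN ?mul0r //; have := lg_le Z0 Zm; lra.
Qed.

Lemma sum_dvd_le (Z d : nat) (F : nat -> R) : (0 < d)%N -> (forall m, 0 <= F m) ->
  \sum_(0 <= m < Z | (d %| m)%N) F m <= \sum_(0 <= m < Z) F (d * m)%N.
Proof.
move=> d0 F0; rewrite big_mkcond /=.
apply: (@le_trans _ _ (\sum_(0 <= m < Z) \sum_(0 <= n < Z) if m == (d * n)%N then F m else 0)).
  rewrite big_nat [leRHS]big_nat; apply: ler_sum => m mZ; case: ifP => dm; last first.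
    by rewrite sumr_ge0 // => n _; case: ifP.
  have q : (m = d * (m %/ d))%N by rewrite mulnC divnK.
  rewrite (bigD1_seq (m %/ d)%N) ?iota_uniq //=; last first.
    by rewrite mem_index_iota /= (leq_ltn_trans (leq_div _ _)).
  rewrite -q eqxx lerDl sumr_ge0 // => n _; case: ifP => //.
rewrite exchange_big /=; apply: ler_sum => n _.
rewrite -big_mkcond /=; case: (ltnP (d * n) Z) => h.
  rewrite (big_rem (d * n)%N) /=; last by rewrite mem_index_iota.
  rewrite eqxx big_seq_cond big1 ?addr0 // => m /andP[]; rewrite mem_rem_uniq ?iota_uniq //.
  by rewrite inE => /andP[/negbTE h1 _]; rewrite h1.
rewrite big_nat_cond big1 // => m /andP[/andP[_ mZ] /eqP e].
by rewrite e ltnNge h in mZ.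
Qed.

Lemma sum_invsq_le (w Z : nat) : (0 < w)%N ->
  \sum_(w.+1 <= d < Z) ((d%:R : R) ^+ 2)^-1 <= w%:R^-1.
Proof.
move=> w0; case: (leqP Z w) => hZ; first by rewrite big_geq ?invr_ge0 // ltnW.
suff : \sum_(w.+1 <= d < Z) ((d%:R : R) ^+ 2)^-1 <= w%:R^-1 - (Z.-1)%:R^-1.
  move=> h; apply: le_trans h _; by rewrite gerBl invr_ge0.
have -> : w%:R^-1 - (Z.-1)%:R^-1 = \sum_(w.+1 <= d < Z) ((d.-1)%:R^-1 - d%:R^-1) :> R.
  case: Z hZ => // Z; rewrite ltnS => hZ.
  rewrite -[LHS]opprB -(telescope_sumr (fun i => i%:R^-1 : R) hZ) -sumrN.
  by rewrite big_add1 /=; apply: eq_bigr => i _; rewrite opprB.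
apply: ler_sum_nat => d /andP[wd _].
have d1 : (0 < d.-1)%N by lia.
have -> : d = d.-1.+1 by lia.
move: (d.-1) d1 => i i0 /=.
have h1 : (0 < i%:R :> R) by rewrite ltr0n.
rewrite -natr1; move: (i%:R : R) h1 => x x0.
have -> : x^-1 - (x + 1)^-1 = (x * (x + 1))^-1.
  by field; rewrite ?gt_eqF //; lra.
rewrite lef_pV2 ?posrE; [|nra|nra]; nra.
Qed.

(** For m coprime to w!, a repeated prime factor must exceed w. That lower bound on d is what makes
    the integers that are not squarefree negligible. *)
Lemma square_free_nm (z w m : nat) : (0 < m)%N -> (m < z)%N -> coprime m w`! ->
  (exists2 d, (w < d < z)%N & (d ^ 2 %| m)%N) \/
  (exists2 A : {set 'I_z}, A \subset prset z w & nm A = m).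
Proof.
move=> m0 mz co.
case: (pickP (fun p : 'I_z => prime p && (p ^ 2 %| m)%N)) => [p /andP[pp pm]|none].
  left; exists p => //; rewrite ltn_ord andbT -coprime_fact //.
  by apply: coprime_dvdl co; apply: dvdn_trans pm; rewrite expnS dvdn_mulr.
right; exists [set p : 'I_z | prime p & (p %| m)%N].
  apply/subsetP => p; rewrite !inE => /andP[pp pm]; rewrite pp /= -coprime_fact //.
  exact: coprime_dvdl co.
rewrite /nm {2}(prod_prime_decomp m0) prime_decompE big_map /=.
have e1 : (\prod_(p <- primes m) p ^ logn p m = \prod_(p <- primes m) p)%N.
  apply: eq_big_seq => p; rewrite mem_primes => /and3P[pp _ pm].
  have pz : (p < z)%N by apply: leq_ltn_trans mz; apply: dvdn_leq.
  have := none (Ordinal pz); rewrite /= pp /= pfactor_dvdn // => /negbT; rewrite -ltnNge ltnS => l1.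
  have : (0 < logn p m)%N by rewrite logn_gt0 mem_primes pp m0.
  by case: (logn p m) l1 => [|[]].
rewrite /= e1; rewrite (eq_bigl (fun p : 'I_z => (p : nat) \in primes m)); last first.
  by move=> p; rewrite !inE mem_primes m0.
rewrite -(big_mkord (fun i => i \in primes m) id) -big_filter; apply: perm_big.
apply: uniq_perm; rewrite ?filter_uniq ?iota_uniq ?primes_uniq // => p.
rewrite mem_filter mem_index_iota /=; case: (boolP (p \in primes m)) => //=.
by rewrite mem_primes => /and3P[pp _ pm]; rewrite (leq_ltn_trans _ mz) // dvdn_leq.
Qed.

(** Union bound over d > w for the integers that are not squarefree: since G is nondecreasing,
    multiples of d^2 carry at most a fraction 1/d^2 of the whole sum, and these fractions add up to
    at most 1/w. *)
Lemma msum_le_wsum_inv (z w : nat) (G : R -> R) (t : R) :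
  (0 < w)%N -> nneg_nondec G ->
  (1 - w%:R^-1) * msum w`! z G t <= wsum (prset z w) (fun p => p%:R^-1) G t.
Proof.
move=> w0 [G0 Gm]; set F := fun m : nat => if coprime m w`! then G (t - lg m) / m%:R else 0.
have F0 m : 0 <= F m by rewrite /F; case: ifP => // _; rewrite divr_ge0.
have msumE : msum w`! z G t = \sum_(0 <= m < z) F m by rewrite /msum big_mkcond.
have wsumE : wsum (prset z w) (fun p => p%:R^-1) G t = \sum_(A : {set 'I_z} | A \subset prset z w) F (nm A).
  by apply: eq_bigr => A AP; rewrite prod_div_nm mulrC /F coprime_nm_fact.
rewrite mulrBl mul1r lerBlDr msumE wsumE.
apply: (@le_trans _ _ (\sum_(0 <= m < z) ((\sum_(A : {set 'I_z} | A \subset prset z w) if nm A == m then F m else 0) +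
   \sum_(w.+1 <= d < z) if (d ^ 2 %| m)%N then F m else 0))).
  rewrite big_nat [leRHS]big_nat; apply: ler_sum => m /andP[_ mz].
  have p1 : 0 <= \sum_(A : {set 'I_z} | A \subset prset z w) (if nm A == m then F m else 0).
    by apply: sumr_ge0 => A _; case: ifP.
  have p2 : 0 <= \sum_(w.+1 <= d < z) (if (d ^ 2 %| m)%N then F m else 0).
    by apply: sumr_ge0 => A _; case: ifP.
  case: (boolP (coprime m w`!)) => co; last by rewrite {1}/F (negbTE co) addr_ge0.
  case: (posnP m) => m0; first by apply: (@le_trans _ _ 0); [rewrite /F m0 invr0 mulr0 if_same | exact: addr_ge0].
  case: (square_free_nm m0 mz co) => [[d wd dm]|[A AP Am]].
    rewrite (bigD1_seq d) ?iota_uniq ?mem_index_iota //= dm addrCA lerDl addr_ge0 //.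
    by apply: sumr_ge0 => ? _; case: ifP.
  rewrite (bigD1 A) //= Am eqxx -addrA lerDl addr_ge0 //.
  by apply: sumr_ge0 => ? _; case: ifP.
rewrite big_split /=; apply: lerD.
  rewrite exchange_big /=; apply: ler_sum => A AP.
  rewrite -big_mkcond /=; case: (ltnP (nm A) z) => h.
    rewrite (big_rem (nm A)) /=; last by rewrite mem_index_iota.
    rewrite eqxx big_seq_cond big1 ?addr0 // => m /andP[]; rewrite mem_rem_uniq ?iota_uniq //.
    by rewrite inE eq_sym => /andP[/negbTE h1 _]; rewrite h1.
  rewrite big_nat_cond big1 // => m /andP[/andP[_ mZ] /eqP e].
  by rewrite -e ltnNge h in mZ.
rewrite exchange_big /=.
have S0 : 0 <= \sum_(0 <= m < z) F m by apply: sumr_ge0.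
apply: le_trans (ler_wpM2r S0 (sum_invsq_le z w0)).
rewrite mulr_suml; apply: ler_sum_nat => d /andP[wd _].
have d0 : (0 < d)%N by lia.
rewrite -big_mkcond /=; apply: (le_trans (sum_dvd_le _ _ F0)); first by rewrite expn_gt0 d0.
rewrite mulr_sumr; apply: ler_sum => m _.
rewrite /F coprimeMl; case: (boolP (coprime m w`!)) => cm; last by rewrite andbF mulr0.
rewrite andbT; case: ifP => _; last by rewrite mulr_ge0 ?invr_ge0 ?exprn_ge0 // divr_ge0.
case: (posnP m) => m0; first by rewrite m0 muln0 invr0 !mulr0.
rewrite natrM natrX invfM mulrCA ler_wpM2l ?invr_ge0 ?exprn_ge0 // ler_wpM2r ?invr_ge0 //.
apply: Gm; rewrite lgM ?expn_gt0 ?d0 //.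
have := @lg_ge0 (d ^ 2)%N; rewrite expn_gt0 d0 => /(_ isT); lra.
Qed.

Lemma lg_unbounded (t : R) : exists2 Z : nat, (0 < Z)%N & t < lg Z.
Proof.
have [h _] := archimed (exp t).
have e0 := exp_pos t.
have u0 : Z.le Z0 (up (exp t)) by apply: le_IZR; apply: Rlt_le; apply: Rlt_trans h.
have e : INR (Z.to_nat (up (exp t))) = IZR (up (exp t)) by rewrite INR_IZR_INZ Z2Nat.id.
exists (Z.to_nat (up (exp t))).
  by apply/ssrnat.ltP; apply: INR_lt; rewrite e; apply: Rlt_trans h.
by apply/RltP; rewrite -{1}(ln_exp t) /lg; apply: ln_increasing => //; rewrite e.
Qed.

Lemma msum_mono (W Z : nat) (G G' : R -> R) (t : R) :
  (forall x, G x <= G' x) -> msum W Z G t <= msum W Z G' t.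
Proof. by move=> h; apply: ler_sum => m _; rewrite ler_wpM2r ?invr_ge0. Qed.

Lemma msum_scale (W Z : nat) (a : R) (G : R -> R) (t : R) :
  msum W Z (fun s => a * G s) t = a * msum W Z G t.
Proof. by rewrite /msum mulr_sumr; apply: eq_bigr => m _; rewrite mulrA. Qed.

Lemma wsum_scale (z : nat) (P : {set 'I_z}) (f : 'I_z -> R) (a : R) (G : R -> R) (t : R) :
  wsum P f (fun s => a * G s) t = a * wsum P f G t.
Proof. by rewrite /wsum mulr_sumr; apply: eq_bigr => m _; rewrite mulrCA. Qed.

Lemma wsum_sum (z n : nat) (P : {set 'I_z}) (f : 'I_z -> R) (G : 'I_n -> R -> R) (t : R) :
  wsum P f (fun s => \sum_(i < n) G i s) t = \sum_(i < n) wsum P f (G i) t.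
Proof.
rewrite /wsum exchange_big /=; apply: eq_bigr => A _; by rewrite mulr_sumr.
Qed.

Lemma wsum_eq (z : nat) (P : {set 'I_z}) (f f' : 'I_z -> R) (G G' : R -> R) (t : R) :
  {in P, f =1 f'} -> G =1 G' -> wsum P f G t = wsum P f' G' t.
Proof.
move=> ff GG; apply: eq_bigr => A AP; rewrite GG; congr (_ * _).
by apply: eq_bigr => p pA; apply/ff/(subsetP AP).
Qed.

Lemma wsum_f0 (z : nat) (P : {set 'I_z}) (G : R -> R) (t : R) :
  wsum P (fun=> 0) G t = G t.
Proof.
rewrite /wsum (bigD1 set0) ?sub0set //= big_set0 nm0 lg1 subr0 mul1r.
rewrite big1 ?addr0 // => A /andP[_ /set0Pn[p pA]].
by rewrite (bigD1 p pA) /= !mul0r.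
Qed.

(** * Sums of dimension k over sets of primes *)

Definition dens (w : nat) : R := (totient w`!)%:R / w`!%:R.
(** The enlargement of the argument in [msum_pw_le] for the modulus w!. It is constant once w is
    fixed, hence negligible against L. *)
Definition C1 (w : nat) : R := (2 * w`! * w`!)%:R / (totient w`!)%:R.

Lemma dens_gt0 (w : nat) : 0 < dens w.
Proof. by rewrite divr_gt0 // ltr0n ?totient_gt0 fact_gt0. Qed.

Lemma C1_ge0 (w : nat) : 0 <= C1 w.
Proof. by rewrite divr_ge0. Qed.

Lemma kp_ge0 (z : nat) (P : {set 'I_z}) (k : nat) : {in P, forall p : 'I_z, 0 <= k%:R / p%:R :> R}.
Proof. by move=> p _; rewrite divr_ge0. Qed.

Lemma inv_ge0 (z : nat) (P : {set 'I_z}) : {in P, forall p : 'I_z, 0 <= p%:R^-1 :> R}.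
Proof. by move=> p _; rewrite invr_ge0. Qed.

Lemma pw_neg (j : nat) (x : R) : x < 0 -> pw j x = 0.
Proof. by move=> x0; rewrite /pw leNgt x0. Qed.

(** Induction on k, splitting (k + 1)/p as 1/p + k/p. Each unit of density integrates the truncated
    power once more, at the price of one further shift [C1 w]; the quotient of factorials is the
    coefficient of the k-fold antiderivative of s^j. *)
Lemma dsum_pw_le (z w k j : nat) (P : {set 'I_z}) (t : R) : P \subset prset z w -> 0 <= t ->
  wsum P (fun p => k%:R / p%:R) (pw j) t <=
  dens w ^+ k * (j`!%:R / (j + k)`!%:R) * (t + k%:R * C1 w) ^+ (j + k).
Proof.
move=> PP; have d0 := ltW (dens_gt0 w); have C0 := C1_ge0 w.
elim: k t => [|k IH] t t0.
  rewrite (@wsum_eq _ _ _ (fun=> 0) _ (pw j)) => [|p _|//]; last by rewrite mul0r.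
  have f0 : (j`!%:R : R) != 0 by rewrite pnatr_eq0 -lt0n fact_gt0.
  by rewrite wsum_f0 /pw t0 addn0 expr0 mul0r addr0 divff // !mul1r.
have [Z Z0 tZ] := lg_unbounded t.
set a : R := dens w ^+ k * (j`!%:R / (j + k)`!%:R).
have a0 : 0 <= a by rewrite mulr_ge0 ?exprn_ge0 // divr_ge0.
rewrite (@wsum_eq _ _ _ (fun p => p%:R^-1 + k%:R / p%:R) _ (pw j)) => [|p _|//]; last first.
  by rewrite -natr1 mulrDl mul1r addrC.
apply: (le_trans (wsum_add_le _ PP (@inv_ge0 _ _) (@kp_ge0 _ _ k) (proj1 (pw_nneg_nondec j)))).
have Wn := wsum_nneg_nondec (@kp_ge0 _ P k) (pw_nneg_nondec j).
apply: (le_trans (wsum_inv_le PP Z0 tZ (proj1 Wn) (wsum_neg _ PP (@pw_neg j)))).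
apply: (@le_trans _ _ (msum w`! Z (fun s => a * (if 0 <= s then (s + k%:R * C1 w) ^+ (j + k) else 0)) t)).
  apply: msum_mono => x; case: (leP 0 x) => x0; first exact: IH.
  by rewrite (wsum_neg _ PP (@pw_neg j)) // mulr0.
rewrite msum_scale.
have kC0 : 0 <= k%:R * C1 w by rewrite mulr_ge0.
have := msum_pw_le Z (j + k) (fact_gt0 w) t0 kC0; rewrite -/(dens w) -/(C1 w) => h.
apply: (le_trans (ler_wpM2l a0 h)).
rewrite le_eqVlt; apply/orP; left; apply/eqP.
have -> : t + k%:R * C1 w + C1 w = t + k.+1%:R * C1 w by rewrite -natr1; ring.
rewrite addnS mulrA; congr (_ * _); rewrite /a factS natrM exprSr.
have h1 : ((j + k)`!%:R : R) != 0 by rewrite pnatr_eq0 -lt0n fact_gt0.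
have h2 : ((j + k).+1%:R : R) != 0 by rewrite pnatr_eq0.
move: ((j + k)`!%:R : R) ((j + k).+1%:R : R) (j`!%:R : R) (dens w ^+ k) h1 h2 => x1 x2 x3 x4 h1 h2.
by field; do ?[apply/andP; split].
Qed.

Lemma sum_prset_invsq_le (z w : nat) : (0 < w)%N ->
  \sum_(p in prset z w) ((p%:R : R) ^+ 2)^-1 <= w%:R^-1.
Proof.
move=> w0; apply: le_trans (sum_invsq_le z w0).
rewrite (eq_bigl (fun p : 'I_z => prime p && (w < p)%N)) => [|p]; last by rewrite inE.
rewrite -(big_mkord (fun p => prime p && (w < p)%N) (fun p => (p%:R ^+ 2)^-1 : R)).
case: (leqP z w.+1) => zw.
  rewrite big_nat_cond big1 => [|p /andP[/andP[_ pz] /andP[_ wp]]]; last by lia.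
  by rewrite sumr_ge0 // => p _; rewrite invr_ge0 exprn_ge0.
rewrite (big_cat_nat (leq0n w.+1) (ltnW zw)) /= big_nat_cond big1 => [|p /andP[/andP[_ pz] /andP[_ wp]]]; last by lia.
rewrite add0r big_mkcond /=; apply: ler_sum => p _; case: ifP => // _.
by rewrite invr_ge0 exprn_ge0.
Qed.

(** The same induction from below. Passing from k to k + 1 loses k/w for primes shared by the two
    factors and 1/w for integers that are not squarefree, together at most K/w. Fixing K in advance
    makes the loss the same at each step. *)
Lemma dsum_pw_ge (z w K k j : nat) (C t : R) : (1 < w)%N -> (k <= K)%N -> (K <= w)%N ->
  t < lg z -> (0 < z)%N -> 0 <= C ->
  (1 - K%:R / w%:R) ^+ k * (dens w ^+ k * (j`!%:R / (j + k)`!%:R)) *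
     pw (j + k) (t - C - k%:R * lg w`!) <=
  wsum (prset z w) (fun p => k%:R / p%:R) (fun s => pw j (s - C)) t.
Proof.
move=> w1 kK Kw tz z0 C0; have w0 := ltnW w1; have d0 := ltW (dens_gt0 w).
have W1 : (1 < w`!)%N by apply: leq_trans w1 _; rewrite dvdn_leq ?fact_gt0 ?dvdn_fact // w0 leqnn.
have wR : (0 < w%:R :> R) by rewrite ltr0n.
have K1 : 0 <= 1 - K%:R / w%:R :> R by rewrite subr_ge0 ler_pdivrMr // mul1r ler_nat.
have lW : 0 <= lg w`! by apply/lg_ge0/fact_gt0.
have Gn := nneg_nondec_shift C (pw_nneg_nondec j).
elim: k kK t tz => [|k IH] kK t tz.
  rewrite (@wsum_eq _ _ _ (fun=> 0) _ (fun s => pw j (s - C))) => [|p _|//]; last by rewrite mul0r.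
  have f0 : (j`!%:R : R) != 0 by rewrite pnatr_eq0 -lt0n fact_gt0.
  by rewrite wsum_f0 addn0 !expr0 mul0r subr0 divff // !mul1r.
set D := (fun s => wsum (prset z w) (fun p => k%:R / p%:R) (fun s => pw j (s - C)) s).
have Dn : nneg_nondec D := wsum_nneg_nondec (@kp_ge0 _ _ k) Gn.
rewrite (@wsum_eq _ _ _ (fun p => p%:R^-1 + k%:R / p%:R) _ (fun s => pw j (s - C))) => [|p _|//]; last first.
  by rewrite -[in LHS]natr1 mulrDl mul1r addrC.
apply: le_trans (wsum_add_ge t (subxx _) (@inv_ge0 _ _) (@kp_ge0 _ _ k) Gn).
rewrite -/D.
have Ms0 : 0 <= msum w`! z D t.
  by apply: sumr_ge0 => m _; rewrite divr_ge0 //; case: Dn.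
have s1 : \sum_(p in prset z w) p%:R^-1 * (k%:R / p%:R) <= k%:R / w%:R :> R.
  apply: le_trans (ler_wpM2l (ler0n _ k) (sum_prset_invsq_le z w0)).
  rewrite mulr_sumr; apply: ler_sum => p _; rewrite expr2 invfM; rewrite le_eqVlt; apply/orP; left; apply/eqP; ring.
have s2 := msum_le_wsum_inv z t w0 Dn.
have kw : k.+1%:R / w%:R <= K%:R / w%:R :> R by rewrite ler_wpM2r ?invr_ge0 // ler_nat.
have kw0 : 0 <= k%:R / w%:R :> R by rewrite divr_ge0.
have wi0 : 0 <= w%:R^-1 :> R by rewrite invr_ge0.
have kS : k.+1%:R / w%:R = k%:R / w%:R + w%:R^-1 :> R by rewrite -natr1 mulrDl mul1r.
apply: (@le_trans _ _ ((1 - K%:R / w%:R) * msum w`! z D t)); last first.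
  apply: (@le_trans _ _ ((1 - k%:R / w%:R) * ((1 - w%:R^-1) * msum w`! z D t))).
    rewrite mulrA ler_wpM2r //; move: kw0 wi0 kw K1; rewrite kS.
    by move: (k%:R / w%:R : R) (w%:R^-1 : R) (K%:R / w%:R : R) => x1 x2 x3; nra.
  have wsn : 0 <= wsum (prset z w) (fun p => p%:R^-1) D t.
    by apply: (proj1 (wsum_nneg_nondec (@inv_ge0 _ _) Dn)).
  apply: (@le_trans _ _ ((1 - k%:R / w%:R) * wsum (prset z w) (fun p => p%:R^-1) D t)).
    apply: ler_wpM2l => //; move: kw0 wi0 kw K1; rewrite kS.
    by move: (k%:R / w%:R : R) (w%:R^-1 : R) (K%:R / w%:R : R) => x1 x2 x3; lra.
  by apply: ler_wpM2r => //; rewrite lerB.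
rewrite exprS -!mulrA ler_wpM2l //.
set a : R := (1 - K%:R / w%:R) ^+ k * (dens w ^+ k * (j`!%:R / (j + k)`!%:R)).
have a0 : 0 <= a by rewrite !mulr_ge0 ?exprn_ge0 // invr_ge0.
have C'0 : 0 <= C + k%:R * lg w`! by rewrite addr_ge0 // mulr_ge0.
apply: (@le_trans _ _ (a * msum w`! z (fun s => pw (j + k) (s - (C + k%:R * lg w`!))) t)); last first.
  rewrite -msum_scale /msum big_nat_cond [leRHS]big_nat_cond; apply: ler_sum => m /andP[/andP[_ mz] cm].
  rewrite ler_wpM2r ?invr_ge0 // opprD addrA; apply: IH; first exact: ltnW.
  have m0 : (0 < m)%N.
    by case: m cm {mz} => //; rewrite /coprime gcd0n => /eqP e; rewrite e in W1.
  by have := lg_ge0 m0; lra.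
have := msum_pw_ge (j + k) W1 tz C'0 z0; rewrite -/(dens w) => h.
apply: le_trans (ler_wpM2l a0 h).
have -> : t - (C + k%:R * lg w`!) - lg w`! = t - C - k.+1%:R * lg w`!.
  by rewrite -[in RHS]natr1; ring.
rewrite addnS le_eqVlt; apply/orP; left; apply/eqP.
rewrite /a factS natrM exprSr.
have h1 : ((j + k)`!%:R : R) != 0 by rewrite pnatr_eq0 -lt0n fact_gt0.
have h2 : ((j + k).+1%:R : R) != 0 by rewrite pnatr_eq0.
move: (pw _ _) ((j + k)`!%:R : R) ((j + k).+1%:R : R) (j`!%:R : R) (dens w ^+ k) ((1 - _) ^+ k) h1 h2 => x0 x1 x2 x3 x4 x5 h1 h2.
by field; do ?[apply/andP; split].
Qed.

(** The excess of k/(p - k) over k/p is k^2 / (p (p - k)), at most 2 k^2 / p^2 when p >= 2k, and the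
    sum of 1/p^2 over p > w is at most 1/w. So the exact density of the diagonal form may be
    exchanged for k/p. *)
Lemma hsum_le (z w k : nat) (P : {set 'I_z}) (G : R -> R) (t : R) :
  P \subset prset z w -> (0 < w)%N -> (2 * k <= w)%N -> nneg_nondec G ->
  (1 - (2 * k * k)%:R / w%:R) * wsum P (fun p => k%:R / (p%:R - k%:R)) G t <=
  wsum P (fun p => k%:R / p%:R) G t.
Proof.
move=> PP w0 kw Gn; have wR : (0 < w%:R :> R) by rewrite ltr0n.
have wp p : p \in P -> (w < p)%N by move=> /(subsetP PP); rewrite inE => /andP[].
pose e (p : 'I_z) : R := k%:R ^+ 2 / (p%:R * (p%:R - k%:R)).
have pk p : p \in P -> (2%:R * k%:R <= p%:R :> R) /\ (0 < p%:R :> R).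
  by move=> /wp hp; split; [rewrite -natrM ler_nat; lia | rewrite ltr0n; lia].
have k0 : 0 <= k%:R :> R by [].
have e0 : {in P, forall p, 0 <= e p}.
  move=> p /pk [h1 h2]; rewrite /e divr_ge0 ?exprn_ge0 // mulr_ge0 //; lra.
have e1 : {in P, forall p : 'I_z, e p <= (2 * k * k)%:R * ((p%:R : R) ^+ 2)^-1}.
  move=> p /pk [h1 h2]; rewrite /e !natrM expr2 ler_pdivrMr; last by nra.
  have -> : 2 * k%:R * k%:R * (p%:R ^+ 2)^-1 * (p%:R * (p%:R - k%:R)) = k%:R * k%:R * (2 * (p%:R - k%:R) / p%:R) :> R.
    by field; rewrite gt_eqF.
  rewrite ler_peMr ?mulr_ge0 // ler_pdivlMr //; lra.
rewrite (@wsum_eq _ _ _ (fun p => e p + k%:R / p%:R) _ G) => [|p pP|//]; last first.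
  have [h1 h2] := pk p pP; rewrite /e.
  case: (posnP k) => [->|kp]; first by rewrite expr0n /= !mul0r addr0.
  have kp' : (0 < k%:R :> R) by rewrite ltr0n.
  by field; rewrite ?gt_eqF //; lra.
set F := wsum P (fun p => k%:R / p%:R) G.
have Fn : nneg_nondec F := wsum_nneg_nondec (@kp_ge0 _ _ k) Gn.
have W0 : 0 <= wsum P (fun p => e p + k%:R / p%:R) G t.
  apply: (proj1 (wsum_nneg_nondec _ Gn)) => p pP; rewrite addr_ge0 ?e0 // divr_ge0 //.
have Wle : wsum P (fun p => e p + k%:R / p%:R) G t <= \prod_(p in P) (1 + e p) * F t.
  apply: (le_trans (wsum_add_le _ PP e0 (@kp_ge0 _ _ k) (proj1 Gn))).
  exact: (wsum_prod_le t PP e0 Fn).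
have E := prod_add1_le e0.
have sE : \sum_(p in P) e p <= (2 * k * k)%:R / w%:R.
  apply: le_trans (ler_wpM2l (ler0n _ _) (sum_prset_invsq_le z w0)).
  rewrite mulr_sumr [leRHS](bigID (fun p => p \in P)) /=.
  rewrite [X in _ <= X + _](eq_bigl (fun p => p \in P)) => [|p]; last first.
    by case: (boolP (p \in P)) => pP; rewrite ?andbF // andbT (subsetP PP).
  apply: (@le_trans _ _ (\sum_(p in P) (2 * k * k)%:R * ((p%:R : R) ^+ 2)^-1)).
    exact: ler_sum.
  by rewrite lerDl sumr_ge0 // => p _; rewrite mulr_ge0 // invr_ge0 exprn_ge0.
case: (leP 0 (1 - (2 * k * k)%:R / w%:R : R)) => [h|h]; last first.
  apply: (@le_trans _ _ 0); last by case: Fn.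
  by rewrite mulr_le0_ge0 // ltW.
apply: (le_trans (ler_wpM2l h Wle)).
have F0 : 0 <= F t by case: Fn.
rewrite mulrA ler_piMl // mulrC.
apply: le_trans E; rewrite ler_wpM2l //; last by rewrite lerB.
by apply: prodr_ge0 => p /e0; lra.
Qed.

(** * The main quadratic forms *)

(* [a 0 + a 1 (t/L) + a 2 (t/L)^2] for [t >= 0], the jump at [0] being replaced by a
   ramp of length [dl * L] so that the function is Lipschitz. *)
Definition Yf (a : nat -> R) (dl L t : R) : R :=
  if 0 <= t then a 0%N * Num.min 1 (t / (dl * L)) + a 1%N * (t / L) + a 2%N * (t / L) ^+ 2
  else 0.

(** With P the polynomial with coefficients [a] and k >= 1, this is the integral over [0, 1] of
    P(u)^2 (1 - u)^(k-1) / (k-1)!, written out by the Beta integral. *)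
Definition A0 (k : nat) (a : nat -> R) : R :=
  \sum_(i < 3) \sum_(j < 3) a i * a j * ((i + j)`!%:R / (i + j + k)`!%:R).

(** For k >= 2, the integral over [0, 1] of Q(u)^2 (1 - u)^(k-2) / (k-2)!, where Q is the
    antiderivative of P vanishing at 0. The exponent k - 2 reflects that a prime member leaves only
    k - 1 members to be sieved. *)
Definition B0 (k : nat) (a : nat -> R) : R :=
  \sum_(i < 3) \sum_(j < 3)
    a i * a j / (i.+1%:R * j.+1%:R) * ((i + j + 2)`!%:R / (i + j + k + 1)`!%:R).

Lemma Yf_nneg_nondec (a : nat -> R) (dl L : R) :
  (forall i, 0 <= a i) -> 0 < dl -> 0 < L -> nneg_nondec (Yf a dl L).
Proof.
move=> a0 d0 L0; have dL : 0 < dl * L by rewrite mulr_gt0.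
have pos x : 0 <= x -> 0 <= a 0%N * Num.min 1 (x / (dl * L)) + a 1%N * (x / L) + a 2%N * (x / L) ^+ 2.
  move=> x0; have h : 0 <= x / L by rewrite divr_ge0 // ltW.
  have Li : 0 <= L^-1 by rewrite invr_ge0 ltW.
  have Di : 0 <= Num.min 1 (x / (dl * L)) by rewrite le_min ler01 divr_ge0 // ltW.
  by rewrite !addr_ge0 ?mulr_ge0 ?exprn_ge0.
split=> [x|x y xy]; rewrite /Yf; first by case: ifP => // x0; apply: pos.
case: (leP 0 x) => x0; last by case: ifP => // y0; apply: pos.
rewrite (le_trans x0 xy).
have h : x / L <= y / L by rewrite ler_pM2r ?invr_gt0.
have h0 : 0 <= x / L by rewrite divr_ge0 // ltW.
rewrite !lerD // ler_wpM2l //.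
  by rewrite le_min !ge_min lexx /= ler_pM2r ?invr_gt0 // xy orbT.
by rewrite lerXn2r ?nnegrE // (le_trans h0 h).
Qed.

Lemma Yf_neg (a : nat -> R) (dl L x : R) : x < 0 -> Yf a dl L x = 0.
Proof. by move=> x0; rewrite /Yf leNgt x0. Qed.

Lemma Yf_le (a : nat -> R) (dl L t : R) : (forall i, 0 <= a i) ->
  Yf a dl L t <= \sum_(i < 3) a i / L ^+ i * pw i t.
Proof.
move=> a0; rewrite !big_ord_recr big_ord0 /= add0r /Yf /pw; case: ifP => t0; last by rewrite !mulr0 !addr0.
rewrite !expr0 !expr1 divr1 mulr1 expr_div_n.
have h : a 0%N * Num.min 1 (t / (dl * L)) <= a 0%N.
  by rewrite ler_piMr // ge_min lexx.
have -> : a 1%N / L * t = a 1%N * (t / L) by ring.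
have -> : a 2%N / L ^+ 2 * t ^+ 2 = a 2%N * (t ^+ 2 / L ^+ 2) by ring.
by rewrite !lerD2r.
Qed.

(** Moving the argument back by [dl * L] compares the polynomial only with points beyond the ramp,
    where the minimum equals 1. *)
Lemma Yf_ge (a : nat -> R) (dl L t : R) : (forall i, 0 <= a i) -> 0 < dl -> 0 < L ->
  \sum_(i < 3) a i / L ^+ i * pw i (t - dl * L) <= Yf a dl L t.
Proof.
move=> a0 d0 L0; have dL : 0 < dl * L by rewrite mulr_gt0.
have Yn := Yf_nneg_nondec a0 d0 L0.
rewrite !big_ord_recr big_ord0 /= add0r /pw; case: (leP 0 (t - dl * L)) => ht; last first.
  by rewrite !mulr0 !addr0; case: Yn.
have t0 : 0 <= t by lra.
rewrite /Yf t0.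
have -> : Num.min 1 (t / (dl * L)) = 1.
  by apply/min_idPl; rewrite ler_pdivlMr // mul1r; lra.
rewrite !expr0 !expr1 divr1 !mulr1 expr_div_n.
have -> : a 1%N / L * (t - dl * L) = a 1%N * ((t - dl * L) / L) by ring.
have -> : a 2%N / L ^+ 2 * (t - dl * L) ^+ 2 = a 2%N * ((t - dl * L) ^+ 2 / L ^+ 2) by ring.
rewrite !lerD // ler_wpM2l // ler_pM2r ?invr_gt0 ?exprn_gt0 //; first lra.
by rewrite lerXn2r ?nnegrE //; lra.
Qed.

Definition Lip (a : nat -> R) (dl : R) : R := a 0%N / dl + a 1%N + 2 * a 2%N.

(** In the variable s/L the ramp has slope 1/dl, and [s <= L] keeps the slope of the square below 2.
    The constant [Lip] grows without bound as [dl] tends to 0 (when [a 0] is not zero), so [dl] has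
    to be fixed before c. *)
Lemma Yf_lip (a : nat -> R) (dl L s x : R) : (forall i, 0 <= a i) -> 0 < dl -> 0 < L ->
  0 <= x -> s <= L ->
  0 <= Yf a dl L s - Yf a dl L (s - x) <= Lip a dl * (x / L) * pw 0 s.
Proof.
move=> a0 d0 L0 x0 sL; have dL : 0 < dl * L by rewrite mulr_gt0.
have [Y0 Ym] := Yf_nneg_nondec a0 d0 L0.
rewrite subr_ge0 Ym ?gerBl //=.
have xL : 0 <= x / L by rewrite divr_ge0 // ltW.
have xd : 0 <= x / (dl * L) by rewrite divr_ge0 // ltW.
rewrite /pw; case: (leP 0 s) => s0; last first.
  by rewrite !Yf_neg ?subr0 ?mulr0 //; lra.
rewrite expr0 mulr1.
have e1 : a 0%N / dl * (x / L) = a 0%N * (x / (dl * L)).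
  by rewrite invfM; ring.
have sL1 : s / L <= 1 by rewrite ler_pdivrMr // mul1r.
have sL0 : 0 <= s / L by rewrite divr_ge0 // ltW.
have m1 : Num.min 1 (s / (dl * L)) <= s / (dl * L) by rewrite ge_min lexx orbT.
have m2 : Num.min 1 (s / (dl * L)) <= 1 by rewrite ge_min lexx.
have a00 := a0 0%N; have a10 := a0 1%N; have a20 := a0 2%N.
have -> : Lip a dl * (x / L) = a 0%N * (x / (dl * L)) + a 1%N * (x / L) + 2 * a 2%N * (x / L).
  by rewrite -e1 /Lip; ring.
rewrite /Yf s0; case: (leP 0 (s - x)) => sx.
  have -> : (s - x) / (dl * L) = s / (dl * L) - x / (dl * L) by rewrite mulrBl.
  have -> : (s - x) / L = s / L - x / L by rewrite mulrBl.
  have q0 : 0 <= s / L - x / L by rewrite -mulrBl divr_ge0 // ltW.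
  have mm : Num.min 1 (s / (dl * L)) - Num.min 1 (s / (dl * L) - x / (dl * L)) <= x / (dl * L).
    rewrite lerBlDr -lerBlDl le_min; apply/andP; split; lra.
  have := ler_wpM2l a00 mm.
  have : a 2%N * (s / L) ^+ 2 - a 2%N * (s / L - x / L) ^+ 2 <= 2 * a 2%N * (x / L).
    have -> : a 2%N * (s / L) ^+ 2 - a 2%N * (s / L - x / L) ^+ 2 =
      a 2%N * (2 * (s / L) * (x / L) - (x / L) ^+ 2) by ring.
    have -> : 2 * a 2%N * (x / L) = a 2%N * (2 * (x / L)) by ring.
    apply: ler_wpM2l => //; move: (s / L) (x / L) sL1 sL0 xL q0 => u v *; nra.
  rewrite [a 0%N * (_ - _)]mulrBr [a 1%N * (s / L - _)]mulrBr.
  move: (a 0%N * Num.min 1 (s / (dl * L))) (a 0%N * Num.min _ _) (a 0%N * _).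
  move: (a 2%N * _ ^+ 2) (a 2%N * _ ^+ 2) (2 * a 2%N * _) (a 1%N * _) (a 1%N * _).
  move=> *; lra.
have sx' : s / L <= x / L by rewrite ler_pM2r ?invr_gt0 //; lra.
have sd' : s / (dl * L) <= x / (dl * L) by rewrite ler_pM2r ?invr_gt0 //; lra.
rewrite subr0.
have h0 := ler_wpM2l a00 (le_trans m1 sd').
have h1 := ler_wpM2l a10 sx'.
have h2 : a 2%N * (s / L) ^+ 2 <= 2 * a 2%N * (x / L).
  have -> : 2 * a 2%N * (x / L) = a 2%N * (2 * (x / L)) by ring.
  apply: ler_wpM2l => //; move: (s / L) (x / L) sL1 sL0 xL sx' => u v *; nra.
exact: lerD (lerD h0 h1) h2.
Qed.

Lemma wsum_le_upto (z w : nat) (P : {set 'I_z}) (f f' : 'I_z -> R) (G G' : R -> R) (t : R) :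
  P \subset prset z w ->
  {in P, forall p, 0 <= f p <= f' p} -> (forall x, x <= t -> 0 <= G x <= G' x) ->
  wsum P f G t <= wsum P f' G' t.
Proof.
move=> PP ff GG; apply: ler_sum => A AP.
have f0 : {in P, forall p, 0 <= f p} by move=> p /ff /andP[].
have [|G0 G1] := andP (GG (t - lg (nm A)) _).
  by have := lg_nm_ge0 (subset_trans AP PP); lra.
apply: ler_pM => //; first exact: (prodr_ge0_in f0).
by apply: ler_prod => p pA; apply/ff/(subsetP AP).
Qed.

Lemma nneg_nondec_sq (G : R -> R) : nneg_nondec G -> nneg_nondec (fun s => G s ^+ 2).
Proof.
move=> [G0 Gm]; split=> [x|x y xy]; first by rewrite exprn_ge0.
by rewrite lerXn2r ?nnegrE // Gm.
Qed.

Lemma pwM (i j : nat) (x : R) : pw i x * pw j x = pw (i + j) x.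
Proof. by rewrite /pw; case: ifP => _; rewrite ?exprD // mulr0. Qed.

(** The ramp is dropped, the square is expanded into truncated powers, and [dsum_pw_le] evaluates
    each of them. The relative shift is at most [et], and k + 4 is the largest exponent i + j +
    k. *)
Lemma form0_le (z w k : nat) (P : {set 'I_z}) (a : nat -> R) (dl L et : R) :
  P \subset prset z w -> (0 < w)%N -> (2 * k <= w)%N ->
  (forall i, 0 <= a i) -> 0 < dl -> 0 < L -> 0 <= et -> k%:R * C1 w <= et * L ->
  (1 - (2 * k * k)%:R / w%:R) *
    wsum P (fun p => k%:R / (p%:R - k%:R)) (fun s => Yf a dl L s ^+ 2) L <=
  dens w ^+ k * L ^+ k * (1 + et) ^+ (k + 4) * A0 k a.
Proof.
move=> PP w0 kw a0 d0 L0 e0 hL; have dn := ltW (dens_gt0 w).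
have Yn := Yf_nneg_nondec a0 d0 L0.
apply: (le_trans (hsum_le _ PP w0 kw (nneg_nondec_sq Yn))).
apply: (@le_trans _ _ (wsum P (fun p => k%:R / p%:R)
  (fun s => \sum_(i < 3) \sum_(j < 3) a i * a j / L ^+ (i + j) * pw (i + j) s) L)).
  apply: wsum_le => [p _|x]; first by rewrite lexx divr_ge0.
  rewrite exprn_ge0 /=; last by case: Yn.
  apply: (@le_trans _ _ ((\sum_(i < 3) a i / L ^+ i * pw i x) ^+ 2)).
    rewrite lerXn2r ?nnegrE; [|by case: Yn| |exact: Yf_le].
      by rewrite //.
    by apply: le_trans (Yf_le dl L x a0); case: Yn.
  rewrite expr2 mulr_suml le_eqVlt; apply/orP; left; apply/eqP; apply: eq_bigr => i _.
  rewrite mulr_sumr; apply: eq_bigr => j _; rewrite -pwM exprD invfM; ring.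
rewrite wsum_sum /A0 mulr_sumr; apply: ler_sum => i _.
rewrite wsum_sum mulr_sumr; apply: ler_sum => j _.
rewrite wsum_scale.
have aij : 0 <= a i * a j by rewrite mulr_ge0.
have Lij : 0 < L ^+ (i + j) by rewrite exprn_gt0.
have f0 : 0 <= ((i + j)`!%:R / (i + j + k)`!%:R : R) by rewrite divr_ge0.
apply: (le_trans (ler_wpM2l _ (dsum_pw_le k (i + j) PP (ltW L0)))); first by rewrite divr_ge0 // ltW.
have -> : a i * a j / L ^+ (i + j) * (dens w ^+ k * ((i + j)`!%:R / (i + j + k)`!%:R) *
   (L + k%:R * C1 w) ^+ (i + j + k)) = (a i * a j * ((i + j)`!%:R / (i + j + k)`!%:R)) *
   (dens w ^+ k * ((L + k%:R * C1 w) ^+ (i + j + k) / L ^+ (i + j))) by ring.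
rewrite [leRHS]mulrC; apply: ler_wpM2l; first exact: mulr_ge0.
rewrite -mulrA; apply: ler_wpM2l; first exact: exprn_ge0.
rewrite ler_pdivrMr // mulrAC -exprD.
have -> : L ^+ (k + (i + j)) = L ^+ (i + j + k) by rewrite addnC.
apply: (@le_trans _ _ ((L * (1 + et)) ^+ (i + j + k))).
  apply: lerXn2r; rewrite ?nnegrE.
  - by rewrite addr_ge0 ?(ltW L0) // mulr_ge0 // C1_ge0.
  - by rewrite mulr_ge0 ?(ltW L0) // addr_ge0.
  - by rewrite mulrDr mulr1 lerD2l [L * et]mulrC.
rewrite exprMn; apply: ler_wpM2l; first by rewrite exprn_ge0 // ltW.
by apply: ler_weXn2l; [lra | have := ltn_ord i; have := ltn_ord j; lia].
Qed.

(** Here k is one less than the size of the tuple. The inner sum of density 1/p integrates the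
    cut-off once; its square brings two of the factors [dens w], and the outer sum of dimension k
    brings the others. The shifts, [dl * L] for the ramp and k + 1 times [lg w!], stay within 2 dl
    L. *)
Lemma form1_ge (z w k : nat) (a : nat -> R) (dl L : R) :
  (1 < w)%N -> (k.+1 <= w)%N -> (0 < z)%N -> L < lg z ->
  (forall i, 0 <= a i) -> 0 < dl -> 2 * dl <= 1 -> 0 < L -> k.+1%:R * lg w`! <= dl * L ->
  (1 - k.+1%:R / w%:R) ^+ k.+2 * (1 - 2 * dl) ^+ (k + 6) *
    (dens w ^+ k.+2 * L ^+ k.+2) * B0 k.+1 a <=
  wsum (prset z w) (fun p => k%:R / p%:R)
    (fun s => wsum (prset z w) (fun p => p%:R^-1) (Yf a dl L) s ^+ 2) L.
Proof.
have n1 (x y : nat) : (x + y + k.+1 + 1 = x + y + 2 + k)%N by lia.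
have n2 (x y : nat) : (x + y + 2 + k = x + y + k.+2)%N by lia.
have n3 (x y : 'I_3) : (x + y + 2 + k <= k + 6)%N.
  by have := ltn_ord x; have := ltn_ord y; lia.
have n4 (x y : nat) : (x + y + 2 = x.+1 + y.+1)%N by lia.
move=> w1 kw z0 Lz a0 d0 d1 L0 hL; have dn := ltW (dens_gt0 w).
have Yn := Yf_nneg_nondec a0 d0 L0.
have wR : (0 < w%:R :> R) by rewrite ltr0n ltnW.
set kap : R := 1 - k.+1%:R / w%:R.
have K1 : 0 <= kap by rewrite subr_ge0 ler_pdivrMr // mul1r ler_nat.
have lW : 0 <= lg w`! by apply/lg_ge0/fact_gt0.
have dL0 : 0 <= dl * L by rewrite mulr_ge0 // ltW.
set C := dl * L + lg w`!; have C0 : 0 <= C by rewrite addr_ge0.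
have step1 s : s <= L -> kap * dens w * \sum_(i < 3) a i / L ^+ i / i.+1%:R * pw i.+1 (s - C) <=
    wsum (prset z w) (fun p => p%:R^-1) (Yf a dl L) s.
  move=> sL.
  apply: (@le_trans _ _ (wsum (prset z w) (fun p => 1%:R / p%:R)
     (fun s => \sum_(i < 3) a i / L ^+ i * pw i (s - dl * L)) s)); last first.
    apply: wsum_le => [p _|x]; first by rewrite mul1r lexx invr_ge0 ler0n.
    rewrite Yf_ge // andbT; apply: sumr_ge0 => i _; rewrite mulr_ge0 //; last by case: (pw_nneg_nondec i).
    by rewrite divr_ge0 // exprn_ge0 // ltW.
  rewrite wsum_sum mulr_sumr; apply: ler_sum => i _; rewrite wsum_scale.
  have sz : s < lg z by apply: le_lt_trans Lz.
  have := dsum_pw_ge i w1 (ltn0Sn k) kw sz z0 dL0; rewrite !expr1 mul1r addn1 -/kap => h.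
  have ai : 0 <= a i / L ^+ i by rewrite divr_ge0 // exprn_ge0 // ltW.
  apply: le_trans (ler_wpM2l ai h).
  have -> : s - dl * L - lg w`! = s - C by rewrite /C; ring.
  rewrite le_eqVlt; apply/orP; left; apply/eqP; rewrite factS natrM.
  have h1 : (i`!%:R : R) != 0 by rewrite pnatr_eq0 -lt0n fact_gt0.
  have h2 : (i.+1%:R : R) != 0 by rewrite pnatr_eq0.
  have h3 : L ^+ i != 0 by rewrite gt_eqF // exprn_gt0.
  move: (pw _ _) (i`!%:R : R) (i.+1%:R : R) (L ^+ i) h1 h2 h3 => x0 x1 x2 x3 h1 h2 h3.
  by field; do ?[apply/andP; split].
apply: (@le_trans _ _ (wsum (prset z w) (fun p => k%:R / p%:R)
  (fun s => \sum_(i < 3) \sum_(j < 3) (kap ^+ 2 * dens w ^+ 2 * (a i * a j / (i.+1%:R * j.+1%:R)) / L ^+ (i + j)) *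
     pw (i + j + 2) (s - C)) L)); last first.
  (* The inner bound is available only for arguments up to L. This is enough, because logarithms of
     divisors are nonnegative. *)
  apply: (wsum_le_upto (subxx _)) => [p _|x xL]; first by rewrite lexx divr_ge0.
  have -> : \sum_(i < 3) \sum_(j < 3) (kap ^+ 2 * dens w ^+ 2 * (a i * a j / (i.+1%:R * j.+1%:R)) / L ^+ (i + j)) *
     pw (i + j + 2) (x - C) = (kap * dens w * \sum_(i < 3) a i / L ^+ i / i.+1%:R * pw i.+1 (x - C)) ^+ 2.
    set S := (X in _ = (_ * X) ^+ 2).
    have -> : (kap * dens w * S) ^+ 2 = kap ^+ 2 * dens w ^+ 2 * (S * S) by ring.
    rewrite {1}/S mulr_suml mulr_sumr; apply: eq_bigr => i _.
    rewrite /S !mulr_sumr; apply: eq_bigr => j _.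
    rewrite n4.
    rewrite -pwM exprD !invfM.
    move: (pw i.+1 _) (pw j.+1 _) (i.+1%:R^-1) (j.+1%:R^-1) (_ ^- i) (_ ^- j) => *; ring.
  rewrite exprn_even_ge0 //= lerXn2r ?nnegrE ?step1 //.
    apply: mulr_ge0; first exact: mulr_ge0.
    apply: sumr_ge0 => i _.
    by rewrite mulr_ge0 ?divr_ge0 ?exprn_ge0 ?(ltW L0) //; case: (pw_nneg_nondec i.+1).
  by apply: (proj1 (wsum_nneg_nondec (@inv_ge0 _ _) Yn)).
rewrite wsum_sum /B0 mulr_sumr; apply: ler_sum => i _.
rewrite wsum_sum mulr_sumr; apply: ler_sum => j _.
rewrite wsum_scale.
have aij : 0 <= a i * a j / (i.+1%:R * j.+1%:R) by rewrite divr_ge0 ?mulr_ge0.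
set co := kap ^+ 2 * _ * _ / _.
have co0 : 0 <= co.
  by rewrite /co divr_ge0 ?exprn_ge0 ?(ltW L0) // mulr_ge0 // mulr_ge0 // exprn_ge0.
have := dsum_pw_ge (i + j + 2) w1 (leqnSn k) kw Lz z0 C0; rewrite -/kap => h.
apply: le_trans (ler_wpM2l co0 h).
have hp : ((1 - 2 * dl) * L) ^+ (i + j + 2 + k) <= pw (i + j + 2 + k) (L - C - k%:R * lg w`!).
  have hL' : (1 - 2 * dl) * L <= L - C - k%:R * lg w`!.
    by rewrite /C; move: hL; rewrite -natr1 mulrDl mul1r; lra.
  have p0 : 0 <= (1 - 2 * dl) * L by rewrite mulr_ge0 ?(ltW L0) //; lra.
  by rewrite /pw (le_trans p0 hL') lerXn2r ?nnegrE // (le_trans p0 hL').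
have m0 : 0 <= kap ^+ k * (dens w ^+ k * ((i + j + 2)`!%:R / (i + j + 2 + k)`!%:R)).
  by rewrite mulr_ge0 ?exprn_ge0 // mulr_ge0 ?exprn_ge0 // divr_ge0.
apply: le_trans (ler_wpM2l co0 (ler_wpM2l m0 hp)).
rewrite n1.
have dl0 : 0 <= 1 - 2 * dl by lra.
have dlX : (1 - 2 * dl) ^+ (k + 6) <= (1 - 2 * dl) ^+ (i + j + 2 + k).
  by apply: ler_wiXn2l; rewrite ?n3 //; lra.
have -> : co * (kap ^+ k * (dens w ^+ k * ((i + j + 2)`!%:R / (i + j + 2 + k)`!%:R)) * ((1 - 2 * dl) * L) ^+ (i + j + 2 + k)) =
   (1 - 2 * dl) ^+ (i + j + 2 + k) * (kap ^+ k.+2 * (dens w ^+ k.+2 * L ^+ k.+2) *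
     (a i * a j / (i.+1%:R * j.+1%:R) * ((i + j + 2)`!%:R / (i + j + 2 + k)`!%:R))).
  rewrite /co [((1 - 2 * dl) * L) ^+ _]exprMn.
  have -> : L ^+ (i + j + 2 + k) = L ^+ (i + j) * L ^+ k.+2.
    by rewrite -exprD n2.
  have h3 : L ^+ (i + j) != 0 by rewrite gt_eqF // exprn_gt0.
  rewrite [kap ^+ k.+2]exprSr [kap ^+ k.+1]exprSr [dens w ^+ k.+2]exprSr [dens w ^+ k.+1]exprSr.
  move: (a i * a j / _) (_ / (i + j + 2 + k)`!%:R) ((1 - 2 * dl) ^+ _) (L ^+ k.+2) (L ^+ (i + j)) h3 => x1 x2 x3 x4 x5 h3.
  by field.
have -> : kap ^+ k.+2 * (1 - 2 * dl) ^+ (k + 6) * (dens w ^+ k.+2 * L ^+ k.+2) *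
   (a i * a j / (i.+1%:R * j.+1%:R) * ((i + j + 2)`!%:R / (i + j + 2 + k)`!%:R)) =
   (1 - 2 * dl) ^+ (k + 6) * (kap ^+ k.+2 * (dens w ^+ k.+2 * L ^+ k.+2) *
   (a i * a j / (i.+1%:R * j.+1%:R) * ((i + j + 2)`!%:R / (i + j + 2 + k)`!%:R))) by ring.
apply: ler_wpM2r => //.
apply: mulr_ge0; last by rewrite mulr_ge0 // divr_ge0.
by rewrite mulr_ge0 ?exprn_ge0 // mulr_ge0 ?exprn_ge0 // ltW.
Qed.

(** * Residue classes and remainders *)

Definition tprod (hs : seq nat) (n : nat) : nat := (\prod_(h <- hs) (n + h))%N.

Lemma prime_dvd_tprod (p : nat) (hs : seq nat) (n : nat) : prime p ->
  (p %| tprod hs n)%N = has (fun h => p %| n + h)%N hs.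
Proof.
move=> pp; rewrite /tprod; elim: hs => [|h hs IH].
  by rewrite big_nil dvdn1 /=; case: eqP => // e; rewrite e in pp.
by rewrite big_cons Euclid_dvdM // IH.
Qed.

Lemma dvdn_add_mod (p n h : nat) : (0 < p)%N ->
  (p %| n + h)%N = (n == p - h %% p %[mod p]).
Proof.
move=> p0; have hp : (h %% p <= p)%N by rewrite ltnW // ltn_pmod.
rewrite -(eqn_modDr (h %% p)) subnK // modnn modnDmr; by rewrite /dvdn.
Qed.

(** If the shifts are distinct modulo p, then p divides at most one n + h. *)
Lemma count_dvd_uniq (p n : nat) (hs : seq nat) : (0 < p)%N ->
  uniq [seq (h %% p)%N | h <- hs] ->
  count (fun h => p %| n + h)%N hs = has (fun h => p %| n + h)%N hs.
Proof.
move=> p0 uq.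
have e h : (p %| n + h)%N = ((h %% p)%N == (p - n %% p) %% p)%N.
  by rewrite addnC dvdn_add_mod.
rewrite (eq_count e) (eq_has e).
rewrite -(count_map (modn^~ p) (pred1 ((p - n %% p) %% p)%N)) (count_uniq_mem _ uq) /=.
by rewrite -has_pred1 has_map.
Qed.

(** Chinese remainder theorem: each p in Q allows one class per member of [hs]. Equating a count
    with a truth value says at once that the chosen classes are disjoint and that they exhaust the
    condition. *)
Lemma residue_classes (M v : nat) (hs : seq nat) (z : nat) (Q : {set 'I_z}) :
  (0 < M)%N ->
  {in Q, forall p : 'I_z, [/\ prime p, coprime p M & uniq [seq (h %% p)%N | h <- hs]]} ->
  exists2 C : seq nat, size C = (size hs ^ #|Q|)%N &
  forall n, count (fun a => n == a %[mod M * nm Q]) C =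
    (n == v %[mod M]) && [forall p in Q, (p %| tprod hs n)%N] :> nat.
Proof.
move=> M0; elim/set_ind_U1: Q => [|p S pS IH] hQ.
  exists [:: v]; first by rewrite cards0.
  move=> n; rewrite nm0 muln1 /= addn0; congr (nat_of_bool _).
  have -> : [forall q : 'I_z in set0, (q %| tprod hs n)%N] = true; last by rewrite andbT.
  by apply/forallP => q; rewrite inE.
have [|C sC cC] := IH; first by move=> q qS; apply: hQ; rewrite !inE qS orbT.
have [pp pM pu] : [/\ prime p, coprime p M & uniq [seq (h %% p)%N | h <- hs]].
  by apply: hQ; rewrite !inE eqxx.
set m := (M * nm S)%N.
have co : coprime m p.
  rewrite coprimeMl coprime_sym pM /=; apply: (@coprime_nm z 0) => q qS.
  have [qp _ _] : [/\ prime q, coprime q M & uniq [seq (h %% q)%N | h <- hs]].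
    by apply: hQ; rewrite !inE qS orbT.
  rewrite prime_coprime // dvdn_prime2 //.
  by apply: contra pS => /eqP e; rewrite -(ord_inj e).
have p0 := prime_gt0 pp.
exists [seq chinese m p a (p - h %% p) | a <- C, h <- hs].
  by rewrite size_allpairs sC cardsU1 pS expnS mulnC.
move=> n; have -> : (M * nm (p |: S) = m * p)%N by rewrite nm_setU1 // /m; ring.
have e a h : (n == chinese m p a (p - h %% p) %[mod m * p]) = (n == a %[mod m]) && (p %| n + h)%N.
  rewrite chinese_remainder // dvdn_add_mod //.
  by rewrite (chinese_modl co) (chinese_modr co).
rewrite -sum1_count big_mkcond big_allpairs_dep /=.
under eq_bigr => a _ do under eq_bigr => h _ do rewrite e.
have -> : (\sum_(a <- C) \sum_(h <- hs) (if (n == a %[mod m]) && (p %| n + h) then 1 else 0) =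
  count (fun a => n == a %[mod m]) C * count (fun h => p %| n + h) hs)%N.
  have cnt (r : seq nat) (q : pred nat) : (\sum_(x <- r) (if q x then 1 else 0) = count q r)%N.
    by elim: r => [|x r IHr]; rewrite ?big_nil ?big_cons //= IHr; case: (q x).
  elim: (C) => [|a r IHr]; first by rewrite big_nil mul0n.
  rewrite big_cons IHr /= mulnDl; congr addn.
  by case: (n == a %[mod m]); rewrite ?mul1n ?cnt // big1 // mul0n.
rewrite cC count_dvd_uniq // -prime_dvd_tprod // mulnb -andbA; congr (nat_of_bool (_ && _)).
apply/andP/forallP => [[/forallP h1 h2] q|h].
  by apply/implyP; rewrite !inE => /predU1P[->//|qS]; have := h1 q; rewrite qS.
split; last by have := h p; rewrite !inE eqxx.
by apply/forallP => q; apply/implyP => qS; have := h q; rewrite !inE qS orbT.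
Qed.

(** The estimate is required only for classes a that satisfy the conditions themselves. This matters
    for primes, where a + h_i has to be coprime to the modulus. *)
Lemma class_sum_bound (M v : nat) (hs : seq nat) (z : nat) (Q : {set 'I_z})
    (m N : nat) (f : nat -> R) (X E : R) :
  (0 < M)%N ->
  {in Q, forall p : 'I_z, [/\ prime p, coprime p M & uniq [seq (h %% p)%N | h <- hs]]} ->
  (forall a, a = v %[mod M] -> {in Q, forall p : 'I_z, p %| tprod hs a}%N ->
     `|\sum_(m <= n < N | n == a %[mod M * nm Q]) f n - X| <= E) ->
  `|\sum_(m <= n < N | (n == v %[mod M]) && [forall p in Q, (p %| tprod hs n)%N]) f n -
     (size hs ^ #|Q|)%:R * X| <= (size hs ^ #|Q|)%:R * E.
Proof.
move=> M0 hQ hE; have [C sC cC] := residue_classes v M0 hQ.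
have -> : \sum_(m <= n < N | (n == v %[mod M]) && [forall p in Q, (p %| tprod hs n)%N]) f n =
  \sum_(a <- C) \sum_(m <= n < N | n == a %[mod M * nm Q]) f n.
  under [RHS]eq_bigr do rewrite big_mkcond.
  rewrite exchange_big /= big_mkcond; apply: eq_bigr => n _.
  rewrite -big_mkcond /= -big_filter big_const_seq count_predT size_filter cC iter_addr_0.
  by case: (_ && _); rewrite ?mulr1n ?mulr0n.
have -> : (size hs ^ #|Q|)%:R * X = \sum_(a <- C) X.
  by rewrite big_const_seq count_predT sC iter_addr_0 mulr_natl.
have -> : (size hs ^ #|Q|)%:R * E = \sum_(a <- C) E.
  by rewrite big_const_seq count_predT sC iter_addr_0 mulr_natl.
rewrite -sumrB; apply: (le_trans (ler_norm_sum _ _ _)).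
rewrite big_seq [leRHS]big_seq; apply: ler_sum => a aC.
have : ((a == v %[mod M]) && [forall p in Q, (p %| tprod hs a)%N] : nat) != 0%N.
  by rewrite -cC -lt0n -has_count; apply/hasP; exists a.
rewrite eqb0 negbK => /andP[/eqP av /forallP fa].
by apply: hE => // p pQ; have := fa p; rewrite pQ.
Qed.

Lemma card_class_le (N a q : nat) : (0 < q)%N ->
  `|\sum_(1 <= n < N.+1 | n == a %[mod q]) (1 : R) - N%:R / q%:R| <= 1.
Proof.
move=> q0; have qR : (0 < q%:R :> R) by rewrite ltr0n.
set s := fun N => \sum_(1 <= n < N.+1 | n == a %[mod q]) (1 : R).
have per i : s (i + q)%N = s i + 1.
  rewrite /s (@big_cat_nat _ _ _ i.+1) ?ltnS ?leq_addr //=; congr (_ + _).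
  rewrite -addSn big_mkcond /= sum_block => [|n]; last by rewrite modnDr.
  rewrite -big_mkcond /= (big_rem (a %% q)%N) /= ?mem_index_iota ?ltn_pmod // modn_mod eqxx.
  rewrite big_seq_cond big1 ?addr0 // => n /andP[]; rewrite mem_rem_uniq ?iota_uniq //.
  rewrite inE mem_index_iota => /andP[na /andP[_ nq]]; rewrite (modn_small nq) => e.
  by rewrite e in na.
have mul i r : s (i * q + r)%N = s r + i%:R.
  elim: i => [|i IH]; first by rewrite addr0.
  have -> : (i.+1 * q + r = i * q + r + q)%N by rewrite mulSn; ring.
  by rewrite per IH -[in RHS]natr1 addrA.
have small r : (r < q)%N -> 0 <= s r <= 1.
  move=> rq; rewrite /s sumr_ge0 //=; case: r rq => [|r] rq; first by rewrite big_geq.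
  apply: (@le_trans _ _ (\sum_(0 <= n < q | n == a %[mod q]) (1 : R))).
    rewrite [leRHS](@big_cat_nat _ _ _ 1) ?(leq_trans _ rq) //=.
    rewrite -[leLHS]add0r lerD ?sumr_ge0 // [leRHS](@big_cat_nat _ _ _ r.+2) //=.
    by rewrite lerDl sumr_ge0.
  have e1 : \sum_(1 <= n < q.+1 | n == a %[mod q]) (1 : R) = 1.
    by have := per 0%N; rewrite /s add0n [X in _ = X + _]big_geq // add0r.
  rewrite -[leRHS]e1 big_mkcond [leRHS]big_mkcond /= big_ltn // [leRHS]big_nat_recr //= mod0n modnn addrC lexx //.
rewrite -/(s N) (divn_eq N q) mul natrD natrM mulrDl mulfK ?gt_eqF //.
have /andP[h1 h2] := small _ (ltn_pmod N q0).
have r0 : 0 <= (N %% q)%:R / q%:R :> R by rewrite divr_ge0.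
have r1 : (N %% q)%:R / q%:R <= 1 :> R.
  by rewrite ler_pdivrMr // mul1r ler_nat ltnW // ltn_pmod.
rewrite ler_norml; move: (s _) (_ / q%:R) h1 h2 r0 r1 => x y h1 h2 r0 r1.
by apply/andP; split; lra.
Qed.

Lemma quad_expand (z : nat) (P : {set 'I_z}) (l : {set 'I_z} -> R) (m N : nat)
    (cond : pred nat) (B : nat -> pred 'I_z) (f : nat -> R) :
  \sum_(m <= n < N | cond n) f n *
     (\sum_(A : {set 'I_z} | (A \subset P) && [forall p in A, B n p]) l A) ^+ 2 =
  \sum_(A : {set 'I_z} | A \subset P) \sum_(A' : {set 'I_z} | A' \subset P)
    l A * l A' * \sum_(m <= n < N | cond n && [forall p in A :|: A', B n p]) f n.
Proof.
transitivity (\sum_(m <= n < N | cond n) \sum_(A : {set 'I_z} | A \subset P)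
   \sum_(A' : {set 'I_z} | A' \subset P)
   if [forall p in A :|: A', B n p] then l A * l A' * f n else 0).
  apply: eq_bigr => n _; rewrite big_mkcondr /= expr2 mulr_suml mulr_sumr.
  apply: eq_bigr => A AP; rewrite !mulr_sumr; apply: eq_bigr => A' AP'.
  have -> : [forall p in A :|: A', B n p] = [forall p in A, B n p] && [forall p in A', B n p].
    apply/forallP/andP => [h|[/forallP h1 /forallP h2] p].
      by split; apply/forallP => p; apply/implyP => pA; have := h p; rewrite inE pA ?orbT.
    by apply/implyP; rewrite inE => /orP[pA|pA]; [have := h1 p|have := h2 p]; rewrite pA.
  by case: [forall p in A, B n p]; case: [forall p in A', B n p]; rewrite /= ?mulr0 ?mul0r ?mulr0 //; ring.
rewrite exchange_big /=; apply: eq_bigr => A AP.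
rewrite exchange_big /=; apply: eq_bigr => A' AP'.
by rewrite -big_mkcondr /= mulr_sumr.
Qed.

Lemma nmU_le (z w : nat) (A B : {set 'I_z}) : A \subset prset z w -> B \subset prset z w ->
  lg (nm (A :|: B)) <= lg (nm A) + lg (nm B).
Proof.
move=> AP BP; have -> : A :|: B = A :|: (B :\: A) by apply/setP => x; rewrite !inE; case: (x \in A).
have BA : B :\: A \subset prset z w by rewrite (subset_trans _ BP) // subsetDl.
rewrite (@lg_nmU _ w) //; last by rewrite disjoints_subset; apply/subsetP => x xA; rewrite !inE xA.
rewrite lerD2l lg_le ?(nm_gt0 BA) //.
rewrite -{2}(setID B A) nm_setU; first by rewrite leq_pmull // (@nm_gt0 _ w) // (subset_trans _ BP) // subsetIl.
by apply/pred0P => x; rewrite !inE; case: (x \in A); rewrite ?andbF.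
Qed.

Lemma sum_subset_pow (T : finType) (Q : {set T}) (c : R) :
  \sum_(A : {set T} | A \subset Q) c ^+ #|A| = (1 + c) ^+ #|Q|.
Proof.
rewrite -prodr_const -sum_subset_prod; apply: eq_bigr => A _; by rewrite prodr_const.
Qed.

(** Each pair (A, B) is charged to its union Q. Extending the sum to all pairs of subsets of Q gives
    (1 + 2)^|Q| twice, hence 9^|Q|. The support of [l] forces log Q <= 2L, which is where the level
    of distribution enters. *)
Lemma quad_remainder (z w : nat) (P : {set 'I_z}) (l S S' E : {set 'I_z} -> R) (Lam L : R) :
  P \subset prset z w -> 0 <= Lam ->
  (forall A : {set 'I_z}, A \subset P -> `|l A| <= Lam * 2 ^+ #|A| * pw 0 (L - lg (nm A))) ->
  (forall Q : {set 'I_z}, Q \subset P -> lg (nm Q) <= 2 * L -> `|S Q - S' Q| <= E Q) ->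
  `|\sum_(A : {set 'I_z} | A \subset P) \sum_(B : {set 'I_z} | B \subset P) l A * l B * S (A :|: B) -
    \sum_(A : {set 'I_z} | A \subset P) \sum_(B : {set 'I_z} | B \subset P) l A * l B * S' (A :|: B)| <=
  Lam ^+ 2 * \sum_(Q : {set 'I_z} | Q \subset P) 9 ^+ #|Q| * E Q * pw 0 (2 * L - lg (nm Q)).
Proof.
move=> PP L0 hl hE.
have count_error (Q : {set 'I_z}) : Q \subset P -> 0 <= E Q * pw 0 (2 * L - lg (nm Q)).
  move=> QP; rewrite /pw; case: (leP 0 (2 * L - lg (nm Q))) => h; rewrite ?mulr0 // expr0 mulr1.
  by apply: le_trans (hE Q QP _); rewrite ?normr_ge0 //; lra.
rewrite -sumrB; apply: (le_trans (ler_norm_sum _ _ _)).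
apply: (@le_trans _ _ (\sum_(A : {set 'I_z} | A \subset P) \sum_(B : {set 'I_z} | B \subset P)
   \sum_(Q : {set 'I_z} | Q \subset P) if (A \subset Q) && (B \subset Q) then
      Lam ^+ 2 * (2 ^+ #|A| * 2 ^+ #|B|) * (E Q * pw 0 (2 * L - lg (nm Q))) else 0)).
  apply: ler_sum => A AP; rewrite -sumrB; apply: (le_trans (ler_norm_sum _ _ _)).
  apply: ler_sum => B BP.
  have ABP : A :|: B \subset P by rewrite subUset AP.
  have pos (Q : {set 'I_z}) : Q \subset P -> 0 <= (if (A \subset Q) && (B \subset Q) then
      Lam ^+ 2 * (2 ^+ #|A| * 2 ^+ #|B|) * (E Q * pw 0 (2 * L - lg (nm Q))) else 0).
    move=> QP; case: ifP => // _; apply: mulr_ge0; last exact: count_error.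
    by rewrite !mulr_ge0 ?exprn_ge0.
  rewrite (bigD1 (A :|: B)) //= subsetUl subsetUr /=.
  apply: (@le_trans _ _ (Lam ^+ 2 * (2 ^+ #|A| * 2 ^+ #|B|) *
      (E (A :|: B) * pw 0 (2 * L - lg (nm (A :|: B)))))); last first.
    by rewrite lerDl sumr_ge0 // => Q /andP[QP _]; apply: pos.
  rewrite -mulrBr normrM normrM.
  have := hl A AP; have := hl B BP; rewrite /pw.
  case: (leP 0 (L - lg (nm A))) => hA; last first.
    by rewrite mulr0 normr_le0 => _ /eqP ->; rewrite normr0 !mul0r; apply: mulr_ge0; [rewrite !mulr_ge0 ?exprn_ge0 // | exact: count_error].
  case: (leP 0 (L - lg (nm B))) => hB; last first.
    by rewrite mulr0 normr_le0 => /eqP -> _; rewrite normr0 mulr0 mul0r; apply: mulr_ge0; [rewrite !mulr_ge0 ?exprn_ge0 // | exact: count_error].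
  rewrite expr0 !mulr1 => lB lA.
  have hU : lg (nm (A :|: B)) <= 2 * L.
    have := nmU_le (subset_trans AP PP) (subset_trans BP PP); lra.
  have -> : 0 <= 2 * L - lg (nm (A :|: B)) by lra.
  rewrite mulr1.
  have -> : Lam ^+ 2 * (2 ^+ #|A| * 2 ^+ #|B|) = (Lam * 2 ^+ #|A|) * (Lam * 2 ^+ #|B|) by ring.
  apply: ler_pM; rewrite ?mulr_ge0 ?normr_ge0 //; last exact: hE.
  by apply: ler_pM; rewrite ?normr_ge0.
under eq_bigr do rewrite exchange_big /=.
rewrite exchange_big /= mulr_sumr; apply: ler_sum => Q QP.
rewrite le_eqVlt; apply/orP; left; apply/eqP.
have sub (F : {set 'I_z} -> R) : \sum_(A : {set 'I_z} | A \subset P) (if A \subset Q then F A else 0) =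
   \sum_(A : {set 'I_z} | A \subset Q) F A.
  rewrite -big_mkcondr /=; apply: eq_bigl => A.
  by case: (boolP (A \subset Q)) => AQ; rewrite ?andbF // andbT (subset_trans AQ QP).
transitivity (\sum_(A : {set 'I_z} | A \subset P) if A \subset Q then 2 ^+ #|A| *
   (\sum_(B : {set 'I_z} | B \subset Q) 2 ^+ #|B|) * (Lam ^+ 2 * (E Q * pw 0 (2 * L - lg (nm Q)))) else 0).
  apply: eq_bigr => A AP; case: (boolP (A \subset Q)) => AQ /=; last by rewrite big1.
  rewrite sub mulr_sumr mulr_suml; apply: eq_bigr => B _; ring.
rewrite sub -mulr_suml -mulr_suml !sum_subset_pow -exprMn.
have -> : (1 + 2) * (1 + 2) = 9 :> R by ring.
ring.
Qed.

(** Over A the factors combine to p/(p - k), at most 2 since p >= 2k; the remaining sum over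
    supersets of A is bounded by the full sum of dimension k. *)
Lemma selberg_weight_bound (z w k : nat) (P : {set 'I_z}) (Y : R -> R) (Ym L : R) (A : {set 'I_z}) :
  P \subset prset z w -> (0 < k)%N -> (2 * k <= w)%N -> A \subset P ->
  (forall x, x <= L -> 0 <= Y x <= Ym * pw 0 x) -> 0 <= Ym ->
  `|selberg_weight P (fun p => k%:R / p%:R) (fun p => k%:R / (p%:R - k%:R)) (fun S => Y (L - lg (nm S))) A| <=
  Ym * wsum P (fun p => k%:R / (p%:R - k%:R)) (pw 0) L * 2 ^+ #|A| * pw 0 (L - lg (nm A)).
Proof.
move=> PP k0 kw AP hY Y0; set h := fun p : 'I_z => k%:R / (p%:R - k%:R) : R.
have pk p : p \in P -> (2%:R * k%:R <= p%:R :> R) /\ (0 < k%:R :> R).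
  move=> /(subsetP PP); rewrite inE => /andP[_ hp].
  by split; [rewrite -natrM ler_nat; lia | rewrite ltr0n; lia].
have h0 : {in P, forall p, 0 <= h p}.
  by move=> p /pk [h1 h2]; rewrite /h divr_ge0 ?ltW //; lra.
have Wn := wsum_nneg_nondec h0 (pw_nneg_nondec 0).
rewrite /selberg_weight sum_superset // normrM.
have AP' := subset_trans AP PP.
have e (U : {set 'I_z}) : U \subset P :\: A -> \prod_(p in A :|: U) h p * Y (L - lg (nm (A :|: U))) =
   \prod_(p in A) h p * (\prod_(p in U) h p * Y (L - lg (nm A) - lg (nm U))).
  rewrite subsetD => /andP[UP UA]; rewrite prod_setU_disj 1?disjoint_sym // (@lg_nmU _ w) //.
  - by rewrite opprD addrA mulrA.
  - exact: subset_trans PP.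
  - by rewrite disjoint_sym.
rewrite (eq_bigr _ e) -mulr_sumr normrM mulrA.
have -> : `|\prod_(p in A) - (k%:R / p%:R)^-1| * `|\prod_(p in A) h p| =
   \prod_(p in A) (p%:R / (p%:R - k%:R)) :> R.
  rewrite -normrM -big_split /= normr_prod; apply: eq_bigr => p pA.
  have [h1 h2] := pk p (subsetP AP p pA).
  have -> : - (k%:R / p%:R)^-1 * h p = - (p%:R / (p%:R - k%:R)).
    by rewrite /h invf_div; field; rewrite ?gt_eqF //; lra.
  by rewrite normrN ger0_norm // divr_ge0 //; lra.
have h2 : \prod_(p in A) (p%:R / (p%:R - k%:R)) <= 2 ^+ #|A| :> R.
  rewrite -prodr_const; apply: ler_prod => p pA.
  have [h1 h2] := pk p (subsetP AP p pA).
  rewrite divr_ge0 //=; last by lra.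
  by rewrite ler_pdivrMr; lra.
have p0 : 0 <= \prod_(p in A) (p%:R / (p%:R - k%:R)) :> R.
  by apply: prodr_ge0 => p pA; have [h1 h3] := pk p (subsetP AP p pA); rewrite divr_ge0 //; lra.
have lA := lg_nm_ge0 AP'.
have inner : `|\sum_(U : {set 'I_z} | U \subset P :\: A) \prod_(p in U) h p * Y (L - lg (nm A) - lg (nm U))| <=
   Ym * wsum P h (pw 0) L * pw 0 (L - lg (nm A)).
  rewrite ger0_norm; last first.
    apply: sumr_ge0 => U UP; have UP' : U \subset P by rewrite (subset_trans UP) // subsetDl.
    rewrite mulr_ge0 ?(prodr_ge0_in h0) //.
    have := lg_nm_ge0 (subset_trans UP' PP) => lU.
    have hx : L - lg (nm A) - lg (nm U) <= L by lra.
    by have /andP[] := hY _ hx.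
  apply: (@le_trans _ _ (\sum_(U : {set 'I_z} | U \subset P :\: A)
     Ym * (\prod_(p in U) h p * pw 0 (L - lg (nm U))) * pw 0 (L - lg (nm A)))).
    apply: ler_sum => U UP; have UP' : U \subset P by rewrite (subset_trans UP) // subsetDl.
    have pU := prodr_ge0_in h0 UP'.
    have := lg_nm_ge0 (subset_trans UP' PP) => lU.
    have -> : Ym * (\prod_(p in U) h p * pw 0 (L - lg (nm U))) * pw 0 (L - lg (nm A)) =
      \prod_(p in U) h p * (Ym * (pw 0 (L - lg (nm U)) * pw 0 (L - lg (nm A)))) by ring.
    apply: ler_wpM2l => //.
    have hx : L - lg (nm A) - lg (nm U) <= L by lra.
    have /andP[_ hh] := hY _ hx; apply: (le_trans hh).
    apply: ler_wpM2l => //; rewrite /pw !expr0.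
    case: (leP 0 (L - lg (nm A) - lg (nm U))) => hx'; last by rewrite mulr_ge0 //; case: ifP.
    have -> : 0 <= L - lg (nm U) by lra.
    have -> : 0 <= L - lg (nm A) by lra.
    by rewrite mulr1.
  rewrite -mulr_suml -mulr_sumr ler_wpM2r ?(proj1 (pw_nneg_nondec 0)) // ler_wpM2l //.
  exact: (wsum_subset L (subsetDl P A) h0 (proj1 (pw_nneg_nondec 0))).
rewrite mulrAC mulrC [leRHS]mulrC.
apply: (@le_trans _ _ ((2 ^+ #|A|) * (Ym * wsum P h (pw 0) L * pw 0 (L - lg (nm A))))).
  by rewrite mulrC; apply: ler_pM => //; rewrite normr_ge0.
by rewrite le_eqVlt; apply/orP; left; apply/eqP; ring.
Qed.

(** Rankin's trick: on the support 1 <= exp X / [nm Q], so the constants K^|Q| turn into the density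
    K/p. *)
Lemma rsum_const_le (z w K : nat) (P : {set 'I_z}) (X : R) :
  P \subset prset z w ->
  \sum_(Q : {set 'I_z} | Q \subset P) K%:R ^+ #|Q| * pw 0 (X - lg (nm Q)) <=
  exp X * wsum P (fun p => K%:R / p%:R) (pw 0) X.
Proof.
move=> PP; rewrite /wsum mulr_sumr; apply: ler_sum => Q QP; rewrite mulrA.
have n0 := nm_gt0 (subset_trans QP PP).
have n0' : (0 < (nm Q)%:R :> R) by rewrite ltr0n.
rewrite /pw; case: (leP 0 (X - lg (nm Q))) => h; rewrite ?mulr0 // !expr0 !mulr1.
rewrite big_split /= prodr_const prod_div_nm mulrCA ler_peMr ?exprn_ge0 // ler_pdivlMr // mul1r.
have l : Rle (lg (nm Q)) X by apply/RleP; lra.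
have : Rle (exp (lg (nm Q))) (exp X).
  by case: (Rle_lt_or_eq_dec _ _ l) => [/exp_increasing/Rlt_le|->] //; apply: Rle_refl.
by rewrite /lg exp_ln; [rewrite INRE => /RleP | apply: INR_gt0].
Qed.

Lemma totient_nm (z w : nat) (Q : {set 'I_z}) : Q \subset prset z w ->
  (totient (nm Q))%:R = \prod_(p in Q) (p%:R - 1) :> R.
Proof.
elim/set_ind_U1: Q => [|p T pT IH] TP; first by rewrite nm0 big_set0.
have [pP TP'] : p \in prset z w /\ T \subset prset z w.
  by move: TP; rewrite subUset sub1set => /andP.
have pp := prset_prime pP.
rewrite nm_setU1 // totient_coprime; last by rewrite prime_coprime // (prime_dvd_nm TP' pP).
by rewrite natrM (IH TP') prod_setU1 // totient_prime // -subn1 natrB // prime_gt0.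
Qed.

(** * The sieve *)

Lemma ler_norm_sum_count (m N a q : nat) (F : nat -> R) (Bd : R) :
  (forall n, (m <= n < N)%N -> `|F n| <= Bd) ->
  `|\sum_(m <= n < N | n == a %[mod q]) F n| <=
  Bd * \sum_(m <= n < N | n == a %[mod q]) 1.
Proof.
move=> hF; apply: (le_trans (ler_norm_sum _ _ _)); rewrite mulr_sumr.
rewrite big_nat_cond [leRHS]big_nat_cond; apply: ler_sum => n /andP[nm _].
by rewrite mulr1 hF.
Qed.

(** The shift by h moves the range to (z0 + h, N + h]. Compared with [1, N] it misses an initial
    piece of one class and gains at most h terms at the end. *)
Lemma ap_shift (N z0 h a q : nat) (F : nat -> R) (Bd : R) : (0 < q)%N -> (z0 <= N)%N ->
  (forall n, (1 <= n < (N + h).+1)%N -> `|F n| <= Bd) -> 0 <= Bd ->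
  `|\sum_(z0.+1 <= n < N.+1 | n == a %[mod q]) F (n + h)%N -
    \sum_(1 <= n < N.+1 | n == a + h %[mod q]) F n| <=
  Bd * ((z0 + h)%:R / q%:R + 1 + h%:R).
Proof.
move=> q0 zN hF B0.
have -> : \sum_(z0.+1 <= n < N.+1 | n == a %[mod q]) F (n + h)%N =
  \sum_((z0 + h).+1 <= n < (N + h).+1 | n == a + h %[mod q]) F n.
  rewrite -[(z0 + h).+1]addSn big_addn -addSn addnK; apply: eq_bigl => n.
  by rewrite eqn_modDr.
set T := fun x y => \sum_(x <= n < y | n == a + h %[mod q]) F n.
have e1 : T 1%N (N + h).+1 = T 1%N (z0 + h).+1 + T (z0 + h).+1 (N + h).+1.
  by rewrite /T -big_cat_nat // ltnS leq_add2r.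
have e2 : T 1%N (N + h).+1 = T 1%N N.+1 + T N.+1 (N + h).+1.
  by rewrite /T -big_cat_nat // ltnS leq_addr.
have b1 : `|T 1%N (z0 + h).+1| <= Bd * ((z0 + h)%:R / q%:R + 1).
  apply: (le_trans (ler_norm_sum_count _ _ _)).
    by move=> n /andP[n1 n2]; apply: hF; rewrite n1 (leq_trans n2) // ltnS leq_add2r.
  apply: ler_wpM2l => //.
  have := card_class_le (z0 + h) (a + h) q0; rewrite ler_norml => /andP[_]; rewrite lerBlDr addrC //.
have b2 : `|T N.+1 (N + h).+1| <= Bd * h%:R.
  apply: (le_trans (ler_norm_sum_count _ _ _)).
    by move=> n /andP[n1 n2]; apply: hF; rewrite n2 (leq_trans _ n1).
  apply: ler_wpM2l => //; rewrite big_mkcond /=.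
  apply: (@le_trans _ _ (\sum_(N.+1 <= n < (N + h).+1) (1 : R))).
    by apply: ler_sum => n _; case: ifP.
  by rewrite sumr_const_nat -addSn addKn.
rewrite -/(T _ _) -/(T _ _).
have -> : T (z0 + h).+1 (N + h).+1 - T 1%N N.+1 = T N.+1 (N + h).+1 - T 1%N (z0 + h).+1.
  by move: e1; rewrite e2; move: (T _ _) (T _ _) (T _ _) (T _ _) => *; lra.
apply: (le_trans (ler_normB _ _)); apply: (le_trans (lerD b2 b1)).
by rewrite le_eqVlt; apply/orP; left; apply/eqP; ring.
Qed.

(* [K^w <= (t + K^(2w)/t)/2] plays the role of the Cauchy-Schwarz inequality. *)
Lemma rsum_amgm (z w K : nat) (P : {set 'I_z}) (m : {set 'I_z} -> R) (X TB SB t : R) :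
  P \subset prset z w -> 0 < t ->
  (forall Q : {set 'I_z}, Q \subset P -> lg (nm Q) <= X ->
     0 <= m Q <= TB * 2 ^+ #|Q| / (nm Q)%:R) ->
  \sum_(Q : {set 'I_z} | Q \subset P) m Q * pw 0 (X - lg (nm Q)) <= SB ->
  \sum_(Q : {set 'I_z} | Q \subset P) K%:R ^+ #|Q| * m Q * pw 0 (X - lg (nm Q)) <=
  2^-1 * (t * SB + TB / t * wsum P (fun p => (2 * K * K)%:R / p%:R) (pw 0) X).
Proof.
move=> PP t0 hm hS.
apply: (@le_trans _ _ (2^-1 * (t * \sum_(Q : {set 'I_z} | Q \subset P) m Q * pw 0 (X - lg (nm Q)) +
   TB / t * wsum P (fun p => (2 * K * K)%:R / p%:R) (pw 0) X))); last first.
  by rewrite ler_wpM2l ?invr_ge0 // lerD2r ler_wpM2l // ltW.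
rewrite /wsum !mulr_sumr -big_split mulr_sumr /=; apply: ler_sum => Q QP.
rewrite /pw; case: (leP 0 (X - lg (nm Q))) => h; last by rewrite !mulr0 addr0 mulr0.
rewrite !expr0 !mulr1.
have lX : lg (nm Q) <= X by lra.
have /andP[m0 m1] := hm Q QP lX.
have -> : \prod_(p in Q) ((2 * K * K)%:R / p%:R) = (K%:R ^+ #|Q|) ^+ 2 * (2 ^+ #|Q| / (nm Q)%:R) :> R.
  rewrite big_split /= prodr_const prod_div_nm !natrM !exprMn [(K%:R ^+ #|Q|) ^+ 2]expr2.
  move: (K%:R ^+ _ : R) (2 ^+ _ : R) => *; ring.
have -> : TB / t * ((K%:R ^+ #|Q|) ^+ 2 * (2 ^+ #|Q| / (nm Q)%:R)) =
  (K%:R ^+ #|Q|) ^+ 2 / t * (TB * 2 ^+ #|Q| / (nm Q)%:R) by ring.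
move: (K%:R ^+ #|Q|) => x.
have h1 : x ^+ 2 / t * m Q <= x ^+ 2 / t * (TB * 2 ^+ #|Q| / (nm Q)%:R).
  by apply: ler_wpM2l => //; rewrite divr_ge0 ?(ltW t0) // sqr_ge0.
have h2 : x * m Q <= 2^-1 * (t * m Q + x ^+ 2 / t * m Q).
  rewrite -mulrDl mulrA ler_wpM2r //.
  rewrite ler_pdivlMl // -subr_ge0.
  have -> : t + x ^+ 2 / t - 2 * x = (t - x) ^+ 2 / t by field; rewrite gt_eqF.
  by rewrite divr_ge0 ?sqr_ge0 // ltW.
apply: (le_trans h2); rewrite ler_wpM2l ?invr_ge0 //.
by rewrite lerD2l.
Qed.

Lemma sum_inj_le (T : finType) (D : pred T) (phi : T -> nat) (G : nat -> R) (U : nat) :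
  {in D &, injective phi} -> (forall x, D x -> 0 < phi x <= U)%N -> (forall q, 0 <= G q) ->
  \sum_(x | D x) G (phi x) <= \sum_(1 <= q < U.+1) G q.
Proof.
move=> inj bd G0.
apply: (@le_trans _ _ (\sum_(x | D x) \sum_(1 <= q < U.+1) if phi x == q then G q else 0)).
  apply: ler_sum => x Dx; rewrite (bigD1_seq (phi x)) ?iota_uniq ?mem_index_iota ?bd //= eqxx lerDl.
  by apply: sumr_ge0 => q _; case: ifP.
rewrite exchange_big /=; apply: ler_sum => q _.
case: (pickP (fun x => D x && (phi x == q))) => [x /andP[Dx /eqP e]|none].
  rewrite (bigD1 x) //= e eqxx big1 ?addr0 // => y /andP[Dy yx].
  by case: eqP => // e'; case/eqP: yx; apply: inj => //; rewrite e.
rewrite big1 // => x Dx; by have := none x; rewrite Dx /= => ->.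
Qed.

Lemma pw0_sq (x : R) : pw 0 x ^+ 2 = pw 0 x.
Proof. by rewrite /pw; case: ifP => _; rewrite ?expr0 ?expr1n // expr0n. Qed.

(** The size of the sieve coefficients: up to 2^|A| this bounds them, as [l_bound] shows. *)
Definition weight_size (k w z : nat) (a : nat -> R) (L : R) : R :=
  (a 0%N + a 1%N + a 2%N) * wsum (prset z w) (fun p => k%:R / (p%:R - k%:R)) (pw 0) L.

Section Sieve.
Variables (hs : seq nat) (w v0 z N : nat) (a : nat -> R) (dl L : R).
Let k := size hs.
Let P := prset z w.
Let W := w`!.
Let y (S : {set 'I_z}) := Yf a dl L (L - lg (nm S)).
Let g (p : 'I_z) : R := k%:R / p%:R.
Let h (p : 'I_z) : R := k%:R / (p%:R - k%:R).
Let l := selberg_weight P g h y.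
Let Lam := weight_size k w z a L.

Hypothesis uhs : uniq hs.
Hypothesis hw : {in hs, forall x, x < w}%N.
Hypothesis k0 : (1 < k)%N.
Hypothesis kw : (2 * k <= w)%N.
Hypothesis a0 : forall i, 0 <= a i.
Hypothesis dl0 : 0 < dl.
Hypothesis L0 : 0 < L.

Definition sieve_weight (n : nat) : R :=
  (\sum_(A : {set 'I_z} | (A \subset P) && [forall p in A, (p %| tprod hs n)%N]) l A) ^+ 2.

Lemma sieve_weight_ge0 n : 0 <= sieve_weight n.
Proof. exact: sqr_ge0. Qed.

Lemma W_gt0 : (0 < W)%N. Proof. exact: fact_gt0. Qed.

Lemma prset_facts (p : 'I_z) : p \in P ->
  [/\ prime p, (w < p)%N, 2%:R * k%:R <= p%:R :> R, 0 < k%:R :> R & 0 < p%:R :> R].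
Proof.
rewrite inE => /andP[pp wp]; split=> //; first by rewrite -natrM ler_nat; lia.
  by rewrite ltr0n ltnW.
by rewrite ltr0n prime_gt0.
Qed.

Lemma g_neq0 : {in P, forall p, g p != 0}.
Proof. by move=> p /prset_facts[_ _ _ k1 p1]; rewrite gt_eqF // divr_gt0. Qed.

Lemma h_gt0 : {in P, forall p, 0 < h p}.
Proof. by move=> p /prset_facts[_ _ k2 k1 p1]; rewrite divr_gt0 //; lra. Qed.

Lemma h_neq0 : {in P, forall p, h p != 0}.
Proof. by move=> p /h_gt0 h0; rewrite gt_eqF. Qed.

Lemma ghE : {in P, forall p, (g p)^-1 = 1 + (h p)^-1}.
Proof.
move=> p /prset_facts[_ _ k2 k1 p1]; rewrite /g /h !invf_div; field; lra.
Qed.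

Lemma Y_bound x : x <= L -> 0 <= Yf a dl L x <= (a 0%N + a 1%N + a 2%N) * pw 0 x.
Proof.
move=> xL; have Yn := Yf_nneg_nondec a0 dl0 L0.
rewrite (proj1 Yn) /=; apply: (le_trans (Yf_le _ _ _ a0)).
rewrite !big_ord_recr big_ord0 /= add0r /pw; case: (leP 0 x) => x0; last by rewrite !mulr0 !addr0.
have xL1 : x / L <= 1 by rewrite ler_pdivrMr // mul1r.
have xL0 : 0 <= x / L by rewrite divr_ge0 // ltW.
rewrite !expr0 !expr1 divr1 !mulr1 !lerD //.
  by rewrite mulrAC -mulrA ler_piMr.
by rewrite mulrAC -mulrA -expr_div_n ler_piMr // expr_le1.
Qed.

Lemma l_bound (A : {set 'I_z}) : A \subset P ->
  `|l A| <= Lam * 2 ^+ #|A| * pw 0 (L - lg (nm A)).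
Proof.
move=> AP; apply: (selberg_weight_bound (w := w)) => //; first exact: ltnW.
  exact: Y_bound.
by rewrite !addr_ge0.
Qed.

Lemma Lam_ge0 : 0 <= Lam.
Proof.
rewrite /Lam /weight_size; apply: mulr_ge0; first by rewrite !addr_ge0.
by apply: (proj1 (wsum_nneg_nondec _ (pw_nneg_nondec 0))) => p /h_gt0 /ltW.
Qed.

(** All members of [hs] lie below w, hence below every sieving prime, so they stay distinct modulo
    it. *)
Lemma class_hyp (M : nat) (hs' : seq nat) (Q : {set 'I_z}) : {subset hs' <= hs} -> uniq hs' ->
  Q \subset P -> {in Q, forall p : 'I_z, coprime p M} ->
  {in Q, forall p : 'I_z, [/\ prime p, coprime p M & uniq [seq (x %% p)%N | x <- hs']]}.
Proof.
move=> sub uhs' QP co p pQ; have [pp wp _ _ _] := prset_facts (subsetP QP p pQ).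
split=> //; first exact: co.
have -> // : [seq (x %% p)%N | x <- hs'] = hs'.
rewrite -[RHS]map_id; apply/eq_in_map => x xh.
by rewrite modn_small // (ltn_trans _ wp) // hw // sub.
Qed.

Lemma coprime_W (Q : {set 'I_z}) : Q \subset P -> {in Q, forall p : 'I_z, coprime p W}.
Proof.
move=> QP p pQ; have [pp wp _ _ _] := prset_facts (subsetP QP p pQ).
by rewrite /W coprime_fact.
Qed.

(** The set Q cuts out k^|Q| classes modulo W [nm Q], each with its expected number of integers up
    to an error 1. Thus the main form has density k/p and is diagonal, and the remainder carries
    9^|Q| k^|Q|. *)
Lemma sum_weight_le :
  \sum_(1 <= n < N.+1 | n == v0 %[mod W]) sieve_weight n <=
  N%:R / W%:R * wsum P h (fun s => Yf a dl L s ^+ 2) L +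
  Lam ^+ 2 * \sum_(Q : {set 'I_z} | Q \subset P) (9 * k)%:R ^+ #|Q| * pw 0 (2 * L - lg (nm Q)).
Proof.
have := @quad_expand z P l 1 N.+1 (fun n => n == v0 %[mod W]) (fun n p => p %| tprod hs n)%N (fun=> 1).
under eq_bigr do rewrite mul1r.
rewrite -/(sieve_weight _) => ->.
set S := fun Q : {set 'I_z} => \sum_(1 <= n < N.+1 | (n == v0 %[mod W]) && [forall p in Q, (p %| tprod hs n)%N]) (1 : R).
have := @quad_remainder z w P l S (fun Q => N%:R / W%:R * \prod_(p in Q) g p) (fun Q => k%:R ^+ #|Q|) Lam L (subxx _) Lam_ge0 l_bound.
have hE (Q : {set 'I_z}) : Q \subset P -> lg (nm Q) <= 2 * L ->
   `|S Q - N%:R / W%:R * \prod_(p in Q) g p| <= k%:R ^+ #|Q|.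
  move=> QP _.
  have := @class_sum_bound W v0 hs z Q 1 N.+1 (fun=> 1) (N%:R / (W * nm Q)%:R) 1 W_gt0 (class_hyp (fun x => id) uhs QP (coprime_W QP)).
  have n0 := nm_gt0 QP.
  move=> /(_ (fun b _ _ => card_class_le N b _)); rewrite muln_gt0 W_gt0 n0 => /(_ isT).
  rewrite natrX mulr1 -/(S Q).
  have -> // : k%:R ^+ #|Q| * (N%:R / (W * nm Q)%:R) = N%:R / W%:R * \prod_(p in Q) g p.
  rewrite /g big_split /= prodr_const prod_div_nm natrM invfM; ring.
move=> /(_ hE).
have -> : \sum_(A : {set 'I_z} | A \subset P) \sum_(B : {set 'I_z} | B \subset P)
   l A * l B * (N%:R / W%:R * \prod_(p in A :|: B) g p) =
   N%:R / W%:R * wsum P h (fun s => Yf a dl L s ^+ 2) L.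
  have := selberg_form y g_neq0 h_neq0 ghE; rewrite -/l => e.
  rewrite /wsum -e !mulr_sumr; apply: eq_bigr => A _; rewrite mulr_sumr; apply: eq_bigr => B _; ring.
rewrite ler_norml => /andP[_]; rewrite lerBlDr addrC => hh.
apply: (le_trans hh); rewrite lerD2l le_eqVlt; apply/orP; left; apply/eqP.
congr (_ * _); apply: eq_bigr => Q _; by rewrite natrM exprMn.
Qed.

Lemma sum_weight_twisted (f : nat -> R) (m N' : nat) (E : {set 'I_z} -> R) :
  (forall Q : {set 'I_z}, Q \subset P -> lg (nm Q) <= 2 * L -> forall b,
     `|\sum_(m <= n < N' | n == b %[mod W * nm Q]) f n| <= E Q) ->
  `|\sum_(m <= n < N' | n == v0 %[mod W]) f n * sieve_weight n| <=
  Lam ^+ 2 * \sum_(Q : {set 'I_z} | Q \subset P)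
     (9 * k)%:R ^+ #|Q| * E Q * pw 0 (2 * L - lg (nm Q)).
Proof.
move=> hE.
have := @quad_expand z P l m N' (fun n => n == v0 %[mod W]) (fun n p => p %| tprod hs n)%N f.
rewrite -/(sieve_weight _) => ->.
set S := fun Q : {set 'I_z} => \sum_(m <= n < N' | (n == v0 %[mod W]) && [forall p in Q, (p %| tprod hs n)%N]) f n.
have := @quad_remainder z w P l S (fun Q => 0) (fun Q => k%:R ^+ #|Q| * E Q) Lam L (subxx _) Lam_ge0 l_bound.
have hE' (Q : {set 'I_z}) : Q \subset P -> lg (nm Q) <= 2 * L -> `|S Q - 0| <= k%:R ^+ #|Q| * E Q.
  move=> QP lQ.
  have := @class_sum_bound W v0 hs z Q m N' f 0 (E Q) W_gt0 (class_hyp (fun x => id) uhs QP (coprime_W QP)).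
  rewrite mulr0 -/(S Q) natrX; apply=> b _ _; rewrite subr0; exact: hE.
move=> /(_ hE').
have -> : \sum_(A : {set 'I_z} | A \subset P) \sum_(B : {set 'I_z} | B \subset P) l A * l B * 0 = 0.
  by apply: big1 => A _; apply: big1 => B _; rewrite mulr0.
rewrite subr0 => hh.
apply: (le_trans hh); rewrite le_eqVlt; apply/orP; left; apply/eqP.
congr (_ * _); apply: eq_bigr => Q _; rewrite natrM exprMn; ring.
Qed.

(** Reinstating a forbidden prime p costs a factor of at most 1 + f p: by monotonicity of G, the
    terms containing p are dominated by those without it. *)
Lemma wsum_remove_le (P' : {set 'I_z}) (f : 'I_z -> R) (G : R -> R) (t : R) (S : {set 'I_z}) :
  P' \subset P -> {in P', forall p, 0 <= f p} -> nneg_nondec G -> S \subset P' ->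
  wsum P' f G t <= \prod_(p in S) (1 + f p) * wsum (P' :\: S) f G t.
Proof.
move=> PP f0 Gn; elim/set_ind_U1: S => [|p S pS IH] SP; first by rewrite big_set0 setD0 mul1r.
have [pP SP'] : p \in P' /\ S \subset P' by move: SP; rewrite subUset sub1set => /andP.
apply: (le_trans (IH SP')).
have pr0 : 0 <= \prod_(q in S) (1 + f q).
  by apply: prodr_ge0 => q qS; rewrite addr_ge0 // f0 // (subsetP SP').
rewrite prod_setU1 // [(1 + f p) * _]mulrC -mulrA; apply: ler_wpM2l => //.
have -> : P' :\: S = p |: (P' :\: (p |: S)).
  apply/setP => x; rewrite !inE; case: eqP => [->|] //=; by rewrite pS pP.
have pD : p \notin P' :\: (p |: S) by rewrite !inE eqxx.
rewrite {1}/wsum sum_subsetU1 // mulrDl mul1r; apply: lerD => //.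
rewrite /wsum mulr_sumr; apply: ler_sum => A AP.
have pA : p \notin A by apply: contra pD; apply: (subsetP AP).
have AP' : A \subset P' by rewrite (subset_trans AP) // subsetDl.
rewrite prod_setU1 // -mulrA; apply: ler_wpM2l; first exact: f0.
apply: ler_wpM2l; first exact: (prodr_ge0_in f0).
have [pp _ _ _ _] := prset_facts (subsetP PP p pP).
have nA := nm_gt0 (subset_trans AP' PP).
have pg := prime_gt0 pp.
rewrite nm_setU1 // lgM //.
by case: Gn => _; apply; have := lg_ge0 (prime_gt0 pp); lra.
Qed.

(** In the cross form with density (k - 1)/(p - 1), each p in S contributes h' (1 + 1/(p - 1))^2,
    while the inner sum avoids the primes of S. By [wsum_remove_le] the squared factor pays exactly
    for letting the inner sum run over all of P. Afterwards h' and 1/(p - 1) are lowered to (k -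
    1)/p and 1/p. *)
Lemma form_prime_ge :
  wsum P (fun p => (k.-1)%:R / p%:R) (fun s => wsum P (fun p => p%:R^-1) (Yf a dl L) s ^+ 2) L <=
  \sum_(A : {set 'I_z} | A \subset P) \sum_(B : {set 'I_z} | B \subset P)
     l A * l B * \prod_(p in A :|: B) ((k.-1)%:R / (p%:R - 1)).
Proof.
pose g' (p : 'I_z) : R := (k.-1)%:R / (p%:R - 1).
pose h' (p : 'I_z) : R := (k.-1)%:R / (p%:R - k%:R).
have k1E : (k.-1)%:R = k%:R - 1 :> R by rewrite -subn1 natrB // ltnW.
have facts p : p \in P -> [/\ 2%:R * k%:R <= p%:R :> R, 1 < k%:R :> R & 0 < p%:R :> R].
  by move=> /prset_facts[_ _ h1 _ h2]; split=> //; rewrite ltr1n.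
have g'0 : {in P, forall p, g' p != 0}.
  by move=> p /facts[h1 h2 h3]; rewrite /g' k1E gt_eqF // divr_gt0; lra.
have gh' : {in P, forall p, (g' p)^-1 = 1 + (h' p)^-1}.
  by move=> p /facts[h1 h2 h3]; rewrite /g' /h' k1E !invf_div; field; lra.
rewrite (selberg_form_cross g h y g'0 gh') /wsum; apply: ler_sum => S SP.
have Yn := Yf_nneg_nondec a0 dl0 L0.
pose f1 (p : 'I_z) : R := (p%:R - 1)^-1.
have f10 : {in P, forall p, 0 <= f1 p}.
  by move=> p /facts[h1 h2 h3]; rewrite /f1 invr_ge0; lra.
set inner := \sum_(U : {set 'I_z} | U \subset P :\: S) _.
have innerE : inner = wsum (P :\: S) f1 (Yf a dl L) (L - lg (nm S)).
  apply: eq_bigr => U; rewrite subsetD => /andP[UP US]; congr (_ * _).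
    apply: eq_bigr => p pU; have [h1 h2 h3] := facts p (subsetP UP p pU).
    by rewrite /h /g' /g /f1 k1E; field; rewrite ?invf_div; lra.
  rewrite /y (@lg_nmU _ w) // 1?disjoint_sym //; congr (Yf _ _ _ _); ring.
have -> : \prod_(p in S) ((h' p)^-1 * (g' p / g p * h p) ^+ 2) =
   \prod_(p in S) h' p * (\prod_(p in S) (1 + f1 p)) ^+ 2.
  rewrite -prodrXl -big_split /=; apply: eq_bigr => p pS.
  have [h1 h2 h3] := facts p (subsetP SP p pS).
  by rewrite /h /h' /g' /g /f1 k1E; field; lra.
rewrite -mulrA -exprMn innerE; apply: ler_pM.
- by apply: prodr_ge0 => p _; rewrite divr_ge0.
- exact: sqr_ge0.
- apply: ler_prod => p pS; have [h1 h2 h3] := facts p (subsetP SP p pS).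
  rewrite divr_ge0 //= /h' ler_wpM2l // lef_pV2 ?posrE; lra.
have b0 : 0 <= wsum P (fun p => p%:R^-1) (Yf a dl L) (L - lg (nm S)).
  by apply: (proj1 (wsum_nneg_nondec (@inv_ge0 _ _) Yn)).
have b1 : wsum P (fun p => p%:R^-1) (Yf a dl L) (L - lg (nm S)) <= wsum P f1 (Yf a dl L) (L - lg (nm S)).
  apply: wsum_le => [p pP|x]; last by rewrite lexx (proj1 Yn).
  have [h1 h2 h3] := facts p pP; rewrite invr_ge0 ler0n /= /f1 lef_pV2 ?posrE; lra.
have b2 := wsum_remove_le (L - lg (nm S)) (subxx P) f10 Yn SP.
by rewrite lerXn2r ?nnegrE // ?(le_trans b1 b2) // (le_trans b0 (le_trans b1 b2)).
Qed.

(** The coefficients [l] remain those of the full tuple; only the divisibility conditions refer to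
    another one. *)
Definition weight_for (hs' : seq nat) (n : nat) : R :=
  (\sum_(A : {set 'I_z} | (A \subset P) && [forall p in A, (p %| tprod hs' n)%N]) l A) ^+ 2.

(** With [hi] removed, Q leaves (k - 1)^|Q| classes, each of expected mass N / totient. The local
    density is therefore (k - 1)/(p - 1), to which [form_prime_ge] applies. *)
Lemma sum_weight_prime (hi : nat) (f : nat -> R) (m N' : nat) (E : {set 'I_z} -> R) :
  hi \in hs -> coprime (v0 + hi) W ->
  (forall Q : {set 'I_z}, Q \subset P -> lg (nm Q) <= 2 * L -> forall b,
     coprime (b + hi) (W * nm Q) ->
     `|\sum_(m <= n < N' | n == b %[mod W * nm Q]) f n - N%:R / (totient (W * nm Q))%:R| <= E Q) ->
  N%:R / (totient W)%:R *
   wsum P (fun p => (k.-1)%:R / p%:R) (fun s => wsum P (fun p => p%:R^-1) (Yf a dl L) s ^+ 2) L -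
  Lam ^+ 2 * \sum_(Q : {set 'I_z} | Q \subset P)
     (9 * k)%:R ^+ #|Q| * E Q * pw 0 (2 * L - lg (nm Q)) <=
  \sum_(m <= n < N' | n == v0 %[mod W]) f n * weight_for (rem hi hs) n.
Proof.
move=> hih cov hE; set hs' := rem hi hs.
have := @quad_expand z P l m N' (fun n => n == v0 %[mod W]) (fun n p => p %| tprod hs' n)%N f.
rewrite -/(weight_for _ _) => ->.
set S := fun Q : {set 'I_z} => \sum_(m <= n < N' | (n == v0 %[mod W]) && [forall p in Q, (p %| tprod hs' n)%N]) f n.
set g' := fun p : 'I_z => (k.-1)%:R / (p%:R - 1) : R.
have := @quad_remainder z w P l S (fun Q => N%:R / (totient W)%:R * \prod_(p in Q) g' p)
  (fun Q => (k.-1)%:R ^+ #|Q| * E Q) Lam L (subxx _) Lam_ge0 l_bound.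
have sub : {subset hs' <= hs} by move=> x; apply: mem_rem.
have uhs' : uniq hs' by apply: rem_uniq.
have sz : size hs' = k.-1 by rewrite size_rem.
have hE' (Q : {set 'I_z}) : Q \subset P -> lg (nm Q) <= 2 * L ->
   `|S Q - N%:R / (totient W)%:R * \prod_(p in Q) g' p| <= (k.-1)%:R ^+ #|Q| * E Q.
  move=> QP lQ.
  have := @class_sum_bound W v0 hs' z Q m N' f (N%:R / (totient (W * nm Q))%:R) (E Q) W_gt0 (class_hyp sub uhs' QP (coprime_W QP)).
  have -> : (size hs' ^ #|Q|)%:R * (N%:R / (totient (W * nm Q))%:R) = N%:R / (totient W)%:R * \prod_(p in Q) g' p.
    rewrite totient_coprime; last by rewrite coprime_sym coprime_nm_fact.
    rewrite natrM.
    rewrite (totient_nm QP).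
    rewrite sz natrX invfM /g' big_split /= prodr_const prodfV; ring.
  rewrite -/(S Q) sz natrX; apply=> b bv bQ; apply: hE => //.
  rewrite coprimeMr; apply/andP; split.
    by rewrite /coprime -gcdn_modl -modnDml bv modnDml gcdn_modl.
  rewrite coprime_sym; apply: (@coprime_nm z w) => p pQ.
  have [pp wp _ _ _] := prset_facts (subsetP QP p pQ).
  rewrite prime_coprime //; apply/negP => pb.
  have := bQ p pQ; rewrite prime_dvd_tprod // => /hasP[x xh px].
  (* If p divided b + x and b + hi for distinct members, it would divide their difference, although
     both are below w < p. So the classes in question are reduced at [hi]. *)
  have xhi : x != hi by apply: contraTneq xh => ->; rewrite mem_rem_uniqF.
  have e : x = hi %[mod p].
    by apply/eqP; rewrite -(eqn_modDl b); rewrite (eqP px) (eqP pb).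
  have xp := ltn_trans (hw (sub x xh)) wp; have hip := ltn_trans (hw hih) wp.
  move: e; rewrite !modn_small // => e.
  by rewrite e eqxx in xhi.
move=> /(_ hE').
have -> : \sum_(A : {set 'I_z} | A \subset P) \sum_(B : {set 'I_z} | B \subset P)
   l A * l B * (N%:R / (totient W)%:R * \prod_(p in A :|: B) g' p) =
   N%:R / (totient W)%:R * \sum_(A : {set 'I_z} | A \subset P) \sum_(B : {set 'I_z} | B \subset P)
     l A * l B * \prod_(p in A :|: B) g' p.
  rewrite !mulr_sumr; apply: eq_bigr => A _; rewrite mulr_sumr; apply: eq_bigr => B _; ring.
rewrite ler_norml => /andP[hh _].
have f1 := ler_wpM2l (_ : 0 <= N%:R / (totient W)%:R :> R) form_prime_ge.
have rr : \sum_(Q : {set 'I_z} | Q \subset P) 9 ^+ #|Q| * ((k.-1)%:R ^+ #|Q| * E Q) * pw 0 (2 * L - lg (nm Q)) <=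
   \sum_(Q : {set 'I_z} | Q \subset P) (9 * k)%:R ^+ #|Q| * E Q * pw 0 (2 * L - lg (nm Q)).
  apply: ler_sum => Q QP; rewrite /pw; case: (leP 0 (2 * L - lg (nm Q))) => lQ; last by rewrite !mulr0.
  have lQ' : lg (nm Q) <= 2 * L by lra.
  have EQ : 0 <= (k.-1)%:R ^+ #|Q| * E Q by apply: le_trans (hE' Q QP lQ'); rewrite normr_ge0.
  have k10 : (0 < (k.-1)%:R :> R) by rewrite ltr0n -subn1 subn_gt0.
  have EQ' : 0 <= E Q by move: EQ; rewrite pmulr_rge0 // exprn_gt0.
  rewrite expr0 !mulr1 natrM exprMn mulrA ler_wpM2r // ler_wpM2l ?exprn_ge0 //.
  by rewrite lerXn2r ?nnegrE // ler_nat leq_pred.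
have rr' := ler_wpM2l (sqr_ge0 Lam) rr.
have f1' := f1 (divr_ge0 (ler0n _ _) (ler0n _ _)).
move: hh f1' rr'; rewrite -/g'.
move: (N%:R / _ * _) (N%:R / _ * _) (Lam ^+ 2 * _) (Lam ^+ 2 * _) (\sum_(A : {set 'I_z} | _) _) => x1 x2 x3 x4 x5; lra.
Qed.

(** All sieving primes are below z, so none of them divides a prime that is at least z. *)
Lemma weight_for_rem (hi n : nat) : hi \in hs -> prime (n + hi) -> (z <= n + hi)%N ->
  sieve_weight n = weight_for (rem hi hs) n.
Proof.
move=> hih pn zn; rewrite /sieve_weight /weight_for; congr (_ ^+ 2).
apply: eq_bigl => A; apply: andb_id2l => AP; apply: eq_forallb => p.
case: (boolP (p \in A)) => //= pA; have [pp _ _ _ _] := prset_facts (subsetP AP p pA).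
rewrite !prime_dvd_tprod // (perm_has _ (perm_to_rem hih)) /= dvdn_prime2 //.
by rewrite ltn_eqF // (leq_trans (ltn_ord p)).
Qed.

(** The conditions at [p0] are automatic, so [selberg_weight_merge] gives a diagonal form in
    differences of the cut-off, which [Yf_lip] bounds. The modulus acquires the factor [p0], whence
    the gain 1/p0. The 3 is 1 + 2, from the bounds for A and for A with [p0] added. *)
Lemma sum_weight_p0_le (p0 : 'I_z) (hm : nat) : p0 \in P -> hm \in hs ->
  \sum_(1 <= n < N.+1 | (n == v0 %[mod W]) && (p0 %| n + hm)%N) sieve_weight n <=
  N%:R / (W * p0)%:R * ((Lip a dl * (lg p0 / L)) ^+ 2 * wsum P h (pw 0) L) +
  (3 * Lam) ^+ 2 * \sum_(Q : {set 'I_z} | Q \subset P) (9 * k)%:R ^+ #|Q| * pw 0 (2 * L - lg (nm Q)).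
Proof.
move=> p0P hmh; have [pp wp _ _ _] := prset_facts p0P.
have p00 := prime_gt0 pp.
set P' := P :\ p0; have P'P : P' \subset P by rewrite subsetDl.
set M := (W * p0)%N; have M0 : (0 < M)%N by rewrite muln_gt0 W_gt0.
have coW : coprime W p0 by rewrite coprime_sym coprime_fact.
set v := chinese W p0 v0 (p0 - hm %% p0).
have vE n : (n == v %[mod M]) = (n == v0 %[mod W]) && (p0 %| n + hm)%N.
  by rewrite /v /M chinese_remainder // dvdn_add_mod // (chinese_modl coW) (chinese_modr coW).
set l' := fun A => l A + l (p0 |: A).
have swE n : (p0 %| n + hm)%N -> sieve_weight n =
   (\sum_(A : {set 'I_z} | (A \subset P') && [forall p in A, (p %| tprod hs n)%N]) l' A) ^+ 2.
  move=> pn; rewrite /sieve_weight; congr (_ ^+ 2).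
  rewrite big_mkcondr -{1}(setD1K p0P) sum_subsetU1 ?inE ?eqxx // -big_split /= big_mkcondr.
  apply: eq_bigr => A AP.
  have -> : [forall p in p0 |: A, (p %| tprod hs n)%N] = [forall p in A, (p %| tprod hs n)%N].
    apply/forallP/forallP => hh p; have := hh p; rewrite !inE.
      by case: (p \in A); rewrite ?orbT.
    case: eqP => [->|//] _ /=; rewrite prime_dvd_tprod //; apply/hasP; by exists hm.
  by case: ifP => // _; rewrite addr0.
under eq_bigl do rewrite -vE.
have -> : \sum_(1 <= n < N.+1 | n == v %[mod M]) sieve_weight n =
  \sum_(1 <= n < N.+1 | n == v %[mod M]) 1 *
   (\sum_(A : {set 'I_z} | (A \subset P') && [forall p in A, (p %| tprod hs n)%N]) l' A) ^+ 2.
  by apply: eq_bigr => n; rewrite vE => /andP[_ pn]; rewrite mul1r swE.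
rewrite quad_expand.
set S := fun Q : {set 'I_z} => \sum_(1 <= n < N.+1 | (n == v %[mod M]) && [forall p in Q, (p %| tprod hs n)%N]) (1 : R).
have lb (A : {set 'I_z}) : A \subset P' -> `|l' A| <= 3 * Lam * 2 ^+ #|A| * pw 0 (L - lg (nm A)).
  move=> AP; have AP' := subset_trans AP P'P.
  have pA : p0 \notin A by apply/negP => /(subsetP AP); rewrite !inE eqxx.
  have UP : p0 |: A \subset P by rewrite subUset sub1set p0P.
  apply: (le_trans (ler_normD _ _)); apply: (le_trans (lerD (l_bound AP') (l_bound UP))).
  have pwm : pw 0 (L - lg (nm (p0 |: A))) <= pw 0 (L - lg (nm A)).
    apply: (proj2 (pw_nneg_nondec 0)); rewrite nm_setU1 // lgM //; last exact: (nm_gt0 AP').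
    by have := lg_ge0 p00; lra.
  rewrite cardsU1 pA add1n exprS.
  have c0 : 0 <= Lam * 2 ^+ #|A| by rewrite mulr_ge0 ?Lam_ge0 // exprn_ge0.
  have := ler_wpM2l c0 pwm.
  have -> : Lam * (2 * 2 ^+ #|A|) * pw 0 (L - lg (nm (p0 |: A))) = 2 * (Lam * 2 ^+ #|A| * pw 0 (L - lg (nm (p0 |: A)))) by ring.
  have -> : 3 * Lam * 2 ^+ #|A| * pw 0 (L - lg (nm A)) = 3 * (Lam * 2 ^+ #|A| * pw 0 (L - lg (nm A))) by ring.
  move: (Lam * 2 ^+ #|A| * _) (Lam * 2 ^+ #|A| * _) => x1 x2; lra.
have := @quad_remainder z w P' l' S (fun Q => N%:R / M%:R * \prod_(p in Q) g p) (fun Q => k%:R ^+ #|Q|) (3 * Lam) L P'P (mulr_ge0 (ler0n _ 3) Lam_ge0) lb.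
have hE (Q : {set 'I_z}) : Q \subset P' -> lg (nm Q) <= 2 * L ->
   `|S Q - N%:R / M%:R * \prod_(p in Q) g p| <= k%:R ^+ #|Q|.
  move=> QP' _; have QP := subset_trans QP' P'P.
  have coM : {in Q, forall p : 'I_z, coprime p M}.
    move=> p pQ; have [pp' _ _ _ _] := prset_facts (subsetP QP p pQ).
    rewrite coprimeMr (coprime_W QP) //= prime_coprime // dvdn_prime2 //.
    by have := subsetP QP' p pQ; rewrite !inE => /andP[].
  have := @class_sum_bound M v hs z Q 1 N.+1 (fun=> 1) (N%:R / (M * nm Q)%:R) 1 M0 (class_hyp (fun x => id) uhs QP coM).
  have n0 := nm_gt0 QP.
  move=> /(_ (fun b _ _ => card_class_le N b _)); rewrite muln_gt0 M0 n0 => /(_ isT).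
  rewrite natrX mulr1 -/(S Q).
  have -> // : k%:R ^+ #|Q| * (N%:R / (M * nm Q)%:R) = N%:R / M%:R * \prod_(p in Q) g p.
  rewrite /g big_split /= prodr_const prod_div_nm natrM invfM; ring.
move=> /(_ hE).
have l'E (A : {set 'I_z}) : A \subset P' -> l' A = selberg_weight P' g h (fun S => y S - y (p0 |: S)) A.
  move=> AP; exact: (selberg_weight_merge y p0P (g_neq0 p0P) (h_neq0 p0P) (ghE p0P) AP).
have -> : \sum_(A : {set 'I_z} | A \subset P') \sum_(B : {set 'I_z} | B \subset P')
   l' A * l' B * (N%:R / M%:R * \prod_(p in A :|: B) g p) =
   N%:R / M%:R * \sum_(R0 : {set 'I_z} | R0 \subset P') \prod_(p in R0) h p * (y R0 - y (p0 |: R0)) ^+ 2.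
  have inP p : p \in P' -> p \in P by apply: (subsetP P'P).
  have e := selberg_form (fun S => y S - y (p0 |: S)) (fun p hp => g_neq0 (inP p hp))
    (fun p hp => h_neq0 (inP p hp)) (fun p hp => ghE (inP p hp)).
  rewrite -e !mulr_sumr; apply: eq_bigr => A AP; rewrite mulr_sumr; apply: eq_bigr => B BP.
  rewrite !l'E //; ring.
rewrite ler_norml => /andP[_]; rewrite lerBlDr addrC => hh.
apply: (le_trans hh); apply: lerD; last first.
  apply: ler_wpM2l; first exact: sqr_ge0.
  rewrite [leRHS](bigID (fun Q : {set 'I_z} => Q \subset P')) /=.
  apply: (@le_trans _ _ (\sum_(Q : {set 'I_z} | (Q \subset P) && (Q \subset P'))
     (9 * k)%:R ^+ #|Q| * pw 0 (2 * L - lg (nm Q)))); last first.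
    by rewrite lerDl sumr_ge0 // => Q _; rewrite mulr_ge0 ?exprn_ge0 ?(proj1 (pw_nneg_nondec 0)).
  rewrite le_eqVlt; apply/orP; left; apply/eqP; apply: eq_big => [Q|Q _]; last by rewrite natrM exprMn.
  by case: (boolP (Q \subset P')) => QP; rewrite ?andbF // andbT (subset_trans QP P'P).
apply: ler_wpM2l; first by rewrite divr_ge0.
have h0 : {in P, forall p, 0 <= h p} by move=> p /h_gt0 /ltW.
apply: le_trans (ler_wpM2l (sqr_ge0 _) (wsum_subset L P'P h0 (proj1 (pw_nneg_nondec 0)))).
rewrite /wsum mulr_sumr; apply: ler_sum => A AP.
have AP' := subset_trans AP P'P.
have pA : p0 \notin A by apply/negP => /(subsetP AP); rewrite !inE eqxx.
rewrite [leRHS]mulrCA; apply: ler_wpM2l; first exact: (prodr_ge0_in h0).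
have lA := lg_nm_ge0 AP'.
have sL : L - lg (nm A) <= L by lra.
have := Yf_lip a0 dl0 L0 (lg_ge0 p00) sL.
have -> : L - lg (nm A) - lg p0 = L - lg (nm (p0 |: A)).
  rewrite nm_setU1 // lgM ?(nm_gt0 AP') //; ring.
move=> /andP[d0 d1].
have -> : (Lip a dl * (lg p0 / L)) ^+ 2 * pw 0 (L - lg (nm A)) = (Lip a dl * (lg p0 / L) * pw 0 (L - lg (nm A))) ^+ 2.
  by rewrite [RHS]exprMn pw0_sq.
by rewrite lerXn2r ?nnegrE // (le_trans d0 d1).
Qed.

End Sieve.

(** * Level of distribution *)

Lemma sum1E (n : nat) (f : nat -> R) : sum1 n f = \sum_(1 <= i < n.+1) f i.
Proof.
elim: n => [|n IH]; first by rewrite big_geq.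
by rewrite big_nat_recr //= IH.
Qed.

Lemma maxR_ge0 (s : seq R) : 0 <= maxR s.
Proof.
elim: s => [|x s IH]; first exact: (lexx (0 : R)).
by apply: le_trans IH _; apply/RleP; apply: Rmax_r.
Qed.

Lemma maxR_ge (s : seq R) (x : R) : x \in s -> x <= maxR s.
Proof.
elim: s => [|y s IH] //=; rewrite inE => /predU1P[->|/IH h]; first by apply/RleP; apply: Rmax_l.
by apply: le_trans h _; apply/RleP; apply: Rmax_r.
Qed.

Lemma maxR_le (s : seq R) (B : R) : 0 <= B -> {in s, forall x, x <= B} -> maxR s <= B.
Proof.
move=> B0; elim: s => [|y s IH] h //=; apply/RleP; apply: Rmax_lub; apply/RleP.
  by apply: h; rewrite inE eqxx.
by apply: IH => x xs; apply: h; rewrite inE xs orbT.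
Qed.

Lemma sum_q_leE (X : R) (F : nat -> R) :
  sum_q_le X F = \sum_(1 <= q < (Z.to_nat (up X)).+1) (if q%:R <= X then F q else 0).
Proof.
rewrite /sum_q_le sum1E; apply: eq_bigr => q _; rewrite INRE.
by case: Rle_dec => h /=; [rewrite (introT RleP h) | rewrite (negbTE (introN RleP h))].
Qed.

Lemma le_up_nat (X : R) (q : nat) : q%:R <= X -> (q <= Z.to_nat (up X))%N.
Proof.
move=> /RleP; rewrite -INRE => qX; have [h _] := archimed X.
have u0 : Z.le Z0 (up X).
  by apply: le_IZR; apply: Rlt_le; apply: Rle_lt_trans h; apply: Rle_trans qX; apply: pos_INR.
apply/ssrnat.leP; apply: INR_le.
have -> : INR (Z.to_nat (up X)) = IZR (up X) by rewrite INR_IZR_INZ Z2Nat.id.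
by apply: Rlt_le; apply: Rle_lt_trans h.
Qed.

Definition vth (n : nat) : R := if prime n then lg n else 0.

(** The summand of condition (A), written so that [levelA] holds by conversion; [errB] does the same
    for (B). *)
Definition errA (N q : nat) : R :=
  maxR (List.map (fun a => Rabs (Rminus (sum1 N (fun p => if prime p && (p %% q == a %% q)%N
                           then ln (INR p) else IZR Z0))
          (Rdiv (INR N) (INR (totient q)))))
        (List.filter (fun a => coprime a q) (seq.iota 0 q))).

Definition errB (N q : nat) : R :=
  maxR (List.map (fun y =>
         maxR (List.map (fun a => Rabs (
            sum1 y (fun n => if (n %% q == a %% q)%N then liouville n else IZR Z0)))
           (seq.iota 0 q)))
        (seq.iota 0 N.+1)).

Lemma vth_sumE (N q b : nat) :
  sum1 N (fun p => if prime p && (p %% q == b %% q)%N then ln (INR p) else IZR Z0) =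
  \sum_(1 <= n < N.+1 | n == b %[mod q]) vth n.
Proof.
rewrite sum1E [RHS]big_mkcond; apply: eq_bigr => n _; rewrite /vth /lg.
by case: prime; case: (_ == _).
Qed.

Lemma errA_ge (N q b : nat) : (0 < q)%N -> coprime b q ->
  `|\sum_(1 <= n < N.+1 | n == b %[mod q]) vth n - N%:R / (totient q)%:R| <= errA N q.
Proof.
move=> q0 co; apply: maxR_ge.
have -> : `|\sum_(1 <= n < N.+1 | n == b %[mod q]) vth n - N%:R / (totient q)%:R| =
  (fun a => Rabs (Rminus (sum1 N (fun p => if prime p && (p %% q == a %% q)%N
                           then ln (INR p) else IZR Z0))
          (Rdiv (INR N) (INR (totient q))))) (b %% q)%N.
  rewrite vth_sumE RabsE RminusE RdivE !INRE; congr (`|_ - _|).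
  by apply: eq_bigl => n; rewrite modn_mod.
apply: (map_f (fun a : nat => _)).
have -> : List.filter (fun a => coprime a q) (seq.iota 0 q) = seq.filter (fun a => coprime a q) (seq.iota 0 q) by [].
by rewrite mem_filter coprime_modl co mem_iota /= add0n ltn_pmod.
Qed.

Lemma errA_le (N q : nat) (B : R) : (0 < q)%N -> 0 <= B ->
  (forall b, `|\sum_(1 <= n < N.+1 | n == b %[mod q]) vth n - N%:R / (totient q)%:R| <= B) ->
  errA N q <= B.
Proof.
move=> q0 B0 hB; apply: maxR_le => // x /(@mapP _ _ (fun a : nat => _)) [b _ ->].
by rewrite vth_sumE RabsE RminusE RdivE !INRE.
Qed.

Lemma liou_sumE (N q b : nat) :
  sum1 N (fun n => if (n %% q == b %% q)%N then liouville n else IZR Z0) =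
  \sum_(1 <= n < N.+1 | n == b %[mod q]) liouville n.
Proof. by rewrite sum1E [RHS]big_mkcond. Qed.

Lemma errB_ge (N q b : nat) : (0 < q)%N ->
  `|\sum_(1 <= n < N.+1 | n == b %[mod q]) liouville n| <= errB N q.
Proof.
move=> q0; set f := fun y : nat => maxR (List.map (fun a => Rabs (
            sum1 y (fun n => if (n %% q == a %% q)%N then liouville n else IZR Z0)))
           (seq.iota 0 q)).
apply: (@le_trans _ _ (f N)); last first.
  apply: (@maxR_ge [seq f y | y <- seq.iota 0 N.+1]).
  by apply: (map_f f); rewrite mem_iota /= add0n.
apply: maxR_ge.
have -> : `|\sum_(1 <= n < N.+1 | n == b %[mod q]) liouville n| =
  (fun a => Rabs (sum1 N (fun n => if (n %% q == a %% q)%N then liouville n else IZR Z0))) (b %% q)%N.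
  rewrite liou_sumE RabsE; congr (`|_|).
  by apply: eq_bigl => n; rewrite modn_mod.
by apply: (map_f (fun a : nat => _)); rewrite mem_iota /= add0n ltn_pmod.
Qed.

Lemma errB_le (N q : nat) (B : R) : (0 < q)%N -> 0 <= B ->
  (forall y b, (y <= N)%N -> `|\sum_(1 <= n < y.+1 | n == b %[mod q]) liouville n| <= B) ->
  errB N q <= B.
Proof.
move=> q0 B0 hB.
pose f (y a : nat) := Rabs (sum1 y (fun n => if (n %% q == a %% q)%N then liouville n else IZR Z0)).
apply: (@maxR_le [seq maxR [seq f y a | a <- seq.iota 0 q] | y <- seq.iota 0 N.+1]) => // x /mapP[y].
rewrite mem_iota /= add0n ltnS => yN ->.
apply: maxR_le => // x' /mapP[b _ ->]; rewrite /f.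
by rewrite liou_sumE RabsE hB.
Qed.

Lemma liouville_norm (n : nat) : `|liouville n| = 1.
Proof. by rewrite /liouville RpowE normrX normrN1 expr1n. Qed.

Definition ex (x : R) : R := exp x.

(** The common shape of (A) and (B). Integral A and K >= 0 are all that is used, and they keep the
    powers of the logarithm algebraic. *)
Definition level (err : nat -> nat -> R) (theta : R) : Prop :=
  forall (eps : R) (A : nat), 0 < eps -> (0 < A)%N ->
  exists K : R, 0 <= K /\ forall N : nat, (2 <= N)%N ->
    sum_q_le (ex ((theta - eps) * lg N)) (err N) <= K * N%:R / lg N ^+ A.

Lemma Rpower_lg (N : nat) (x : R) : Rpower (INR N) x = ex (x * lg N).
Proof. by []. Qed.

Lemma Rpower_lgX (N A : nat) : (2 <= N)%N -> Rpower (lg N) (INR A) = lg N ^+ A.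
Proof.
move=> N2; have l0 : 0 < lg N by rewrite -lg1; apply: lg_lt.
by rewrite Rpower_pow ?RpowE //; apply/RltP.
Qed.

Lemma level_of (err : nat -> nat -> R) (theta : R) :
  (forall eps A : R, Rlt 0 eps -> Rlt 0 A -> exists K : R, forall N : nat, (2 <= N)%N ->
    Rle (sum_q_le (Rpower (INR N) (Rminus theta eps)) (err N))
      (Rdiv (Rmult K (INR N)) (Rpower (ln (INR N)) A))) ->
  level err theta.
Proof.
move=> h eps A e0 A0; have [|K hK] := h eps (INR A) _ (INR_gt0 A0); first exact/RltP.
exists (Num.max K 0); split; first by rewrite le_max lexx orbT.
move=> N N2; have /RleP := hK N N2.
rewrite Rpower_lg -/(lg N) Rpower_lgX // RminusE RdivE RmultE INRE => hh.
have l0 : 0 < lg N by rewrite -lg1; apply: lg_lt.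
apply: (le_trans hh); rewrite ler_wpM2r ?invr_ge0 ?exprn_ge0 ?(ltW l0) //.
by rewrite ler_wpM2r // le_max lexx.
Qed.

Lemma levelA (theta : R) : condA theta -> level errA theta.
Proof. by move=> h; apply: level_of. Qed.

Lemma levelB (theta : R) : condB theta -> level errB theta.
Proof. by move=> h; apply: level_of. Qed.

(** With eps = theta the moduli satisfy q <= N^0 = 1, and (A) becomes the prime number theorem with
    a weak error term, which is more than Chebyshev's bound. *)
Lemma chebyshev_of_level (theta : R) : 0 < theta -> level errA theta ->
  exists C : R, 0 <= C /\ forall n : nat, \sum_(1 <= p < n.+1) vth p <= C * n%:R.
Proof.
move=> t0 /(_ theta 1%N t0 isT) [K [K0 hK]].
have l2 : 0 < lg 2 by rewrite -lg1; apply: lg_lt.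
have Kl : 0 <= K / lg 2 by rewrite divr_ge0 // ltW.
exists (1 + K / lg 2); split; first by rewrite addr_ge0.
case=> [|[|n]]; first by rewrite big_geq // mulr0.
  by rewrite big_nat1 /vth /= mulr1 addr_ge0.
set N := n.+2; have N2 : (2 <= N)%N by [].
have count_error : ex ((theta - theta) * lg N) = 1 by rewrite /ex subrr mul0r exp_0.
have := hK N N2; rewrite sum_q_leE count_error.
have h1 : (1 <= Z.to_nat (up (1 : R)))%N by apply: le_up_nat.
rewrite big_ltn // lexx => hh.
have pos : 0 <= \sum_(2 <= q < (Z.to_nat (up (1 : R))).+1) (if q%:R <= (1 : R) then errA N q else 0).
  by apply: sumr_ge0 => q _; case: ifP => // _; apply: maxR_ge0.
have := @errA_ge N 1 0 isT; rewrite coprimen1 => /(_ isT).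
have -> : totient 1 = 1%N by [].
under eq_bigl do rewrite !modn1 eqxx.
rewrite divr1 => h2.
have h3 : K * N%:R / lg N ^+ 1 <= K / lg 2 * N%:R.
  rewrite expr1 mulrAC ler_wpM2r // ler_wpM2l // lef_pV2 ?posrE //; first exact: lg_le.
  by apply: lt_le_trans l2 _; apply: lg_le.
have := le_trans (ler_norm _) h2; rewrite mulrDl mul1r.
move: hh pos h3; move: (K * N%:R / lg N ^+ 1) (K / lg 2 * N%:R) (errA N 1) => x1 x2 x3.
move: (\sum_(2 <= q < _) _) (\sum_(1 <= p < _) _) => x4 x5; lra.
Qed.

(** Partial summation as an induction. The quantity that propagates is C lg T plus the mean of [vth]
    up to T: the decrease of the mean caused by a larger denominator is at most C/(T + 1), which the
    growth of C lg T covers. *)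
Lemma mertens_upper (C : R) : 0 <= C -> (forall n : nat, \sum_(1 <= p < n.+1) vth p <= C * n%:R) ->
  forall T : nat, (0 < T)%N -> \sum_(1 <= p < T.+1) vth p / p%:R <= C * (1 + lg T).
Proof.
move=> C0 hC T T0.
suff h : \sum_(1 <= p < T.+1) vth p / p%:R <= C * lg T + (\sum_(1 <= p < T.+1) vth p) / T%:R.
  apply: (le_trans h); rewrite mulrDr mulr1 addrC lerD2r.
  by rewrite ler_pdivrMr ?ltr0n.
case: T T0 => // T _; elim: T => [|T IH].
  by rewrite !big_nat1 lg1 mulr0 add0r.
rewrite big_nat_recr //= [X in _ <= _ + X / _]big_nat_recr //=.
have hT := hC T.+1.
have l1 := lgS_ge (ltn0Sn T).
have T1 : (0 < T.+1%:R :> R) by rewrite ltr0n.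
have T2 : T.+2%:R = T.+1%:R + 1 :> R by rewrite -[in LHS]natr1.
move: IH hT l1; rewrite T2; move: (\sum_(1 <= p < T.+2) vth p / p%:R) (\sum_(1 <= p < T.+2) vth p) (vth T.+2).
move: (lg T.+2) (lg T.+1) (T.+1%:R : R) T1 => l2 l1' x x0 m s v IH hs hl.
have x1 : 0 < x + 1 by lra.
have e : s / x = s / (x + 1) + s / x / (x + 1) by field; lra.
have b : s / x / (x + 1) <= C * (l2 - l1').
  apply: (@le_trans _ _ (C * (x + 1)^-1)); last by rewrite ler_wpM2l.
  by rewrite ler_wpM2r ?invr_ge0 ?(ltW x1) // ler_pdivrMr.
rewrite mulrDl; lra.
Qed.

(** One-sided o(N), sufficient for upper bounds on errors. *)
Definition negl (f : nat -> R) : Prop :=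
  forall eps : R, 0 < eps -> exists N0 : nat, forall N, (N0 <= N)%N -> f N <= eps * N%:R.

Lemma lg_large (x : R) : exists N0 : nat, forall N, (N0 <= N)%N -> x <= lg N.
Proof.
have [Z Z0 h] := lg_unbounded x; exists Z => N ZN.
by apply: (le_trans (ltW h)); apply: lg_le.
Qed.

Lemma eventually_and (P Q : nat -> Prop) :
  (exists N0, forall N, (N0 <= N)%N -> P N) -> (exists N0, forall N, (N0 <= N)%N -> Q N) ->
  exists N0, forall N, (N0 <= N)%N -> P N /\ Q N.
Proof.
move=> [a ha] [b hb]; exists (maxn a b) => N; rewrite geq_max => /andP[aN bN].
by split; [apply: ha | apply: hb].
Qed.

Lemma negl_add (f g : nat -> R) : negl f -> negl g -> negl (fun N => f N + g N).
Proof.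
move=> hf hg e e0; have e2 : 0 < e / 2 by rewrite divr_gt0.
have [N0 h] := eventually_and (hf _ e2) (hg _ e2); exists N0 => N /h [h1 h2].
by apply: (le_trans (lerD h1 h2)); lra.
Qed.

Lemma negl_le (f g : nat -> R) : (exists N0, forall N, (N0 <= N)%N -> f N <= g N) ->
  negl g -> negl f.
Proof.
move=> hfg hg e e0; have [N0 h] := eventually_and hfg (hg _ e0); exists N0 => N /h [h1 h2].
exact: le_trans h1 h2.
Qed.

Lemma exD (x y : R) : ex (x + y) = ex x * ex y.
Proof. by rewrite /ex exp_plus. Qed.

Lemma exX (x : R) (n : nat) : ex x ^+ n = ex (x *+ n).
Proof. exact: expRX. Qed.

Lemma ex_lg (N : nat) : (0 < N)%N -> ex (lg N) = N%:R.
Proof. by move=> N0; rewrite /ex /lg exp_ln; [rewrite INRE | exact: INR_gt0]. Qed.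

Lemma ex_ge1D (x : R) : 1 + x <= ex x.
Proof. by apply/RleP; apply: exp_ineq1_le. Qed.

Lemma ex_gt0 (x : R) : 0 < ex x.
Proof. by apply/RltP; apply: exp_pos. Qed.

Lemma ex_le (x y : R) : x <= y -> ex x <= ex y.
Proof.
by rewrite le_eqVlt => /predU1P[->//|/RltP h]; apply/ltW/RltP; apply: exp_increasing.
Qed.

(** N^(1 - tau) is split into B + 1 equal powers N^d: B of them absorb the power of the logarithm,
    and the last one supplies the small constant. *)
Lemma negl_polyex (C tau : R) (B : nat) : 0 <= C -> tau < 1 ->
  negl (fun N => C * (1 + lg N) ^+ B * ex (tau * lg N)).
Proof.
move=> C0 t1 e e0.
set d := (1 - tau) / B.+1%:R.
have B1 : (0 < B.+1%:R :> R) by rewrite ltr0n.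
have d0 : 0 < d by rewrite divr_gt0 //; lra.
set D := (2 / d) ^+ B.
have dd : 0 <= 2 / d by rewrite divr_ge0 // ltW.
have D0 : 0 <= D by rewrite exprn_ge0.
have [N0 hN0] := eventually_and (lg_large 1) (lg_large (C * D / (e * d))).
exists (maxn N0 1) => N; rewrite geq_max => /andP[/hN0 [l1 l2] N1].
have l0 : 0 <= lg N by apply: lg_ge0.
have b1 : d * lg N <= ex (d * lg N) by apply: le_trans (ex_ge1D _); lra.
have -> : e * N%:R = e * ex (d * lg N) ^+ B.+1 * ex (tau * lg N).
  rewrite -mulrA; congr (_ * _).
  rewrite -(ex_lg N1) exX -exD; congr ex.
  have B1' : (B.+1%:R : R) != 0 by rewrite gt_eqF.
  rewrite -mulr_natr /d; move: (B.+1%:R : R) B1' => x x0; by field.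
rewrite ler_wpM2r ?(ltW (ex_gt0 _)) //.
have h1 : (1 + lg N) ^+ B <= D * ex (d * lg N) ^+ B.
  have q1 : 0 <= 1 + lg N by lra.
  have q2 : 0 <= 2 / d * ex (d * lg N) by apply: mulr_ge0 => //; exact/ltW/ex_gt0.
  rewrite /D -exprMn; apply: lerXn2r; rewrite ?nnegrE //.
  apply: (@le_trans _ _ (2 / d * (d * lg N))); last exact: ler_wpM2l.
  have -> : 2 / d * (d * lg N) = 2 * lg N by field; rewrite gt_eqF.
  lra.
apply: (le_trans (ler_wpM2l C0 h1)).
rewrite exprS [leLHS]mulrA [leRHS]mulrA ler_wpM2r ?exprn_ge0 ?(ltW (ex_gt0 _)) //.
apply: (@le_trans _ _ (e * (d * lg N))); last by rewrite ler_wpM2l // ltW.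
have -> : e * (d * lg N) = lg N * (e * d) by ring.
have ed : 0 < e * d by exact: mulr_gt0.
by move: l2; rewrite ler_pdivrMr.
Qed.

Lemma negl_invlog (C : R) : 0 <= C -> negl (fun N => C * N%:R / lg N).
Proof.
move=> C0 e e0; have [N0 h] := eventually_and (lg_large 1) (lg_large (C / e)).
exists N0 => N /h [l1 l2]; have l0 : 0 < lg N by lra.
rewrite mulrAC ler_wpM2r // ler_pdivrMr //; move: l2; rewrite ler_pdivrMr //; lra.
Qed.

(** * Error terms *)

(** Just above exp L, so that L < lg z: a divisor with logarithm at most L has all its prime factors
    below z. *)
Definition zN (L : R) : nat := Z.to_nat (up (ex L)).

Lemma zN_facts (L : R) : [/\ (0 < zN L)%N, L < lg (zN L) & (zN L)%:R <= ex L + 1].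
Proof.
have [h1 h2] := archimed (ex L); have e0 := exp_pos L.
have u0 : Z.le Z0 (up (ex L)) by apply: le_IZR; apply: Rlt_le; apply: Rlt_trans h1.
have e : INR (zN L) = IZR (up (ex L)) by rewrite INR_IZR_INZ Z2Nat.id.
split.
- by apply/ssrnat.ltP; apply: INR_lt; rewrite e; apply: Rlt_trans h1.
- by apply/RltP; rewrite -{1}(ln_exp L) /lg; apply: ln_increasing => //; rewrite e.
- rewrite -INRE e; move/RleP: h2; rewrite RminusE R1E; lra.
Qed.

Lemma dens_le1 (w : nat) : dens w <= 1.
Proof.
rewrite /dens ler_pdivrMr ?ltr0n ?fact_gt0 // mul1r -(card_coprime_block 0 (fact_gt0 w)).
rewrite add0n big_mkcond /=; apply: (@le_trans _ _ (\sum_(0 <= n < w`!) (1 : R))).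
  by apply: ler_sum => n _; case: ifP.
by rewrite sumr_const_nat subn0.
Qed.

Definition CK (w K : nat) : R := (1 + K%:R * C1 w) ^+ K.

Lemma CK_ge0 (w K : nat) : 0 <= CK w K.
Proof. by rewrite exprn_ge0 // addr_ge0 // mulr_ge0 // C1_ge0. Qed.

Lemma wsum_K_le (z w K : nat) (X l : R) : 0 <= X <= l ->
  wsum (prset z w) (fun p => K%:R / p%:R) (pw 0) X <= CK w K * (1 + l) ^+ K.
Proof.
move=> /andP[X0 Xl]; have Cw := C1_ge0 w.
apply: (le_trans (dsum_pw_le K 0 (subxx _) X0)); rewrite add0n.
have KC : 0 <= K%:R * C1 w by rewrite mulr_ge0.
have h1 : dens w ^+ K * (0`!%:R / K`!%:R) <= 1 :> R.
  rewrite -[leRHS]mulr1; apply: ler_pM; rewrite ?exprn_ge0 ?(ltW (dens_gt0 w)) ?divr_ge0 //.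
    by rewrite exprn_ile1 ?dens_le1 // ltW // dens_gt0.
  by rewrite fact0 mul1r invf_le1 ?ler1n ?ltr0n fact_gt0.
have h2 : (X + K%:R * C1 w) ^+ K <= CK w K * (1 + l) ^+ K.
  rewrite /CK -exprMn; apply: lerXn2r; rewrite ?nnegrE; [exact: addr_ge0 | |].
    by rewrite mulr_ge0 ?addr_ge0 // (le_trans X0).
  have l0 := le_trans X0 Xl; move: (K%:R * C1 w) KC => c c0; nra.
rewrite -[leRHS]mul1r; apply: ler_pM => //; last by rewrite exprn_ge0 // addr_ge0.
by rewrite mulr_ge0 ?exprn_ge0 ?(ltW (dens_gt0 w)) // divr_ge0.
Qed.

Definition CL (k w : nat) (a : nat -> R) : R := 2 * (a 0%N + a 1%N + a 2%N) * CK w k.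

Lemma half_le (k w : nat) : (0 < w)%N -> (4 * k * k <= w)%N ->
  2^-1 <= 1 - (2 * k * k)%:R / w%:R :> R.
Proof.
move=> w0 kw; have wR : (0 < w%:R :> R) by rewrite ltr0n.
have : (2 * k * k)%:R / w%:R <= 2^-1 :> R.
  rewrite ler_pdivrMr // ler_pdivlMl //.
  by rewrite -natrM ler_nat !mulnA.
by move: ((2 * k * k)%:R / w%:R : R) => x; lra.
Qed.

Lemma hsum_le2 (z k w : nat) (L : R) : (1 < k)%N -> (4 * k * k <= w)%N ->
  wsum (prset z w) (fun p => k%:R / (p%:R - k%:R)) (pw 0) L <=
  2 * wsum (prset z w) (fun p => k%:R / p%:R) (pw 0) L.
Proof.
move=> k0 kw; have w0 : (0 < w)%N by nia.
have kw' : (2 * k <= w)%N by nia.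
have := hsum_le L (subxx (prset z w)) w0 kw' (pw_nneg_nondec 0).
have h1 : 0 <= wsum (prset z w) (fun p => k%:R / (p%:R - k%:R)) (pw 0) L.
  apply: (proj1 (wsum_nneg_nondec _ (pw_nneg_nondec 0))) => p.
  by rewrite inE => /andP[_ wp]; rewrite divr_ge0 // subr_ge0 ler_nat; lia.
move: (half_le w0 kw) h1 => h2 h1 h3.
move: (1 - _) (wsum _ _ _ _) (wsum _ _ _ _) h1 h2 h3 => x y u; nra.
Qed.

Lemma weight_size_le (k w z : nat) (a : nat -> R) (L l : R) : (1 < k)%N -> (4 * k * k <= w)%N ->
  (forall i, 0 <= a i) -> 0 <= L <= l ->
  0 <= weight_size k w z a L <= CL k w a * (1 + l) ^+ k.
Proof.
move=> k0 kw a0 Ll; have s0 : 0 <= a 0%N + a 1%N + a 2%N by rewrite !addr_ge0.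
have h1 : 0 <= wsum (prset z w) (fun p => k%:R / (p%:R - k%:R)) (pw 0) L.
  apply: (proj1 (wsum_nneg_nondec _ (pw_nneg_nondec 0))) => p.
  by rewrite inE => /andP[_ wp]; rewrite divr_ge0 // subr_ge0 ler_nat; nia.
rewrite /weight_size mulr_ge0 //= /CL.
have -> : 2 * (a 0%N + a 1%N + a 2%N) * CK w k * (1 + l) ^+ k =
  (a 0%N + a 1%N + a 2%N) * (2 * (CK w k * (1 + l) ^+ k)) by ring.
rewrite ler_wpM2l //; apply: (le_trans (hsum_le2 _ _ k0 kw)).
by rewrite ler_wpM2l // wsum_K_le.
Qed.

Section Errors.
Variables (k w : nat) (a : nat -> R) (tau : R).
Hypothesis k0 : (1 < k)%N.
Hypothesis kw : (4 * k * k <= w)%N.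
Hypothesis a0 : forall i, 0 <= a i.
Hypothesis t0 : 0 < tau.
Hypothesis t1 : tau < 1.

(** Half of tau log N, since the lcm of two divisors of this size reaches N^tau. *)
Definition LN (N : nat) : R := tau / 2 * lg N.
Let z N := zN (LN N).
Let Lam N := weight_size k w (z N) a (LN N).
Let P N := prset (z N) w.

Lemma LN_facts (N : nat) : (0 < N)%N -> [/\ 0 <= LN N <= lg N, 0 <= 2 * LN N <= lg N & 2 * LN N = tau * lg N].
Proof.
move=> N0; have l0 := lg_ge0 N0.
have u0 : 0 <= tau * lg N by rewrite mulr_ge0 // ltW.
have u1 : tau * lg N <= lg N by rewrite ler_piMl // ltW.
have -> : LN N = 2^-1 * (tau * lg N) by rewrite /LN; ring.
move: (tau * lg N) u0 u1 => u u0 u1.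
by split; [apply/andP; split | apply/andP; split |]; lra.
Qed.

Lemma Lam_sq_le (N : nat) : (0 < N)%N -> Lam N ^+ 2 <= CL k w a ^+ 2 * (1 + lg N) ^+ (2 * k).
Proof.
move=> N0; have [h1 _ _] := LN_facts N0.
have /andP[l0 l1] := weight_size_le (z N) k0 kw a0 h1.
rewrite mulnC exprM -exprMn; apply: lerXn2r; rewrite ?nnegrE //; exact: le_trans l0 l1.
Qed.

Definition count_error (N : nat) : R :=
  Lam N ^+ 2 * \sum_(Q : {set 'I_(z N)} | Q \subset P N) (9 * k)%:R ^+ #|Q| * pw 0 (2 * LN N - lg (nm Q)).

Lemma count_error_ge0 (N : nat) : 0 <= count_error N.
Proof.
rewrite /count_error mulr_ge0 ?sqr_ge0 // sumr_ge0 // => Q _.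
by rewrite mulr_ge0 ?exprn_ge0 ?(proj1 (pw_nneg_nondec 0)).
Qed.

Lemma count_error_le (N : nat) : (0 < N)%N ->
  count_error N <= CL k w a ^+ 2 * CK w (9 * k) * (1 + lg N) ^+ (2 * k + 9 * k) * ex (tau * lg N).
Proof.
move=> N0; have [h1 h2 h3] := LN_facts N0; have l0 := lg_ge0 N0.
have := rsum_const_le (9 * k) (2 * LN N) (subxx (P N)); rewrite -/(ex _) => hr.
have hk := wsum_K_le (z N) w (9 * k) h2.
have hh := le_trans hr (ler_wpM2l (ltW (ex_gt0 _)) hk).
have -> : CL k w a ^+ 2 * CK w (9 * k) * (1 + lg N) ^+ (2 * k + 9 * k) * ex (tau * lg N) =
  (CL k w a ^+ 2 * (1 + lg N) ^+ (2 * k)) * (ex (2 * LN N) * (CK w (9 * k) * (1 + lg N) ^+ (9 * k))).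
  by rewrite exprD h3; ring.
apply: ler_pM => //; first exact: sqr_ge0.
- by apply: sumr_ge0 => Q _; rewrite mulr_ge0 ?exprn_ge0 ?(proj1 (pw_nneg_nondec 0)).
- exact: Lam_sq_le.
Qed.

(** The extra N^c accounts for the number of small primes over which this error gets summed. *)
Lemma negl_count_error (c : R) : 0 <= c -> tau + c < 1 -> negl (fun N => ex (c * lg N) * count_error N).
Proof.
move=> c0 tc; apply: (negl_le _ (negl_polyex (C := CL k w a ^+ 2 * CK w (9 * k)) (2 * k + 9 * k) _ tc)).
  exists 1%N => N N0; rewrite mulrDl exD.
  have -> : CL k w a ^+ 2 * CK w (9 * k) * (1 + lg N) ^+ (2 * k + 9 * k) * (ex (tau * lg N) * ex (c * lg N)) =
    ex (c * lg N) * (CL k w a ^+ 2 * CK w (9 * k) * (1 + lg N) ^+ (2 * k + 9 * k) * ex (tau * lg N)).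
    by move: (_ ^+ _) (_ ^+ _) => *; ring.
  by apply: ler_wpM2l; [exact/ltW/ex_gt0 | exact: count_error_le].
by rewrite mulr_ge0 ?sqr_ge0 ?CK_ge0.
Qed.

(** The accumulated cost of [ap_shift] for values bounded by (1 + h)(1 + log N), a bound valid for
    [vth] as well as for the Liouville function. *)
Definition shift_error (h N : nat) : R :=
  Lam N ^+ 2 * \sum_(Q : {set 'I_(z N)} | Q \subset P N) (9 * k)%:R ^+ #|Q| *
    ((1 + h%:R) * (1 + lg N) * ((z N + h)%:R / (w`! * nm Q)%:R + 1 + h%:R)) * pw 0 (2 * LN N - lg (nm Q)).

Lemma negl_shift_error (h : nat) : negl (shift_error h).
Proof.
set C := CL k w a ^+ 2 * CK w (9 * k) * ((1 + h%:R) * (3 + 2 * h%:R)).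
apply: (negl_le _ (negl_polyex (C := C) (2 * k + 9 * k + 1) _ t1)); last first.
  by rewrite /C mulr_ge0 ?mulr_ge0 ?sqr_ge0 ?CK_ge0 ?addr_ge0 // mulr_ge0.
exists 1%N => N N0; have [h1 h2 h3] := LN_facts N0; have l0 := lg_ge0 N0.
set S := wsum (P N) (fun p => (9 * k)%:R / p%:R) (pw 0) (2 * LN N).
have S0 : 0 <= S by apply: (proj1 (wsum_nneg_nondec (@kp_ge0 _ _ _) (pw_nneg_nondec 0))).
have hS : S <= CK w (9 * k) * (1 + lg N) ^+ (9 * k) by apply: wsum_K_le.
have e1 : 1 <= ex (2 * LN N) by apply: le_trans (ex_ge1D _); have /andP[] := h2; lra.
have zb : (z N + h)%:R <= (2 + h%:R) * ex (2 * LN N).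
  have [_ _ zz] := zN_facts (LN N).
  have : ex (LN N) <= ex (2 * LN N) by apply: ex_le; have /andP[] := h1; lra.
  have h0 : 0 <= h%:R :> R by [].
  rewrite natrD; move: zz; rewrite -/(z N).
  move: ((z N)%:R : R) (h%:R : R) (ex (LN N)) (ex (2 * LN N)) h0 e1 => *; nra.
have hb0 : 0 <= 1 + h%:R :> R by rewrite addr_ge0.
have hr := rsum_const_le (9 * k) (2 * LN N) (subxx (P N)); rewrite -/(ex _) in hr.
have main : \sum_(Q : {set 'I_(z N)} | Q \subset P N) (9 * k)%:R ^+ #|Q| *
    ((1 + h%:R) * (1 + lg N) * ((z N + h)%:R / (w`! * nm Q)%:R + 1 + h%:R)) * pw 0 (2 * LN N - lg (nm Q)) <=
   (1 + h%:R) * (1 + lg N) * ((3 + 2 * h%:R) * (ex (2 * LN N) * S)).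
  apply: (@le_trans _ _ ((1 + h%:R) * (1 + lg N) * ((z N + h)%:R * S + (1 + h%:R) *
     \sum_(Q : {set 'I_(z N)} | Q \subset P N) (9 * k)%:R ^+ #|Q| * pw 0 (2 * LN N - lg (nm Q))))).
    rewrite /S /wsum !mulr_sumr -big_split mulr_sumr /=; apply: ler_sum => Q QP.
    have -> : (9 * k)%:R ^+ #|Q| * ((1 + h%:R) * (1 + lg N) * ((z N + h)%:R / (w`! * nm Q)%:R + 1 + h%:R)) * pw 0 (2 * LN N - lg (nm Q)) =
      (1 + h%:R) * (1 + lg N) * ((z N + h)%:R * ((9 * k)%:R ^+ #|Q| / (w`! * nm Q)%:R * pw 0 (2 * LN N - lg (nm Q))) +
       (1 + h%:R) * ((9 * k)%:R ^+ #|Q| * pw 0 (2 * LN N - lg (nm Q)))).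
      by move: (_ ^+ #|Q|) (_^-1) ((z N + h)%:R) (pw 0 _) (lg N) (h%:R) => *; ring.
    rewrite ler_wpM2l ?mulr_ge0 ?addr_ge0 // lerD2r ler_wpM2l // ler_wpM2r ?(proj1 (pw_nneg_nondec 0)) //.
    rewrite big_split /= prodr_const prod_div_nm ler_wpM2l ?exprn_ge0 //.
    have n0 := nm_gt0 QP.
    by rewrite lef_pV2 ?posrE ?ltr0n ?muln_gt0 ?n0 ?fact_gt0 // ler_nat leq_pmull // fact_gt0.
  rewrite ler_wpM2l ?mulr_ge0 ?addr_ge0 //.
  apply: (le_trans (lerD (ler_wpM2r S0 zb) (ler_wpM2l hb0 hr))).
  rewrite -/S le_eqVlt; apply/orP; left; apply/eqP; move: (ex _) (h%:R) S {S0 hS hr} => *; ring.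
have -> : C * (1 + lg N) ^+ (2 * k + 9 * k + 1) * ex (tau * lg N) =
  (CL k w a ^+ 2 * (1 + lg N) ^+ (2 * k)) * ((1 + h%:R) * (1 + lg N) * ((3 + 2 * h%:R) *
    (ex (2 * LN N) * (CK w (9 * k) * (1 + lg N) ^+ (9 * k))))).
  rewrite /C h3 !exprD expr1; move: ((1 + lg N) ^+ (2 * k)) ((1 + lg N) ^+ (9 * k)) (ex _) (CL _ _ _) (CK _ _) => x1 x2 x3 x4 x5.
  move: (lg N) (h%:R : R) => *; ring.
apply: ler_pM; [exact: sqr_ge0 | | exact: Lam_sq_le |].
  apply: sumr_ge0 => Q _; rewrite mulr_ge0 ?(proj1 (pw_nneg_nondec 0)) // mulr_ge0 ?exprn_ge0 //.
  by rewrite mulr_ge0 ?mulr_ge0 ?addr_ge0 // divr_ge0.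
apply: (le_trans main); rewrite ler_wpM2l ?mulr_ge0 ?addr_ge0 // ler_wpM2l ?addr_ge0 ?mulr_ge0 //.
by rewrite ler_wpM2l ?(ltW (ex_gt0 _)).
Qed.

Definition level_error (err : nat -> nat -> R) (N : nat) : R :=
  Lam N ^+ 2 * \sum_(Q : {set 'I_(z N)} | Q \subset P N)
     (9 * k)%:R ^+ #|Q| * err N (w`! * nm Q)%N * pw 0 (2 * LN N - lg (nm Q)).

(** The level hypothesis bounds the errors without the weights (9k)^|Q|. By [rsum_amgm] each
    weighted error is split into t times the error, handled by [level], and 1/t times its trivial
    bound, handled by a sum of dimension K2; t is a power of the logarithm. *)
Lemma negl_level_error (err : nat -> nat -> R) (theta : R) : tau < theta -> level err theta ->
  (forall N q, 0 <= err N q) ->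
  (forall N (Q : {set 'I_(z N)}), (0 < N)%N -> Q \subset P N -> lg (nm Q) <= 2 * LN N ->
     err N (w`! * nm Q)%N <= 3 * N%:R * (1 + lg N) * 2 ^+ #|Q| / (nm Q)%:R) ->
  negl (level_error err).
Proof.
move=> tt lev err0 triv.
set K2 := (2 * (9 * k) * (9 * k))%N.
(* [Bt] lets 1/t beat the logarithms from the squared weight size, the trivial bound and the sum of
   dimension K2, with one to spare; A then beats the squared weight size times t, again with one to
   spare. *)
set Bt := (2 * k + 1 + K2 + 1)%N; set A := (2 * k + Bt + 1)%N.
(* Half of the gap between tau and theta is left to absorb the factor w! of the moduli. *)
set eps := (theta - tau) / 2; have eps0 : 0 < eps by rewrite /eps; lra.
have [K [K0 hK]] := lev eps A eps0 (ltn_addl _ (ltn0Sn 0)).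
set D := CL k w a ^+ 2; have D0 : 0 <= D by exact: sqr_ge0.
have CK0 := CK_ge0 w K2.
set C := 2^-1 * D * (2 ^+ (A.-1) * K + 3 * CK w K2).
have C0 : 0 <= C.
  apply: mulr_ge0; first by apply: mulr_ge0 => //; rewrite invr_ge0.
  by apply: addr_ge0; apply: mulr_ge0 => //; rewrite exprn_ge0.
apply: (negl_le _ (negl_invlog C0)).
have [N0 hN0] := eventually_and (lg_large 1) (lg_large (lg w`! / eps)).
exists (maxn N0 2) => N; rewrite geq_max => /andP[/hN0 [l1 l2] N2].
have N1 : (0 < N)%N by apply: leq_trans N2.
have [h1 h2 h3] := LN_facts N1.
set l := lg N in l1 l2 *.
have l0 : 0 < l by lra.
have l0' : 0 < 1 + l by lra.
set t := (1 + l) ^+ Bt; have t0' : 0 < t by rewrite exprn_gt0.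
set SB := K * N%:R / l ^+ A.
have hSB : \sum_(Q : {set 'I_(z N)} | Q \subset P N) err N (w`! * nm Q)%N * pw 0 (2 * LN N - lg (nm Q)) <= SB.
  apply: le_trans (hK N N2); rewrite sum_q_leE -/l; set X := ex _.
  set D' := fun Q : {set 'I_(z N)} => (Q \subset P N) && (lg (nm Q) <= 2 * LN N).
  have WX (Q : {set 'I_(z N)}) : D' Q -> ((w`! * nm Q)%:R <= X).
    move=> /andP[QP lQ]; have n0 := nm_gt0 QP.
    rewrite -ex_lg ?muln_gt0 ?fact_gt0 // /X; apply: ex_le; rewrite lgM ?fact_gt0 //.
    move: l2; rewrite ler_pdivrMr // => l2.
    have -> : (theta - eps) * l = l * eps + tau * l by rewrite /eps; field.
    by rewrite -h3 lerD.
  apply: (@le_trans _ _ (\sum_(Q : {set 'I_(z N)} | D' Q) (fun q => if q%:R <= X then err N q else 0) (w`! * nm Q)%N)).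
    rewrite /D' [leRHS]big_mkcondr; apply: ler_sum => Q QP; rewrite /pw.
    case: (leP (lg (nm Q)) (2 * LN N)) => hQ.
      rewrite WX ?/D' ?QP ?hQ //.
      by rewrite subr_ge0 hQ expr0 mulr1.
    have -> : (0 <= 2 * LN N - lg (nm Q)) = false by apply/negbTE; rewrite -ltNge; lra.
    by rewrite mulr0.
  apply: (sum_inj_le (G := fun q => if q%:R <= X then err N q else 0)).
  - move=> Q Q' /andP[QP _] /andP[QP' _] /eqP; rewrite eqn_pmul2l ?fact_gt0 // => /eqP.
    exact: nm_inj QP QP'.
  - move=> Q DQ; rewrite muln_gt0 fact_gt0 /= (nm_gt0 (proj1 (andP DQ))) /=.
    exact/le_up_nat/WX.
  - by move=> q; case: ifP.
have hm (Q : {set 'I_(z N)}) : Q \subset P N -> lg (nm Q) <= 2 * LN N ->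
   0 <= err N (w`! * nm Q)%N <= 3 * N%:R * (1 + l) * 2 ^+ #|Q| / (nm Q)%:R.
  by move=> QP lQ; rewrite err0 triv.
have := rsum_amgm (9 * k) (subxx (P N)) t0' hm hSB.
set S := wsum _ _ _ _ => hr.
have hS : S <= CK w K2 * (1 + l) ^+ K2 by apply: wsum_K_le.
have hsum : 2^-1 * (t * SB + 3 * N%:R * (1 + l) / t * S) <=
   2^-1 * (t * SB + 3 * N%:R * (1 + l) / t * (CK w K2 * (1 + l) ^+ K2)).
  rewrite ler_wpM2l ?invr_ge0 // lerD2l ler_wpM2l // divr_ge0 ?(ltW t0') //.
  by rewrite mulr_ge0 ?mulr_ge0 // ltW.
have r0 : 0 <= \sum_(Q : {set 'I_(z N)} | Q \subset P N)
     (9 * k)%:R ^+ #|Q| * err N (w`! * nm Q)%N * pw 0 (2 * LN N - lg (nm Q)).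
  by apply: sumr_ge0 => Q _; rewrite mulr_ge0 ?(proj1 (pw_nneg_nondec 0)) // mulr_ge0 ?exprn_ge0.
apply: (le_trans (ler_pM (sqr_ge0 _) r0 (Lam_sq_le N1) (le_trans hr hsum))).
rewrite -/l -/D.
have -> : D * (1 + l) ^+ (2 * k) * (2^-1 * (t * SB + 3 * N%:R * (1 + l) / t * (CK w K2 * (1 + l) ^+ K2))) =
  2^-1 * D * (((1 + l) ^+ (2 * k) * t / l ^+ A) * K + 3 * CK w K2 * ((1 + l) ^+ (2 * k) * (1 + l) * (1 + l) ^+ K2 / t)) * N%:R.
  by rewrite /SB; ring.
have -> : C * N%:R / l = 2^-1 * D * ((2 ^+ A.-1 * K + 3 * CK w K2) / l) * N%:R.
  by rewrite /C; move: (2 ^+ A.-1) (CK w K2) (D) (l^-1) => *; ring.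
have hD : 0 <= 2^-1 * D by apply: mulr_ge0 => //; rewrite invr_ge0.
apply: ler_wpM2r => //; apply: ler_wpM2l => //.
have e1 : (1 + l) ^+ (2 * k) * t / l ^+ A <= 2 ^+ A.-1 / l.
  have -> : (1 + l) ^+ (2 * k) * t = (1 + l) ^+ A.-1 by rewrite /t -exprD /A addn1.
  have -> : l ^+ A = l ^+ A.-1 * l by rewrite -exprSr /A addn1.
  rewrite invfM mulrA ler_pM2r ?invr_gt0 // ler_pdivrMr ?exprn_gt0 // -exprMn.
  by apply: lerXn2r; rewrite ?nnegrE; lra.
have e2 : (1 + l) ^+ (2 * k) * (1 + l) * (1 + l) ^+ K2 / t <= l^-1.
  have -> : (1 + l) ^+ (2 * k) * (1 + l) * (1 + l) ^+ K2 = (1 + l) ^+ (Bt.-1).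
    by rewrite -exprSr -exprD /Bt addn1 /= addn1.
  have -> : t = (1 + l) ^+ (Bt.-1) * (1 + l) by rewrite /t -exprSr /Bt addn1.
  rewrite invfM mulrA divff ?mul1r; last by rewrite gt_eqF // exprn_gt0.
  by rewrite lef_pV2 ?posrE //; lra.
rewrite [leRHS]mulrDl; apply: lerD.
  by rewrite [leRHS]mulrAC; apply: ler_wpM2r.
by apply: ler_wpM2l => //; apply: mulr_ge0.
Qed.

End Errors.

(** * Evaluation of the weighted sums *)

Lemma vth_ge0 (n : nat) : 0 <= vth n.
Proof. by rewrite /vth; case: ifP => // /prime_gt0 /lg_ge0. Qed.

Lemma vth_le (n M : nat) : (n <= M)%N -> (0 < M)%N -> vth n <= lg M.
Proof.
move=> nM M0; rewrite /vth; case: ifP => [/prime_gt0 n0|_]; last exact: lg_ge0.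
exact: lg_le.
Qed.

Lemma lg_shift_le (N h : nat) : (0 < N)%N -> lg (N + h) <= (1 + h%:R) * (1 + lg N).
Proof.
move=> N0; have l0 := lg_ge0 N0.
have h1 : lg (N + h) <= lg N + lg h.+1.
  by rewrite -lgM // lg_le ?addn_gt0 ?N0 //; nia.
have h2 : lg h.+1 <= h%:R.
  have := ln_le_subr1 (INR_gt0 (ltn0Sn h)); rewrite -/(lg h.+1) INRE -natr1; lra.
have h0 : 0 <= h%:R :> R by [].
by move: (lg (N + h)) (lg h.+1) (lg N) (h%:R : R) l0 h1 h2 h0 => *; nra.
Qed.

Lemma count_le (N b q : nat) : (0 < q)%N ->
  \sum_(1 <= n < N.+1 | n == b %[mod q]) (1 : R) <= N%:R / q%:R + 1.
Proof.
by move=> q0; have := card_class_le N b q0; rewrite ler_norml => /andP[_]; rewrite lerBlDr addrC.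
Qed.

Lemma nm_le (z w N : nat) (Q : {set 'I_z}) : Q \subset prset z w -> (0 < N)%N ->
  lg (nm Q) <= lg N -> (nm Q <= N)%N.
Proof.
move=> QP N0 lQ; rewrite leqNgt; apply/negP => /(lg_lt N0).
by rewrite ltNge lQ.
Qed.

Lemma class_count_triv (z w N M b : nat) (Q : {set 'I_z}) : Q \subset prset z w -> (0 < N)%N ->
  lg (nm Q) <= lg N -> (M <= N)%N ->
  \sum_(1 <= n < M.+1 | n == b %[mod w`! * nm Q]) (1 : R) <= 2 * N%:R / (nm Q)%:R.
Proof.
move=> QP N0 lQ MN; have n0 := nm_gt0 QP; have nN := nm_le QP N0 lQ.
have n0' : (0 < (nm Q)%:R :> R) by rewrite ltr0n.
have q0 : (0 < w`! * nm Q)%N by rewrite muln_gt0 fact_gt0.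
apply: (le_trans (count_le M b q0)).
have h1 : M%:R / (w`! * nm Q)%:R <= N%:R / (nm Q)%:R :> R.
  apply: ler_pM; rewrite ?invr_ge0 ?ler_nat //.
  by rewrite lef_pV2 ?posrE ?ltr0n // ler_nat leq_pmull // fact_gt0.
have h2 : 1 <= N%:R / (nm Q)%:R :> R by rewrite ler_pdivlMr // mul1r ler_nat.
by rewrite -mulrA; move: (M%:R / _) (N%:R / _) h1 h2 => x y; lra.
Qed.

Lemma errB_triv (z w N : nat) (Q : {set 'I_z}) : Q \subset prset z w -> (0 < N)%N ->
  lg (nm Q) <= lg N -> errB N (w`! * nm Q)%N <= 3 * N%:R * (1 + lg N) * 2 ^+ #|Q| / (nm Q)%:R.
Proof.
move=> QP N0 lQ; have l0 := lg_ge0 N0; have n0 := nm_gt0 QP.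
have q0 : (0 < w`! * nm Q)%N by rewrite muln_gt0 fact_gt0.
have p2 : 1 <= 2 ^+ #|Q| :> R by rewrite exprn_ege1 // ler1n.
have NQ : 0 <= N%:R / (nm Q)%:R :> R by rewrite divr_ge0.
have -> : 3 * N%:R * (1 + lg N) * 2 ^+ #|Q| / (nm Q)%:R = 3 * (1 + lg N) * 2 ^+ #|Q| * (N%:R / (nm Q)%:R).
  by move: (2 ^+ _) (_^-1) => *; ring.
have fac : 2 <= 3 * (1 + lg N) * 2 ^+ #|Q| by move: (2 ^+ _ : R) (lg N) p2 l0 => *; nra.
apply: errB_le => //.
  by apply: mulr_ge0 => //; apply: le_trans fac.
move=> y b yN; apply: (le_trans (@ler_norm_sum_count _ _ _ _ _ 1 _)).
  by move=> n _; rewrite liouville_norm.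
rewrite mul1r; apply: (le_trans (class_count_triv b QP N0 lQ yN)).
by rewrite -mulrA; apply: ler_wpM2r.
Qed.

Lemma inv_totient_le (z w : nat) (Q : {set 'I_z}) : Q \subset prset z w -> (0 < w)%N ->
  (totient (w`! * nm Q))%:R^-1 <= 2 ^+ #|Q| / (nm Q)%:R :> R.
Proof.
move=> QP w0; have n0 := nm_gt0 QP.
have n0' : (0 < (nm Q)%:R :> R) by rewrite ltr0n.
rewrite totient_coprime; last by rewrite coprime_sym coprime_nm_fact.
have t0 : (0 < totient (nm Q))%N by rewrite totient_gt0.
have tW : (0 < totient w`!)%N by rewrite totient_gt0 fact_gt0.
apply: (@le_trans _ _ ((totient (nm Q))%:R^-1)).
  by rewrite lef_pV2 ?posrE ?ltr0n ?muln_gt0 ?tW // ler_nat leq_pmull.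
rewrite (totient_nm QP) -prodfV -prod_div_nm -prodr_const -big_split /=.
apply: ler_prod => p pQ; have := subsetP QP p pQ; rewrite inE => /andP[pp wp].
have p2 : (2 <= p%:R :> R) by rewrite ler_nat prime_gt1.
rewrite invr_ge0; apply/andP; split; first by lra.
rewrite ler_pdivlMr; last by lra.
by rewrite ler_pdivrMl; lra.
Qed.

Lemma errA_triv (z w N : nat) (Q : {set 'I_z}) : (0 < w)%N -> Q \subset prset z w -> (0 < N)%N ->
  lg (nm Q) <= lg N -> errA N (w`! * nm Q)%N <= 3 * N%:R * (1 + lg N) * 2 ^+ #|Q| / (nm Q)%:R.
Proof.
move=> w0 QP N0 lQ; have l0 := lg_ge0 N0; have n0 := nm_gt0 QP.
have q0 : (0 < w`! * nm Q)%N by rewrite muln_gt0 fact_gt0.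
have p2 : 1 <= 2 ^+ #|Q| :> R by rewrite exprn_ege1 // ler1n.
have NQ : 0 <= N%:R / (nm Q)%:R :> R by rewrite divr_ge0.
have -> : 3 * N%:R * (1 + lg N) * 2 ^+ #|Q| / (nm Q)%:R = 3 * (1 + lg N) * 2 ^+ #|Q| * (N%:R / (nm Q)%:R).
  by move: (2 ^+ _) (_^-1) => *; ring.
apply: errA_le => //.
  by apply: mulr_ge0 => //; move: (2 ^+ _ : R) (lg N) p2 l0 => *; nra.
move=> b; apply: (le_trans (ler_normB _ _)).
have h1 : `|\sum_(1 <= n < N.+1 | n == b %[mod w`! * nm Q]) vth n| <= lg N * (2 * (N%:R / (nm Q)%:R)).
  apply: (le_trans (@ler_norm_sum_count _ _ _ _ _ (lg N) _)).
    by move=> n /andP[_ nN]; rewrite ger0_norm ?vth_ge0 // vth_le.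
  by apply: ler_wpM2l => //; rewrite mulrA; apply: (class_count_triv b QP N0 lQ (leqnn N)).
have h2 : `|N%:R / (totient (w`! * nm Q))%:R| <= 2 ^+ #|Q| * (N%:R / (nm Q)%:R) :> R.
  rewrite ger0_norm ?divr_ge0 // mulrCA; apply: ler_wpM2l => //.
  exact: inv_totient_le.
apply: (le_trans (lerD h1 h2)); rewrite (mulrA (lg N) 2) -mulrDl; apply: ler_wpM2r => //.
by move: (2 ^+ _ : R) (lg N) p2 l0 => *; nra.
Qed.

Lemma double_le_of_square_le (k w : nat) : (1 < k)%N -> (4 * k * k <= w)%N -> (2 * k <= w)%N.
Proof. by nia. Qed.

Lemma gt0_of_square_le (k w : nat) : (1 < k)%N -> (4 * k * k <= w)%N -> (0 < w)%N.
Proof. by nia. Qed.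

Section Package.
Variables (hs : seq nat) (w v0 : nat) (a : nat -> R) (dl tau theta : R).
Let k := size hs.
Hypothesis uhs : uniq hs.
Hypothesis hw : {in hs, forall x, x < w}%N.
Hypothesis k0 : (1 < k)%N.
Hypothesis kw : (4 * k * k <= w)%N.
Hypothesis a0 : forall i, 0 <= a i.
Hypothesis dl0 : 0 < dl.
Hypothesis t0 : 0 < tau.
Hypothesis t1 : tau < 1.
Hypothesis tth : tau < theta.
Hypothesis lA : level errA theta.
Hypothesis lB : level errB theta.

Let L N := LN tau N.
Let z N := zN (L N).

Definition wt (N n : nat) : R := sieve_weight hs w (z N) a dl (L N) n.

Lemma L_gt0 (N : nat) : (1 < N)%N -> 0 < L N.
Proof.
by move=> N1; rewrite /L /LN mulr_gt0 ?divr_gt0 // -lg1 lg_lt.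
Qed.

Lemma L2_le (N : nat) (x : R) : (0 < N)%N -> x <= 2 * L N -> x <= lg N.
Proof. by move=> N0 h; have [_ /andP[_ h2] _] := LN_facts t0 t1 N0; apply: le_trans h h2. Qed.

Lemma sum_lambda_negl (hm : nat) :
  negl (fun N => `|\sum_((z N).+1 <= n < N.+1 | n == v0 %[mod w`!]) liouville (n + hm) * wt N n|).
Proof.
have n1 : negl (level_error k w a tau errB).
  apply: (negl_level_error k0 kw a0 t0 t1 tth lB) => [N q|N Q N0 QP lQ]; first exact: maxR_ge0.
  by apply: errB_triv => //; apply: L2_le.
apply: (negl_le _ (negl_add n1 (negl_shift_error k0 kw a0 t0 t1 hm))).
exists 2%N => N N2; have N0 : (0 < N)%N by apply: leq_trans N2.
have l0 := lg_ge0 N0.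
case: (leqP (z N) N) => zn; last first.
  rewrite big_geq ?normr0; last by rewrite ltnS ltnW.
  apply: addr_ge0; apply: mulr_ge0; rewrite ?sqr_ge0 //; apply: sumr_ge0 => Q _; rewrite mulr_ge0 ?(proj1 (pw_nneg_nondec 0)) //.
    by rewrite mulr_ge0 ?exprn_ge0 // maxR_ge0.
  apply: mulr_ge0; first exact: exprn_ge0.
  apply: mulr_ge0; first by apply: mulr_ge0; apply: addr_ge0.
  by rewrite !addr_ge0 // divr_ge0.
pose E (Q : {set 'I_(z N)}) := errB N (w`! * nm Q)%N +
  (1 + hm%:R) * (1 + lg N) * ((z N + hm)%:R / (w`! * nm Q)%:R + 1 + hm%:R).
have := @sum_weight_twisted hs w v0 (z N) a dl (L N) uhs hw k0 (double_le_of_square_le k0 kw) a0 dl0 (L_gt0 N2)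
  (fun n => liouville (n + hm)) (z N).+1 N.+1 E.
have hE (Q : {set 'I_(z N)}) : Q \subset prset (z N) w -> lg (nm Q) <= 2 * L N -> forall b,
   `|\sum_((z N).+1 <= n < N.+1 | n == b %[mod w`! * nm Q]) liouville (n + hm)| <= E Q.
  move=> QP lQ b; have q0 : (0 < w`! * nm Q)%N by rewrite muln_gt0 fact_gt0 (nm_gt0 QP).
  have B1 : 1 <= (1 + hm%:R) * (1 + lg N) by have : 0 <= hm%:R :> R by []; move: (hm%:R : R) (lg N) l0 => *; nra.
  have := ap_shift b q0 zn (Bd := (1 + hm%:R) * (1 + lg N)) (F := liouville) (h := hm).
  move=> /(_ _ _) sh.
  have {}sh : `|\sum_((z N).+1 <= n < N.+1 | n == b %[mod w`! * nm Q]) liouville (n + hm) -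
    \sum_(1 <= n < N.+1 | n == b + hm %[mod w`! * nm Q]) liouville n| <=
    (1 + hm%:R) * (1 + lg N) * ((z N + hm)%:R / (w`! * nm Q)%:R + 1 + hm%:R).
    by apply: sh => [n _|]; [rewrite liouville_norm | apply: le_trans B1].
  have eb := errB_ge N (b + hm) q0.
  rewrite -[X in `|X|](subrK (\sum_(1 <= n < N.+1 | n == b + hm %[mod w`! * nm Q]) liouville n)).
  by apply: (le_trans (ler_normD _ _)); rewrite /E addrC; apply: lerD.
move=> /(_ hE) hh; apply: (le_trans hh).
rewrite /level_error /shift_error -/(L N) -/(z N) -mulrDr -big_split /=.
rewrite le_eqVlt; apply/orP; left; apply/eqP; congr (_ * _); apply: eq_bigr => Q _.
by rewrite /E -/k mulrDr mulrDl.
Qed.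

(** Summation starts above [z N], so that n + hi exceeds all sieving primes and [weight_for_rem]
    applies at primes. *)
Lemma sum_prime_ge (hi : nat) : hi \in hs -> coprime (v0 + hi) w`! ->
  exists2 e : nat -> R, negl e & exists N0, forall N, (N0 <= N)%N ->
  N%:R / (totient w`!)%:R *
    wsum (prset (z N) w) (fun p => (k.-1)%:R / p%:R)
      (fun s => wsum (prset (z N) w) (fun p => p%:R^-1) (Yf a dl (L N)) s ^+ 2) (L N) - e N <=
  \sum_((z N).+1 <= n < N.+1 | n == v0 %[mod w`!]) vth (n + hi) * wt N n.
Proof.
move=> hih cov; exists (fun N => level_error k w a tau errA N + shift_error k w a tau hi N).
  apply: negl_add; last exact: negl_shift_error.
  apply: (negl_level_error k0 kw a0 t0 t1 tth lA) => [N q|N Q N0 QP lQ]; first exact: maxR_ge0.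
  by apply: errA_triv => //; [exact: gt0_of_square_le k0 kw | apply: L2_le].
have [N1 hN1] : exists N0, forall N, (N0 <= N)%N -> (z N <= N)%N.
  have ht : tau / 2 < 1 by rewrite ltr_pdivrMr ?ltr0n // mul1r (lt_trans t1) // ltr1n.
  have [N0 h] := negl_polyex 0 (ler0n _ 2) ht ltr01; exists (maxn N0 1) => N; rewrite geq_max => /andP[/h hN N0'].
  rewrite -(ler_nat R); have [_ _ zz] := zN_facts (L N); apply: (le_trans zz).
  move: hN; rewrite expr0 mulr1 mul1r => hN; apply: le_trans hN.
  have : 1 <= ex (L N).
    by apply: le_trans (ex_ge1D _); have [/andP[h1 _] _ _] := LN_facts t0 t1 N0'; rewrite /L; lra.
  rewrite /L /LN; move: (ex _) => x; lra.
exists (maxn N1 2) => N; rewrite geq_max => /andP[/hN1 zn N2].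
have N0 : (0 < N)%N by apply: leq_trans N2.
have l0 := lg_ge0 N0.
pose E (Q : {set 'I_(z N)}) := errA N (w`! * nm Q)%N +
  (1 + hi%:R) * (1 + lg N) * ((z N + hi)%:R / (w`! * nm Q)%:R + 1 + hi%:R).
have := @sum_weight_prime hs w v0 (z N) N a dl (L N) uhs hw k0 (double_le_of_square_le k0 kw) a0 dl0 (L_gt0 N2)
  hi (fun n => vth (n + hi)) (z N).+1 N.+1 E hih cov.
have hE (Q : {set 'I_(z N)}) : Q \subset prset (z N) w -> lg (nm Q) <= 2 * L N -> forall b,
   coprime (b + hi) (w`! * nm Q) ->
   `|\sum_((z N).+1 <= n < N.+1 | n == b %[mod w`! * nm Q]) vth (n + hi) - N%:R / (totient (w`! * nm Q))%:R| <= E Q.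
  move=> QP lQ b cb; have q0 : (0 < w`! * nm Q)%N by rewrite muln_gt0 fact_gt0 (nm_gt0 QP).
  have := ap_shift b q0 zn (Bd := (1 + hi%:R) * (1 + lg N)) (F := vth) (h := hi).
  move=> /(_ _ _) sh.
  have {}sh : `|\sum_((z N).+1 <= n < N.+1 | n == b %[mod w`! * nm Q]) vth (n + hi) -
    \sum_(1 <= n < N.+1 | n == b + hi %[mod w`! * nm Q]) vth n| <=
    (1 + hi%:R) * (1 + lg N) * ((z N + hi)%:R / (w`! * nm Q)%:R + 1 + hi%:R).
    apply: sh => [n /andP[_ nN]|]; last by rewrite mulr_ge0 ?addr_ge0.
    rewrite ger0_norm ?vth_ge0 //; apply: le_trans (lg_shift_le hi N0).
    by apply: vth_le => //; rewrite addn_gt0 N0.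
  have eb := errA_ge N q0 cb.
  rewrite -(subrKA (\sum_(1 <= n < N.+1 | n == b + hi %[mod w`! * nm Q]) vth n)).
  by apply: (le_trans (ler_normD _ _)); rewrite /E addrC; apply: lerD.
move=> /(_ hE) hh.
have -> : \sum_((z N).+1 <= n < N.+1 | n == v0 %[mod w`!]) vth (n + hi) * wt N n =
  \sum_((z N).+1 <= n < N.+1 | n == v0 %[mod w`!]) vth (n + hi) * weight_for hs w (z N) a dl (L N) (rem hi hs) n.
  rewrite big_nat_cond [RHS]big_nat_cond; apply: eq_bigr => n /andP[/andP[zn' _] _].
  rewrite /vth; case: ifP => pn; last by rewrite !mul0r.
  congr (_ * _); apply: weight_for_rem => //.
  - exact: double_le_of_square_le k0 kw.
  - exact: L_gt0.
  - by rewrite (leq_trans (ltnW zn')) // leq_addr.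
apply: le_trans hh; rewrite -/k lerD2l lerN2.
rewrite /level_error /shift_error -/(L N) -/(z N) -mulrDr -big_split /=.
rewrite le_eqVlt; apply/orP; left; apply/eqP; congr (_ * _); apply: eq_bigr => Q _.
by rewrite /E -/k mulrDr mulrDl.
Qed.

End Package.

Lemma lg_ge_of_ex (n : nat) (x : R) : (0 < n)%N -> lg n <= x -> n%:R <= ex x.
Proof. by move=> n0 h; rewrite -(ex_lg n0) ex_le. Qed.

Lemma lg_le_add (T : nat) (x : R) : 0 <= x -> (0 < T)%N -> T%:R <= ex x + 1 -> lg T <= x + 1.
Proof.
move=> x0 T0 h; have e1 : 1 <= ex x by apply: le_trans (ex_ge1D x); lra.
have e2 : 2 <= ex 1 by apply: le_trans (ex_ge1D 1); lra.
have : T%:R <= ex (x + 1) by rewrite exD; move: (ex x) (ex 1) e1 e2 h => *; nra.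
rewrite -(ex_lg T0) => h'; rewrite leNgt; apply/negP => /RltP /exp_increasing /RltP.
by rewrite -/(ex (lg T)) -/(ex (x + 1)) ltNge h'.
Qed.

Section Asymptotics.
Variables (hs : seq nat) (w v0 : nat) (a : nat -> R) (dl tau theta : R).
Let k := size hs.
Hypothesis uhs : uniq hs.
Hypothesis hw : {in hs, forall x, x < w}%N.
Hypothesis k0 : (1 < k)%N.
Hypothesis kw : (4 * k * k <= w)%N.
Hypothesis a0 : forall i, 0 <= a i.
Hypothesis dl0 : 0 < dl.
Hypothesis dl1 : 2 * dl <= 1.
Hypothesis t0 : 0 < tau.
Hypothesis t1 : tau < 1.
Hypothesis tth : tau < theta.
Hypothesis lA : level errA theta.
Hypothesis lB : level errB theta.

Let L N := LN tau N.
Let z N := zN (L N).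
Let wgt N n := wt hs w a dl tau N n.

(** The common order of magnitude: N/W integers in the class, times ([dens w] L)^k from a sum of
    dimension k. *)
Definition mainterm (N : nat) : R := N%:R / w`!%:R * (dens w ^+ k * L N ^+ k).

Lemma L_large (x : R) : exists N0, forall N, (N0 <= N)%N -> [/\ (1 < N)%N, 1 <= lg N & x <= L N].
Proof.
have [N1 h1] := lg_large (x / (tau / 2)); have [N2 h2] := lg_large 1.
exists (maxn 2 (maxn N1 N2)) => N; rewrite !geq_max => /and3P[N0 /h1 hx /h2 hl]; split => //.
rewrite /L /LN mulrC -ler_pdivrMr // divr_gt0 //.
Qed.

Lemma mainterm_ge : exists2 c : R, 0 < c &
  exists N0, forall N, (N0 <= N)%N -> c * N%:R <= mainterm N.
Proof.
have d0 := dens_gt0 w.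
exists (w`!%:R^-1 * dens w ^+ k); first by rewrite mulr_gt0 ?invr_gt0 ?ltr0n ?fact_gt0 ?exprn_gt0.
have [N0 h] := L_large 1; exists N0 => N /h[_ _ L1].
rewrite /mainterm mulrC mulrA [leRHS]mulrA ler_peMr ?exprn_ege1 //.
by rewrite !mulr_ge0 ?invr_ge0 ?exprn_ge0 // ltW.
Qed.

Lemma negl_mainterm (e : nat -> R) (eps : R) : negl e -> 0 < eps ->
  exists N0, forall N, (N0 <= N)%N -> e N <= eps * mainterm N.
Proof.
move=> ne e0; have [c c0 hc] := mainterm_ge.
have [N0 h] := eventually_and hc (ne _ (mulr_gt0 e0 c0)).
exists N0 => N /h[h1 h2]; apply: (le_trans h2); rewrite -mulrA.
by apply: ler_wpM2l => //; apply: ltW.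
Qed.

Lemma sum_all_le (et : R) : 0 < et -> exists N0, forall N, (N0 <= N)%N ->
  (1 - (2 * k * k)%:R / w%:R) * \sum_(1 <= n < N.+1 | n == v0 %[mod w`!]) wgt N n <=
  mainterm N * ((1 + et) ^+ (k + 4) * A0 k a) + count_error k w a tau N.
Proof.
move=> et0; have w0 := gt0_of_square_le k0 kw; have k2w := double_le_of_square_le k0 kw.
have [N0 h] := L_large (k%:R * C1 w / et); exists N0 => N /h[N2 l1 L1].
have L0 := L_gt0 t0 N2; rewrite -/(L N) in L0.
have eL : k%:R * C1 w <= et * L N by rewrite -ler_pdivrMl // mulrC.
have S0 := sum_weight_le v0 (z N) N uhs hw k0 k2w a0 dl0 L0.
have F0 := form0_le (subxx (prset (z N) w)) w0 k2w a0 dl0 L0 (ltW et0) eL.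
have c0 := half_le w0 kw.
have c1 : 1 - (2 * k * k)%:R / w%:R <= 1 :> R by rewrite lerBlDr lerDl divr_ge0.
have En := count_error_ge0 k w a tau N.
have NW : 0 <= N%:R / w`!%:R :> R by rewrite divr_ge0.
move: S0; rewrite -[X in _ + X]/(count_error k w a tau N) => S0.
rewrite /mainterm; move: F0 S0; rewrite -/k.
set F := wsum _ _ _ _; move=> F0 S0.
have c0' : 0 <= 1 - (2 * k * k)%:R / w%:R :> R by apply: le_trans c0; rewrite invr_ge0.
apply: (le_trans (ler_wpM2l c0' S0)); rewrite mulrDr; apply: lerD; last by rewrite ler_piMl.
rewrite mulrCA -[leRHS]mulrA; apply: ler_wpM2l => //.
by apply: (le_trans F0); rewrite mulrA.
Qed.

Lemma sum_prime_mainterm (hi : nat) : hi \in hs -> coprime (v0 + hi) w`! ->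
  exists2 e : nat -> R, negl e & exists N0, forall N, (N0 <= N)%N ->
  mainterm N * L N * ((1 - k%:R / w%:R) ^+ k.+1 * (1 - 2 * dl) ^+ (k + 5) * B0 k a) - e N <=
  \sum_((z N).+1 <= n < N.+1 | n == v0 %[mod w`!]) vth (n + hi) * wgt N n.
Proof.
move=> hih cov; have w0 := gt0_of_square_le k0 kw.
have [e ne he] := sum_prime_ge uhs hw k0 kw a0 dl0 t0 t1 tth lA hih cov.
exists e => //; have [N0 h] := eventually_and he (L_large (k%:R * lg w`! / dl)).
exists N0 => N /h[h1 [N2 l1 L1]]; apply: le_trans h1; rewrite lerD2r.
have L0 := L_gt0 t0 N2; rewrite -/(L N) in L0.
have [z0 zL _] := zN_facts (L N).
have kE : k = k.-1.+1 by rewrite prednK // ltnW.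
have w1 : (1 < w)%N by apply: leq_trans (double_le_of_square_le k0 kw); rewrite -[X in (X <= _)%N]muln1 leq_mul // ltnW.
have kw1 : (k.-1.+1 <= w)%N by rewrite -kE; apply: leq_trans (double_le_of_square_le k0 kw); rewrite leq_pmull.
have dL : k.-1.+1%:R * lg w`! <= dl * L N by rewrite -kE -ler_pdivrMl // mulrC.
have := form1_ge w1 kw1 z0 zL a0 dl0 dl1 L0 dL; rewrite -kE.
have -> : (k.-1 + 6 = k + 5)%N by rewrite [in RHS]kE addSnnS.
rewrite -/k -/(L N) -/(z N) => F.
have tW : 0 <= N%:R / (totient w`!)%:R :> R by rewrite divr_ge0.
apply: le_trans (ler_wpM2l tW F).
(* One of the k + 1 factors [dens w] turns N / totient(w!) into N / w!. *)
rewrite le_eqVlt; apply/orP; left; apply/eqP; rewrite /mainterm !exprSr {3}/dens.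
have W0 : w`!%:R != 0 :> R by rewrite pnatr_eq0 -lt0n fact_gt0.
have T0 : (totient w`!)%:R != 0 :> R by rewrite pnatr_eq0 -lt0n totient_gt0 fact_gt0.
move: (L N) (dens w ^+ k) (L N ^+ k) (1 - k%:R / w%:R) ((1 - k%:R / w%:R) ^+ k) (B0 k a) (_ ^+ (k + 5)) (w`!%:R : R) ((totient w`!)%:R : R) W0 T0.
by move=> x1 x2 x3 x4 x5 x6 x7 W T W0 T0; field; rewrite W0 T0.
Qed.

Definition small_primes (c : R) (N : nat) : {set 'I_(z N)} :=
  [set p in prset (z N) w | lg p <= c * lg N].

(** One factor log p is bounded by c log N and the other is summed by [mertens_upper], so the bound
    is quadratic in c. The assumption 2 <= c log N absorbs the additive constants. *)
Lemma small_primes_sum (c : R) (N : nat) (C : R) : (1 < N)%N -> 0 < c -> 2 <= c * lg N -> 0 <= C ->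
  (forall n : nat, \sum_(1 <= p < n.+1) vth p <= C * n%:R) ->
  \sum_(p in small_primes c N) lg p ^+ 2 / p%:R <= 2 * C * (c * lg N) ^+ 2.
Proof.
move=> N1 c0 cl C0 hC; have cl0 : 0 <= c * lg N by lra.
set T := zN (c * lg N); have [T0 _ T1] := zN_facts (c * lg N); rewrite -/T in T0 T1.
have lT : lg T <= c * lg N + 1 by apply: lg_le_add.
have hm := mertens_upper C0 hC T0.
have h1 : \sum_(p in small_primes c N) vth p / p%:R <= \sum_(1 <= p < T.+1) vth p / p%:R.
  apply: (@sum_inj_le _ (mem (small_primes c N)) (fun p => nat_of_ord p) (fun p => vth p / p%:R) T).
  - by move=> p q _ _; apply: ord_inj.
  - move=> p; rewrite !inE => /andP[/andP[pp _] lp]; rewrite prime_gt0 //=.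
    by apply: le_up_nat; apply: lg_ge_of_ex => //; apply: prime_gt0.
  - by move=> q; rewrite divr_ge0 // vth_ge0.
apply: (@le_trans _ _ (c * lg N * \sum_(p in small_primes c N) vth p / p%:R)).
  rewrite mulr_sumr; apply: ler_sum => p; rewrite !inE => /andP[/andP[pp _] lp].
  rewrite /vth pp expr2 mulrA ler_wpM2r ?invr_ge0 // ler_wpM2r //.
  by apply: lg_ge0; apply: prime_gt0.
apply: (@le_trans _ _ (c * lg N * (C * (1 + lg T)))).
  by apply: ler_wpM2l => //; apply: le_trans hm.
have : C * (1 + lg T) <= C * (2 * (c * lg N)) by apply: ler_wpM2l => //; lra.
move: (lg T) (c * lg N) cl0 => x y y0 /(ler_wpM2l y0) h; apply: (le_trans h).
by rewrite le_eqVlt; apply/orP; left; apply/eqP; ring.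
Qed.

Lemma card_small_primes (c : R) (N : nat) : (0 < N)%N -> 0 <= c ->
  #|small_primes c N|%:R <= 2 * ex (c * lg N).
Proof.
move=> N0 c0; have cl0 : 0 <= c * lg N by rewrite mulr_ge0 // lg_ge0.
set T := zN (c * lg N); have [T0 _ T1] := zN_facts (c * lg N); rewrite -/T in T0 T1.
have e1 : 1 <= ex (c * lg N) by apply: le_trans (ex_ge1D _); lra.
apply: (@le_trans _ _ T%:R); last by lra.
rewrite -sum1_card natr_sum.
have := @sum_inj_le _ (mem (small_primes c N)) (fun p => nat_of_ord p) (fun=> 1) T.
rewrite sumr_const_nat subn1 /=; apply => //.
- by move=> p q _ _; apply: ord_inj.
- move=> p; rewrite !inE => /andP[/andP[pp _] lp]; rewrite prime_gt0 //=.
  by apply: le_up_nat; apply: lg_ge_of_ex => //; apply: prime_gt0.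
Qed.

(** K does not depend on c. The 1/L^2 from the Lipschitz bound meets (c log N)^2, which leaves c^2.
    In 18 = 9 * 2 the 9 is the square of the factor 3 for merged weights, and the 2 comes from
    [card_small_primes]. *)
Lemma sum_small_primes_le (hm : nat) : hm \in hs ->
  exists2 K : R, 0 <= K & forall c : R, 0 < c -> exists N0, forall N, (N0 <= N)%N ->
  \sum_(p in small_primes c N) \sum_(1 <= n < N.+1 | (n == v0 %[mod w`!]) && (p %| n + hm)%N) wgt N n <=
  K * c ^+ 2 * mainterm N + 18 * (ex (c * lg N) * count_error k w a tau N).
Proof.
move=> hmh; have th0 : 0 < theta by apply: lt_trans tth.
have [C [C0 hC]] := chebyshev_of_level th0 lA.
have w0 := gt0_of_square_le k0 kw; have k2w := double_le_of_square_le k0 kw.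
have d0 := dens_gt0 w; have C10 := C1_ge0 w.
exists (2 ^+ k.+1 * (Lip a dl ^+ 2 * (2 * C) / (tau / 2) ^+ 2)).
  by rewrite mulr_ge0 ?exprn_ge0 // divr_ge0 ?sqr_ge0 // mulr_ge0 ?sqr_ge0 // mulr_ge0.
move=> c c0; have [N1 h1] := lg_large (2 / c); have [N2 h2] := L_large (k%:R * C1 w).
exists (maxn N1 N2) => N; rewrite geq_max => /andP[/h1 cl /h2[N1' l1 L1]].
have L0 := L_gt0 t0 N1'; rewrite -/(L N) in L0.
have {}cl : 2 <= c * lg N by rewrite mulrC -ler_pdivrMr.
have kC : 0 <= k%:R * C1 w by rewrite mulr_ge0.
set H := wsum (prset (z N) w) (fun p => k%:R / (p%:R - k%:R)) (pw 0) (L N).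
have hH : H <= 2 ^+ k.+1 * (dens w ^+ k * L N ^+ k).
  apply: (le_trans (hsum_le2 _ _ k0 kw)).
  rewrite exprS -mulrA; apply: ler_wpM2l => //.
  apply: (le_trans (dsum_pw_le k 0 (subxx _) (ltW L0))); rewrite add0n fact0.
  have -> : 2 ^+ k * (dens w ^+ k * L N ^+ k) = dens w ^+ k * (1 * (2 * L N) ^+ k) by rewrite mul1r (exprMn k 2 (L N)) mulrCA.
  rewrite -mulrA; apply: ler_wpM2l; first by rewrite exprn_ge0 // ltW.
  apply: ler_pM; rewrite ?div1r ?invr_ge0 ?exprn_ge0 //.
  - by rewrite addr_ge0 // ltW.
  - by rewrite invf_le1 ?ler1n ?ltr0n fact_gt0.
  - by apply: lerXn2r; rewrite ?nnegrE; move: (L N) (k%:R * C1 w) L0 L1 kC => *; lra.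
have H0 : 0 <= H.
  apply: (proj1 (wsum_nneg_nondec _ (pw_nneg_nondec 0))) => p.
  by rewrite inE => /andP[_ wp]; rewrite divr_ge0 // subr_ge0 ler_nat (leq_trans _ (ltnW wp)) // (leq_trans _ k2w) // leq_pmull.
have En := count_error_ge0 k w a tau N.
apply: (@le_trans _ _ (\sum_(p in small_primes c N)
   (N%:R / w`!%:R * (Lip a dl / L N) ^+ 2 * H * (lg p ^+ 2 / p%:R) + 9 * count_error k w a tau N))).
  apply: ler_sum => p; rewrite inE => /andP[pP _].
  have := sum_weight_p0_le v0 N uhs hw k0 k2w a0 dl0 L0 pP hmh; rewrite -/k -/H => hp.
  apply: (le_trans hp); rewrite le_eqVlt; apply/orP; left; apply/eqP.
  congr (_ + _); last by rewrite /count_error -/(L N) -/(z N) exprMn -mulrA; congr (_ * _); rewrite expr2 -natrM.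
  rewrite natrM invfM; move: (w`!%:R^-1 : R) ((p%:R : R)^-1) (L N)^-1 => x y u; ring.
rewrite big_split /= -mulr_sumr sumr_const -(mulr_natr _ #|small_primes c N|); apply: lerD; last first.
  have := card_small_primes (ltnW N1') (ltW c0); move: (#|_|%:R : R) (ex _) => x y.
  move: (count_error _ _ _ _ _) En => E E00 xy; nra.
have hs2 := small_primes_sum N1' c0 cl C0 hC.
have NW : 0 <= N%:R / w`!%:R :> R by rewrite divr_ge0.
have q0 : 0 <= N%:R / w`!%:R * (Lip a dl / L N) ^+ 2 by rewrite mulr_ge0 ?sqr_ge0.
apply: (@le_trans _ _ (N%:R / w`!%:R * (Lip a dl / L N) ^+ 2 * (2 ^+ k.+1 * (dens w ^+ k * L N ^+ k)) * (2 * C * (c * lg N) ^+ 2))).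
  apply: ler_pM => //; last by apply: ler_wpM2l.
    exact: mulr_ge0.
  by apply: sumr_ge0 => p _; rewrite divr_ge0 ?sqr_ge0.
rewrite le_eqVlt; apply/orP; left; apply/eqP; rewrite /mainterm.
have -> : Lip a dl / L N = Lip a dl / (tau / 2) / lg N by rewrite /L /LN invfM mulrA.
have l0 : lg N != 0 by apply: lt0r_neq0; apply: lt_le_trans l1.
move: (dens w ^+ k) (L N ^+ k) (Lip a dl) (lg N) l0 (w`!%:R^-1 : R) (N%:R : R) (2 ^+ k.+1 : R) tau (lt0r_neq0 t0) => x1 x2 Lp l l0 x3 x4 x5 t tn0.
by field; rewrite l0 tn0.
Qed.

End Asymptotics.

(** * Combining the estimates *)

Lemma sum_tail_le (m N : nat) (P : pred nat) (F : nat -> R) : (forall n, 0 <= F n) ->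
  \sum_(m.+1 <= n < N.+1 | P n) F n <= \sum_(1 <= n < N.+1 | P n) F n.
Proof.
move=> F0; case: (leqP m N) => mN; last by rewrite big_geq ?sumr_ge0 // ltnS ltnW.
by rewrite [leRHS](@big_cat_nat _ _ _ m.+1) //= lerDr sumr_ge0.
Qed.

Lemma eventually_all (s : seq nat) (P : nat -> nat -> Prop) :
  (forall x, x \in s -> exists N0, forall N, (N0 <= N)%N -> P x N) ->
  exists N0, forall N, (N0 <= N)%N -> forall x, x \in s -> P x N.
Proof.
elim: s => [|x s IH] h; first by exists 0%N.
have [N1 h1] := h x (mem_head _ _).
have [N2 h2] : exists N0, forall N, (N0 <= N)%N -> forall y, y \in s -> P y N.
  by apply: IH => y ys; apply: h; rewrite inE ys orbT.
exists (maxn N1 N2) => N; rewrite geq_max => /andP[/h1 p1 /h2 p2] y.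
by rewrite inE => /orP[/eqP->|/p2].
Qed.

Lemma sum_seq_ge (s : seq nat) (x : R) (F : nat -> R) :
  (forall y, y \in s -> x <= F y) -> (size s)%:R * x <= \sum_(y <- s) F y.
Proof.
elim: s => [|y s IH] h; first by rewrite mul0r big_nil.
rewrite big_cons /= -natr1 mulrDl mul1r addrC; apply: lerD; first by apply: h; rewrite mem_head.
by apply: IH => u us; apply: h; rewrite inE us orbT.
Qed.

Lemma ex_small (x y u : R) : 0 < x -> 0 < y -> 0 < u ->
  exists2 e : R, 0 < e & [/\ e <= x, e <= y & e <= u].
Proof.
move=> x0 y0 u0; exists (Num.min x (Num.min y u)); first by rewrite !lt_min x0 y0 u0.
by rewrite !ge_min !lexx !orbT.
Qed.

(** The final bookkeeping, with q = k - 1, X the main term and l = log N. After division by l X the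
    left side is at least A/2 + 3g/2, while the right side is at most A/2 + g. *)
Lemma scalar_contradiction (q tau B A g K eps s l X S0 Sl S3 : R) :
  0 < g -> 0 < X -> 1 <= l -> 0 <= s -> 0 <= eps -> q * tau * B = A + 4 * g ->
  K <= g / 4 -> eps <= g / 80 -> q * eps <= g / 2 -> s * (A / 2 + g / 2) <= g / 2 ->
  S0 <= X * A + 2 * (eps * X) -> Sl <= eps * X -> S3 <= K * X + 18 * (eps * X) ->
  q * (X * (tau / 2 * l) * B - eps * X) <= (1 + s) * l * (2^-1 * S0 + 2^-1 * Sl + S3) -> False.
Proof.
move=> g0 X0 l1 s0 e0 gE Kg eg qe sA hS0 hSl hS3 fin.
have l0 : 0 < l by lra.
have br : 2^-1 * S0 + 2^-1 * Sl + S3 <= X * (A / 2 + g / 2).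
  have gX := mulr_gt0 g0 X0; have := ler_wpM2r (ltW X0) Kg; have := ler_wpM2r (ltW X0) eg.
  by move: (K * X) (eps * X) hS0 hSl hS3 => u v *; lra.
have sl0 : 0 <= (1 + s) * l by rewrite mulr_ge0 //; lra.
have fin2 := le_trans fin (ler_wpM2l sl0 br).
have lX : 0 < l * X by rewrite mulr_gt0.
have h1 := ler_wpM2l (ltW lX) sA.
have h2 : q * eps * X <= g / 2 * (l * X).
  apply: (@le_trans _ _ (g / 2 * X)); first by apply: ler_wpM2r => //; apply: ltW.
  by apply: ler_wpM2l; [lra | rewrite ler_peMl // ltW].
have h3 : q * (X * (tau / 2 * l) * B - eps * X) = l * X * ((q * tau * B) / 2) - q * eps * X by field.
rewrite h3 gE in fin2.
have gl : 0 < g * (l * X) by rewrite mulr_gt0.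
by move: (q * eps * X) h2 fin2 => u h2 fin2; lra.
Qed.

Section Combination.
Variables (hs : seq nat) (w v0 : nat) (a : nat -> R) (dl tau theta : R).
Let k := size hs.
Let L N := LN tau N.
Let z N := zN (L N).
Let wgt N n := wt hs w a dl tau N n.

Definition prime_bound (hm : nat) (c : R) (N n : nat) : Prop :=
  \sum_(hi <- rem hm hs) (prime (n + hi))%:R <=
  (1 + liouville (n + hm)) / 2 + \sum_(p in small_primes w tau c N) (p %| n + hm)%N%:R :> R.

Lemma sum_prime_bound (hm N : nat) (c Lg : R) :
  (forall n, (z N < n <= N)%N -> n == v0 %[mod w`!] -> prime_bound hm c N n) ->
  0 <= Lg -> {in hs, forall hi, lg (N + hi) <= Lg} ->
  \sum_(hi <- rem hm hs) \sum_((z N).+1 <= n < N.+1 | n == v0 %[mod w`!]) vth (n + hi) * wgt N n <=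
  Lg * (2^-1 * \sum_(1 <= n < N.+1 | n == v0 %[mod w`!]) wgt N n +
        2^-1 * `|\sum_((z N).+1 <= n < N.+1 | n == v0 %[mod w`!]) liouville (n + hm) * wgt N n| +
        \sum_(p in small_primes w tau c N)
          \sum_(1 <= n < N.+1 | (n == v0 %[mod w`!]) && (p %| n + hm)%N) wgt N n).
Proof.
move=> hpt Lg0 hLg; have wg0 n : 0 <= wgt N n by apply: sieve_weight_ge0.
rewrite exchange_big /=.
apply: (@le_trans _ _ (\sum_((z N).+1 <= n < N.+1 | n == v0 %[mod w`!])
  Lg * (2^-1 * wgt N n + 2^-1 * (liouville (n + hm) * wgt N n) +
   \sum_(p in small_primes w tau c N) (if (p %| n + hm)%N then wgt N n else 0)))).
  rewrite big_nat_cond [leRHS]big_nat_cond; apply: ler_sum => n /andP[/andP[zn nN] nv].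
  have := hpt n; rewrite zn -ltnS nN => /(_ isT nv); rewrite /prime_bound => pb.
  apply: (@le_trans _ _ (Lg * (\sum_(hi <- rem hm hs) (prime (n + hi))%:R * wgt N n))).
    rewrite mulr_sumr big_seq_cond [leRHS]big_seq_cond; apply: ler_sum => hi /andP[hih _].
    rewrite mulrA; apply: ler_wpM2r => //; rewrite /vth; case: ifP => pn; last by rewrite mulr0.
    rewrite mulr1; apply: le_trans (hLg hi (mem_rem hih)).
    by apply: lg_le; [apply: prime_gt0 | rewrite leq_add2r -ltnS].
  apply: ler_wpM2l => //; rewrite -mulr_suml.
  apply: (le_trans (ler_wpM2r (wg0 n) pb)); rewrite mulrDl mulr_suml.
  rewrite le_eqVlt; apply/orP; left; apply/eqP; congr (_ + _); first by ring.
  by apply: eq_bigr => p _; case: ifP; rewrite ?mul1r ?mul0r.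
rewrite -mulr_sumr; apply: ler_wpM2l => //; rewrite !big_split /=.
apply: lerD; first apply: lerD.
- rewrite -mulr_sumr; apply: ler_wpM2l; first by rewrite invr_ge0.
  exact: sum_tail_le.
- rewrite -mulr_sumr; apply: ler_wpM2l; first by rewrite invr_ge0.
  exact: ler_norm.
- rewrite exchange_big /=; apply: ler_sum => p _; rewrite -big_mkcondr /=.
  exact: sum_tail_le.
Qed.

Hypothesis uhs : uniq hs.
Hypothesis hw : {in hs, forall x, x < w}%N.
Hypothesis k0 : (1 < k)%N.
Hypothesis kw : (4 * k * k <= w)%N.
Hypothesis a0 : forall i, 0 <= a i.
Hypothesis dl0 : 0 < dl.
Hypothesis dl1 : 2 * dl <= 1.
Hypothesis t0 : 0 < tau.
Hypothesis t1 : tau < 1.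
Hypothesis tth : tau < theta.
Hypothesis lA : level errA theta.
Hypothesis lB : level errB theta.

Let mt := mainterm hs w tau.

Lemma lg_add_le (h : nat) (s : R) : 0 < s ->
  exists N0, forall N, (N0 <= N)%N -> lg (N + h) <= (1 + s) * lg N.
Proof.
move=> s0; have [N1 h1] := lg_large (lg h.+1 / s); exists (maxn N1 1) => N.
rewrite geq_max => /andP[/h1 hl N0].
have : lg (N + h) <= lg N + lg h.+1.
  rewrite -lgM // lg_le ?addn_gt0 ?N0 // mulnS leq_add2l; exact: leq_pmull.
rewrite ler_pdivrMr // in hl; move: (lg (N + h)) (lg h.+1) (lg N) hl => *; lra.
Qed.

Lemma sieve_contradiction (hm : nat) (et : R) : hm \in hs ->
  {in hs, forall h, coprime (v0 + h) w`!} -> 0 < et ->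
  (1 + et) ^+ (k + 4) * A0 k a < (1 - (2 * k * k)%:R / w%:R) *
    ((k.-1)%:R * tau * ((1 - k%:R / w%:R) ^+ k.+1 * (1 - 2 * dl) ^+ (k + 5) * B0 k a)) ->
  (forall c : R, 0 < c -> c <= tau / 2 -> exists N0, forall N, (N0 <= N)%N ->
     forall n, (z N < n <= N)%N -> n == v0 %[mod w`!] -> prime_bound hm c N n) -> False.
Proof.
move=> hmh cop et0; set cc := 1 - (2 * k * k)%:R / w%:R; set A1 := _ * A0 k a.
set B' := _ * B0 k a => hAB hpt.
have w0 := gt0_of_square_le k0 kw.
have cc2 : 2^-1 <= cc := half_le w0 kw.
have cc0 : 0 < cc by apply: lt_le_trans cc2; rewrite invr_gt0.
have A10 : 0 <= A1.
  rewrite /A1 mulr_ge0 ?exprn_ge0 ?addr_ge0 ?(ltW et0) //.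
  by rewrite /A0; do 2! apply: sumr_ge0 => ? _; rewrite !mulr_ge0 ?invr_ge0.
set A' := A1 / cc.
have ccA : cc * A' = A1 by rewrite /A' mulrC divfK // gt_eqF.
have A'0 : 0 <= A' by rewrite divr_ge0 // ltW.
have hAB' : A' < (k.-1)%:R * tau * B' by rewrite ltr_pdivrMr // mulrC.
(* The strict inequality leaves a margin 4g, from which all later errors are paid. *)
have [g g0 gE] : exists2 g : R, 0 < g & (k.-1)%:R * tau * B' = A' + 4 * g.
  exists (((k.-1)%:R * tau * B' - A') / 4); first by rewrite divr_gt0 // subr_gt0.
  by move: (_ * _ * B') (A') => x y; field.
have [K K0 hK] := sum_small_primes_le v0 uhs hw k0 kw a0 dl0 t0 tth lA hmh.
(* The three bounds keep the small primes below z, ensure tau + c < 1, and make K c^2 at most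
   g/4. *)
have [c c0 [c1 c2 c3]] : exists2 c : R, 0 < c & [/\ c <= tau / 2, c <= (1 - tau) / 2 & c <= g / (4 * (K + 1))].
  by apply: ex_small; rewrite ?divr_gt0 ?mulr_gt0 ?subr_gt0 //; lra.
have Kc : K * c ^+ 2 <= g / 4.
  have cl1 : c <= 1 by lra.
  have : c * (4 * (K + 1)) <= g by rewrite -ler_pdivlMr //; lra.
  have : 0 <= K * c * (1 - c) by rewrite !mulr_ge0 ?subr_ge0 // ltW.
  move: (g) (K) (c) c0 K0 => *; lra.
have k1 : 0 <= (k.-1)%:R :> R by [].
have [eps e0 [e1 e2 _]] : exists2 e : R, 0 < e & [/\ e <= g / 80, e <= g / (2 * ((k.-1)%:R + 1)) & e <= 1].
  by apply: ex_small; rewrite ?divr_gt0 ?mulr_gt0 //; lra.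
(* [s] is the relative error in replacing log(N + h) by log N. *)
have [s s0 [s1 _ _]] : exists2 e : R, 0 < e & [/\ e <= g / (A' + g), e <= 1 & e <= 1].
  by apply: ex_small; rewrite ?divr_gt0 //; lra.
have ke : (k.-1)%:R * eps <= g / 2.
  have : eps * (2 * ((k.-1)%:R + 1)) <= g by rewrite -ler_pdivlMr //; lra.
  move: ((k.-1)%:R : R) (eps) e0 (g) => *; lra.
have sg : s * (A' / 2 + g / 2) <= g / 2.
  have : s * (A' + g) <= g by rewrite -ler_pdivlMr //; lra.
  move: (s) (A') (g) => *; lra.
have tc : tau + c < 1 by lra.
have t0' : tau + 0 < 1 by rewrite addr0.
have E1 := negl_mainterm hs w t0 (negl_count_error k0 kw a0 t0 t1 (lexx 0) t0') e0.
have E2 := negl_mainterm hs w t0 (negl_count_error k0 kw a0 t0 t1 (ltW c0) tc) e0.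
have E3 := negl_mainterm hs w t0 (sum_lambda_negl v0 uhs hw k0 kw a0 dl0 t0 t1 tth lB hm) e0.
have E4 : exists N0, forall N, (N0 <= N)%N -> forall hi, hi \in rem hm hs ->
   mt N * L N * B' - eps * mt N <=
   \sum_((z N).+1 <= n < N.+1 | n == v0 %[mod w`!]) vth (n + hi) * wgt N n.
  apply: eventually_all => hi /mem_rem hih.
  have [e ne he] := sum_prime_mainterm uhs hw k0 kw a0 dl0 dl1 t0 t1 tth lA hih (cop _ hih).
  have [N0 h] := eventually_and he (negl_mainterm hs w t0 ne e0); exists N0 => N /h[h1 h2].
  by apply: le_trans h1; rewrite lerB.
have E5 : exists N0, forall N, (N0 <= N)%N -> forall hi, hi \in hs -> lg (N + hi) <= (1 + s) * lg N.
  by apply: eventually_all => hi _; apply: lg_add_le.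
have E6 := L_large t0 1.
have E7 := mainterm_ge hs w t0; case: E7 => kap kap0 E7.
have E8 := sum_all_le v0 uhs hw k0 kw a0 dl0 t0 et0.
have [N0 hN] := eventually_and E1 (eventually_and E2 (eventually_and E3 (eventually_and E4
   (eventually_and E5 (eventually_and E6 (eventually_and E7 (eventually_and E8 (eventually_and (hK c c0) (hpt c c0 c1))))))))).
have {hN E1 E2 E3 E4 E5 E6 E7 E8 hpt hK} := hN N0 (leqnn N0); set N := N0.
move=> [E1 [E2 [E3 [E4 [E5 [[N1 l1 L1] [E7 [E8 [E9 hpt]]]]]]]]].
have X0 : 0 < mt N by apply: lt_le_trans E7; rewrite mulr_gt0 // ltr0n ltnW.
have Lg0 : 0 <= (1 + s) * lg N by rewrite mulr_ge0 //; lra.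
have main := sum_prime_bound hpt Lg0 E5.
have low : (k.-1)%:R * (mt N * L N * B' - eps * mt N) <=
  \sum_(hi <- rem hm hs) \sum_((z N).+1 <= n < N.+1 | n == v0 %[mod w`!]) vth (n + hi) * wgt N n.
  by rewrite -(size_rem hmh); apply: sum_seq_ge.
have := le_trans low main.
move: E1 E2 E3 E8 E9; rewrite mul0r -/k.
set S0 := \sum_(1 <= n < N.+1 | _) _; set Sl := `|_|; set S3 := \sum_(p in _) _.
rewrite -/cc -/A1 -/(mt N) => E1 E2 E3 E8 E9 fin.
have S0b : S0 <= mt N * A' + 2 * (eps * mt N).
  have ecc : count_error k w a tau N <= 2 * (eps * mt N) * cc.
    have : 0 <= eps * mt N by rewrite mulr_ge0 // ltW.
    have ex0 : ex 0 = 1 by exact: exp_0.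
    move: E1; rewrite ex0 mul1r; move: (count_error _ _ _ _ _) (eps * mt N) (cc) cc2 => *; nra.
  rewrite -(ler_pM2l cc0); apply: (le_trans E8); rewrite mulrDr; apply: lerD; last by rewrite mulrC.
  by rewrite [leRHS]mulrCA ccA.
apply: (scalar_contradiction g0 X0 l1 (ltW s0) (ltW e0) gE Kc e1 ke sg S0b E3 _ fin).
by apply: (le_trans E9); rewrite lerD2l; apply: ler_wpM2l.
Qed.

End Combination.

(** * Admissible tuples, prime gaps and rough shifts *)

Lemma coprime_shift_mod (v v' h m : nat) : v = v' %[mod m] -> coprime (v + h) m = coprime (v' + h) m.
Proof. by move=> e; rewrite -coprime_modl -modnDml e modnDml coprime_modl. Qed.

(** The Chinese remainder theorem, one factor of w! at a time. A composite factor brings no new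
    prime, as its prime divisors already occur in the smaller factorial. *)
Lemma exists_residue (hs : seq nat) (w : nat) :
  (forall p, prime p -> exists v, {in hs, forall h, ~~ (p %| v + h)%N}) ->
  exists v, {in hs, forall h, coprime (v + h) w`!}.
Proof.
move=> adm; elim: w => [|w [v hv]]; first by exists 0%N => h _; rewrite coprimen1.
have [pw|npw] := boolP (prime w.+1).
  have [u hu] := adm _ pw.
  have cw : coprime w.+1 w`! by rewrite coprime_fact.
  exists (chinese w.+1 w`! u v) => h hh; rewrite factS coprimeMr.
  rewrite (coprime_shift_mod h (chinese_modl cw u v)) (coprime_shift_mod h (chinese_modr cw u v)).
  by rewrite hv // andbT coprime_sym prime_coprime // hu.
exists v => h hh; rewrite factS coprimeMr hv // andbT.
apply/negPn/negP => ng; have g0 : (0 < gcdn (v + h) w.+1)%N by rewrite gcdn_gt0 orbT.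
have g1 : (1 < gcdn (v + h) w.+1)%N by rewrite ltn_neqAle eq_sym g0 andbT.
have pq := pdiv_prime g1; set q := pdiv _ in pq.
have qg : (q %| gcdn (v + h) w.+1)%N by apply: pdiv_dvd.
have [qv qw] : (q %| v + h)%N /\ (q %| w.+1)%N by move: qg; rewrite dvdn_gcd => /andP[].
have qlw : (q <= w)%N.
  rewrite -ltnS ltn_neqAle dvdn_leq // andbT; apply/eqP => e; by rewrite -e pq in npw.
have : (q %| gcdn (v + h) w`!)%N by rewrite dvdn_gcd qv dvdn_fact // prime_gt0.
by have /eqP-> := hv h hh; rewrite dvdn1 => /eqP q1; rewrite q1 in pq.
Qed.

(** Admissibility by computation for tuples inside [0, 26]: for a prime p >= 29 the residue 1 works,
    because 1 <= 1 + h <= 27 < p, so only smaller primes have to be tested. *)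
Definition admissible_check (hs : seq nat) : bool :=
  all (fun h => h < 27)%N hs &&
  all (fun p => prime p ==> has (fun v => all (fun h => ~~ (p %| v + h)%N) hs) (iota 0 p)) (iota 0 29).

Lemma admissible_residue (hs : seq nat) (p : nat) : admissible_check hs -> prime p ->
  exists v, {in hs, forall h, ~~ (p %| v + h)%N}.
Proof.
move=> /andP[/allP h27 /allP h29] pp; case: (ltnP p 29) => p29.
  have := h29 p; rewrite mem_iota p29 pp => /(_ isT) /hasP[v _ /allP hv]; by exists v.
exists 1%N => h /h27 hh; apply/negP => /dvdn_leq -/(_ isT); rewrite add1n leqNgt.
have -> // : (h.+1 < p)%N by apply: leq_trans p29; rewrite ltnS; apply: leq_trans hh _.
Qed.

Lemma nth_primeS (n : nat) : (nth_prime n < nth_prime n.+1)%N && prime (nth_prime n.+1).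
Proof. by rewrite /nth_prime iterS /next_prime; case: ex_minnP. Qed.

Lemma nth_primeS_le (n q : nat) : prime q -> (nth_prime n < q)%N -> (nth_prime n.+1 <= q)%N.
Proof.
move=> pq h; rewrite /nth_prime iterS /next_prime; case: ex_minnP => m _; apply.
by rewrite h pq.
Qed.

Lemma prime_nth_prime (p n : nat) : prime p -> (nth_prime n <= p)%N ->
  exists2 m, (n <= m)%N & nth_prime m = p.
Proof.
move=> pp; move: {2}(p - nth_prime n)%N (leqnn (p - nth_prime n)%N) => d.
elim: d n => [|d IH] n hd hn.
  by exists n => //; apply/eqP; rewrite eqn_leq hn -subn_eq0 -leqn0.
move: hn; rewrite leq_eqVlt => /orP[/eqP e|lt]; first by exists n.
have /andP[h1 _] := nth_primeS n; have h2 := nth_primeS_le pp lt.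
have [m nm e] : exists2 m, (n.+1 <= m)%N & nth_prime m = p by apply: IH => //; lia.
by exists m => //; apply: ltnW.
Qed.

(** A lower limit above D makes all late consecutive gaps exceed D, and q is at least the prime
    following p. *)
Lemma gaps_of_liminf (D : nat) :
  ~ Rbar_le (LimInf_seq (fun n => INR (nth_prime n.+2 - nth_prime n.+1)%N)) (INR D) ->
  exists M, forall p q, prime p -> prime q -> (M <= p)%N -> (p < q)%N -> (p + D < q)%N.
Proof.
set u := fun n => _; move=> nle.
have [N hN] : exists N, forall n, (N <= n)%N -> Rlt (INR D) (u n).
  move: nle; rewrite /LimInf_seq; case: (ex_LimInf_seq u) => [[l| |]] /= h nle; move: h.
  - move=> h; have l0 : Rlt (IZR Z0) (Rminus l (INR D)) by apply: Rlt_Rminus; apply: Rnot_le_lt.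
    (* Radius l - D around a finite lower limit l: eventually u n > l - (l - D) = D. *)
    have [_ [N hN]] := h (mkposreal _ l0); exists N => n /ssrnat.leP /hN /=.
    by rewrite /Rminus Ropp_plus_distr Ropp_involutive -Rplus_assoc Rplus_opp_r Rplus_0_l.
  - by move=> /(_ (INR D)) [N hN]; exists N => n /ssrnat.leP /hN.
  - by case: nle.
exists (nth_prime N.+1) => p q pp pq Np plq.
have [m Nm e] := prime_nth_prime pp Np.
case: m Nm e => // m; rewrite ltnS => Nm e.
have := nth_primeS_le (n := m.+1) pq; rewrite e => /(_ plq) h2.
have /ssrnat.ltP := INR_lt _ _ (hN _ Nm); rewrite e.
by move: h2; move: (nth_prime _) => y; lia.
Qed.

(** Roughness bounds the number of prime factors; this limits the values b that can occur. *)
Lemma pdiv_exp_bigOmega (m : nat) : (0 < m)%N -> (pdiv m ^ bigOmega m <= m)%N.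
Proof.
move=> m0; rewrite {3}(prod_prime_decomp m0) prime_decompE big_map /= /bigOmega expn_sum.
rewrite big_seq [leqRHS]big_seq; apply: leq_prod => p; rewrite mem_primes => /and3P[pp _ pm].
have : (pdiv m <= p)%N by apply: pdiv_min_dvd => //; apply: prime_gt1.
by case: (logn p m) => // e; rewrite leq_exp2r.
Qed.

Lemma lgX (q b : nat) : (0 < q)%N -> lg (q ^ b) = b%:R * lg q.
Proof.
move=> q0; elim: b => [|b IH]; first by rewrite expn0 lg1 mul0r.
by rewrite expnS lgM ?expn_gt0 ?q0 // IH -natr1 mulrDl mul1r addrC.
Qed.

Lemma liouvilleE (n : nat) : liouville n = (-1) ^+ bigOmega n.
Proof. by rewrite /liouville RpowE. Qed.

Lemma gap_unique (M D n x y : nat) :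
  (forall p q, prime p -> prime q -> (M <= p)%N -> (p < q)%N -> (p + D < q)%N) ->
  (M <= n)%N -> prime (n + x) -> prime (n + y) -> (x <= y + D)%N -> (y <= x + D)%N -> x = y.
Proof.
move=> gap Mn px py xy yx.
have Mx : (M <= n + x)%N := leq_trans Mn (leq_addr _ _).
have My : (M <= n + y)%N := leq_trans Mn (leq_addr _ _).
case: (ltngtP x y) => // lt; exfalso.
  by have := gap _ _ px py Mx; rewrite ltn_add2l lt -addnA ltn_add2l ltnNge yx => /(_ isT).
by have := gap _ _ py px My; rewrite ltn_add2l lt -addnA ltn_add2l ltnNge xy => /(_ isT).
Qed.

Section Pointwise.
Variables (hs : seq nat) (hm w v0 D : nat) (tau : R).
Hypothesis uhs : uniq hs.
Hypothesis hmh : hm \in hs.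
Hypothesis diam : {in hs &, forall x y, x <= y + D}%N.
Hypothesis cov : coprime (v0 + hm) w`!.
Hypothesis t0 : 0 < tau.
Hypothesis gaps : exists M, forall p q, prime p -> prime q -> (M <= p)%N -> (p < q)%N -> (p + D < q)%N.
Hypothesis rough : forall (c : R) (b h : nat), 0 < c -> odd b -> h \in rem hm hs ->
  exists M, forall n, (M <= n)%N -> prime (n + h) -> c * lg (n + h) < lg (pdiv (n + hm)) ->
    bigOmega (n + hm) <> b.

Lemma eventually_zN (M : nat) : exists N0, forall N, (N0 <= N)%N ->
  [/\ (1 < N)%N, (M < zN (LN tau N))%N & 1 <= lg N].
Proof.
have [N0 h] := L_large t0 (lg M.+1); exists N0 => N /h[N1 l1 hL]; split=> //.
have [z0 zL _] := zN_facts (LN tau N); rewrite ltnNge; apply/negP => zM.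
have := lg_le z0 (leqW zM); rewrite leNgt (le_lt_trans hL zL) //.
Qed.

(** The hypothesis gives one threshold for each b and h. Only finitely many b satisfy b c <= 1 and
    [hs] is finite, so a common threshold exists. *)
Lemma rough_uniform (c : R) : 0 < c -> exists M, forall n, (M <= n)%N ->
  forall h, h \in rem hm hs -> prime (n + h) -> c * lg (n + h) < lg (pdiv (n + hm)) ->
  forall b, (b%:R * c <= 1) -> odd b -> bigOmega (n + hm) <> b.
Proof.
move=> c0; pose B := Z.to_nat (up (c^-1)).
have [M hM] : exists M, forall n, (M <= n)%N -> forall b, b \in iota 0 B.+1 ->
   forall h, h \in rem hm hs -> odd b -> prime (n + h) -> c * lg (n + h) < lg (pdiv (n + hm)) ->
    bigOmega (n + hm) <> b.
  apply: (@eventually_all _ (fun b n => forall h, h \in rem hm hs -> odd b -> prime (n + h) ->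
     c * lg (n + h) < lg (pdiv (n + hm)) -> bigOmega (n + hm) <> b)) => b _.
  apply: (@eventually_all _ (fun h n => odd b -> prime (n + h) ->
     c * lg (n + h) < lg (pdiv (n + hm)) -> bigOmega (n + hm) <> b)) => h hh.
  case ob : (odd b); last by exists 0%N.
  by have [M hM] := rough c0 ob hh; exists M => n Mn _; apply: hM.
exists M => n Mn h hh pn lt b bc ob; apply: (hM n Mn b _ h) => //.
by rewrite mem_iota /= add0n ltnS; apply: le_up_nat; rewrite -(mul1r c^-1) ler_pdivlMr.
Qed.

(** The case to be excluded is an odd number of prime factors of n + h_m, all above N^c. Then that
    number is at most 2/c, and roughness with exponent c/2 contradicts [rough]. *)
Lemma prime_bound_eventually (c : R) : 0 < c -> c <= tau / 2 -> exists N0, forall N, (N0 <= N)%N ->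
  forall n, (zN (LN tau N) < n <= N)%N -> n == v0 %[mod w`!] -> prime_bound hs w tau hm c N n.
Proof.
move=> c0 c2; have [M1 gap] := gaps.
(* Half of c, since the logarithms of n + hi are only bounded by 2 log N. *)
have c20 : 0 < c / 2 by rewrite divr_gt0.
have [M2 hM2] := rough_uniform c20.
have E5 : exists N0, forall N, (N0 <= N)%N -> forall hi, hi \in hs -> lg (N + hi) <= (1 + 1) * lg N.
  by apply: eventually_all => hi _; apply: lg_add_le.
have [N0 hN0] := eventually_and E5 (eventually_zN (M1 + M2)); exists N0 => N /hN0[E [N1 Mz l1]] n /andP[zn nN] nv.
have Mn : (M1 + M2 <= n)%N := ltnW (ltn_trans Mz zn).
have M1n : (M1 <= n)%N := leq_trans (leq_addr _ _) Mn.
have M2n : (M2 <= n)%N := leq_trans (leq_addl _ _) Mn.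
have n0 : (0 < n)%N := leq_trans (ltn0Sn _) zn.
have S0 : 0 <= \sum_(p in small_primes w tau c N) (p %| n + hm)%N%:R :> R by apply: sumr_ge0.
have lam0 : 0 <= (1 + liouville (n + hm)) / 2.
  by have := ler_norm (- liouville (n + hm)); rewrite normrN liouville_norm; lra.
rewrite /prime_bound; have [/hasP[hi hih pi]|/hasPn nop] := boolP (has (fun h => prime (n + h)) (rem hm hs)); last first.
  rewrite big_seq big1 ?addr_ge0 // => h hh; by rewrite (negbTE (nop h hh)).
have ur : uniq (rem hm hs) by apply: rem_uniq.
have -> : \sum_(h <- rem hm hs) (prime (n + h))%:R = 1 :> R.
  rewrite (bigD1_seq hi) //= pi big1_seq ?addr0 // => h /andP[hne hh].
  case ph : (prime (n + h)) => //; exfalso.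
  have d1 := diam (mem_rem hh) (mem_rem hih); have d2 := diam (mem_rem hih) (mem_rem hh).
  by rewrite (gap_unique gap M1n ph pi d1 d2) eqxx in hne.
have [ob|eb] := boolP (odd (bigOmega (n + hm))); last first.
  rewrite liouvilleE -signr_odd (negbTE eb) expr0; lra.
suff : 1 <= \sum_(p in small_primes w tau c N) (p %| n + hm)%N%:R :> R by lra.
(* [pdiv] is a genuine prime only above 1; the value 1 is ruled out by its even [bigOmega]. *)
have m1 : (1 < n + hm)%N.
  rewrite ltnNge; apply/negP => m1; have m2 : (n + hm = 1)%N.
    by apply/eqP; rewrite eqn_leq m1 addn_gt0 n0.
  by rewrite m2 /bigOmega big_nil in ob.
set q := pdiv (n + hm); have pq : prime q by apply: pdiv_prime.
have qm : (q %| n + hm)%N by apply: pdiv_dvd.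
have q0 := prime_gt0 pq.
(* The residue class is coprime to w! at h_m, so the least prime factor is one of the sieving primes
   as soon as it is below z. *)
have wq : (w < q)%N.
  rewrite -coprime_fact //; apply: (coprime_dvdl qm).
  by rewrite (coprime_shift_mod hm (eqP nv)).
have cL : c * lg N <= LN tau N by rewrite /LN; apply: ler_wpM2r => //; apply: lg_ge0; apply: ltnW.
case: (lerP (lg q) (c * lg N)) => lq.
  have qz : (q < zN (LN tau N))%N.
    rewrite ltnNge; apply/negP => zq; have [z0 zL _] := zN_facts (LN tau N).
    have := lg_le z0 zq; lra.
  rewrite (bigD1 (Ordinal qz)) /=; last by rewrite !inE /= pq wq lq.
  by rewrite qm lerDl; apply: sumr_ge0.
exfalso.
have l0 : 0 < lg N by lra.
have le1 := E hi (mem_rem hih); have le2 := E hm hmh.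
have lnN (h : nat) : lg (n + h) <= lg (N + h) by apply: lg_le; rewrite ?addn_gt0 ?n0 // leq_add2r.
have h1 : c / 2 * lg (n + hi) < lg q.
  apply: le_lt_trans lq; have := lnN hi; have -> : c * lg N = c / 2 * (2 * lg N) by field.
  by move=> ?; apply: ler_wpM2l; [rewrite divr_ge0 // ltW | lra].
have hb : (bigOmega (n + hm))%:R * lg q <= 2 * lg N.
  rewrite -lgX // (@le_trans _ _ (lg (n + hm))) //; last by have := lnN hm; lra.
  by apply: lg_le; rewrite ?expn_gt0 ?q0 // pdiv_exp_bigOmega // ltnW.
apply: (hM2 n M2n hi hih pi h1 (bigOmega (n + hm)) _ ob) => //.
rewrite -(ler_pM2r l0) mul1r.
have : (bigOmega (n + hm))%:R * (c * lg N) <= (bigOmega (n + hm))%:R * lg q by apply: ler_wpM2l => //; apply: ltW.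
move: ((bigOmega (n + hm))%:R : R) hb => x hb; move: (lg q) (lg N) hb => y l; lra.
Qed.

End Pointwise.

(** * Choice of the parameters and the numerical inequality *)

Lemma bernoulli_sub (u : R) (m : nat) : 0 <= u <= 1 -> 1 - m%:R * u <= (1 - u) ^+ m.
Proof.
move=> /andP[u0 u1]; elim: m => [|m IH]; first by rewrite mul0r subr0 expr0.
rewrite exprS -natr1; have m0 : 0 <= m%:R :> R by [].
have := ler_wpM2l (_ : 0 <= 1 - u) IH; rewrite subr_ge0 => /(_ u1) h; apply: le_trans h.
have := mulr_ge0 m0 (sqr_ge0 u); move: (m%:R : R) m0 => x x0; nra.
Qed.

Lemma small_loss (A G : R) (m : nat) : 0 <= A -> A < G ->
  exists2 u : R, 0 < u <= 1 & A < G * (1 - u) ^+ m.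
Proof.
move=> A0' AG; have G0 : 0 < G by apply: le_lt_trans AG.
have m0 : 0 <= m%:R :> R by [].
have [u u0 [u1 u2 _]] : exists2 e : R, 0 < e & [/\ e <= 1, e <= (G - A) / (2 * G * (m%:R + 1)) & e <= 1].
  by apply: ex_small => //; rewrite divr_gt0 ?subr_gt0 // mulr_gt0 ?mulr_gt0 //; lra.
exists u; first by rewrite u0.
have : G * (1 - m%:R * u) <= G * (1 - u) ^+ m.
  by apply: ler_wpM2l; [exact: ltW | apply: bernoulli_sub; rewrite u1 ltW].
have h : u * (2 * G * (m%:R + 1)) <= G - A by rewrite -ler_pdivlMr // mulr_gt0 ?mulr_gt0 //; lra.
have uG := mulr_gt0 u0 G0; have mu := mulr_ge0 (mulr_ge0 m0 (ltW u0)) (ltW G0).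
move: (m%:R : R) m0 h mu => x x0 h mu; move: (_ ^+ m) => v; nra.
Qed.

Lemma A0_ge0 (k : nat) (a : nat -> R) : (forall i, 0 <= a i) -> 0 <= A0 k a.
Proof. by move=> a0; rewrite /A0; do 2! apply: sumr_ge0 => ? _; rewrite !mulr_ge0 ?invr_ge0. Qed.

(** A single u controls every loss: it bounds 2k^2/w and k/w, it equals twice the ramp length, and
    it is the relative shift in [form0_le]. *)
Lemma choose_parameters (k : nat) (a : nat -> R) (tau : R) : (1 < k)%N -> (forall i, 0 <= a i) ->
  A0 k a < (k.-1)%:R * tau * B0 k a ->
  exists (w : nat) (u : R), [/\ (27 <= w)%N, (4 * k * k <= w)%N, 0 < u <= 1 &
  (1 + u) ^+ (k + 4) * A0 k a < (1 - (2 * k * k)%:R / w%:R) *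
    ((k.-1)%:R * tau * ((1 - k%:R / w%:R) ^+ k.+1 * (1 - 2 * (u / 2)) ^+ (k + 5) * B0 k a))].
Proof.
move=> k0 a0 AG; have A0g := A0_ge0 k a0.
(* Number of factors 1 - u: one for 1 - 2k^2/w, then k + 1 and k + 5 from the lower bound at primes,
   and k + 4 to undo (1 + u)^(k+4) by (1 + u)(1 - u) <= 1. *)
have [u /andP[u0 u1] hu] := small_loss (1 + k.+1 + (k + 5) + (k + 4)) A0g AG.
have [T hT] : exists T : nat, u^-1 <= T%:R.
  exists (Z.to_nat (up u^-1)).
  have [h1 _] := archimed u^-1; have i0 : 0 < u^-1 by rewrite invr_gt0.
  have u0' : Z.le Z0 (up u^-1) by apply: le_IZR; apply: Rlt_le; apply: Rlt_trans h1; apply/RltP.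
  rewrite -INRE INR_IZR_INZ Z2Nat.id //; apply: ltW; exact/RltP.
(* The 27 puts every member of an admissible tuple below w, and T >= 1/u gives 2k^2/w <= u. *)
exists (4 * k * k * T.+1 + 27)%N, u; set w := (_ + 27)%N.
have kw : (4 * k * k <= w)%N by rewrite /w; nia.
have wT : (2 * k * k * T <= w)%N by rewrite /w; nia.
have w27 : (27 <= w)%N by rewrite /w leq_addl.
have w0 : 0 < w%:R :> R by rewrite ltr0n; apply: leq_trans w27.
clearbody w; split => //; first by rewrite u0 u1.
have c1 : (2 * k * k)%:R / w%:R <= u.
  rewrite ler_pdivrMr // -ler_pdivrMl // mulrC.
  apply: (@le_trans _ _ ((2 * k * k)%:R * T%:R)); first by apply: ler_wpM2l.
  by rewrite -natrM ler_nat.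
have c2 : k%:R / w%:R <= u.
  apply: le_trans c1; rewrite ler_pM2r ?invr_gt0 // ler_nat; nia.
have -> : 2 * (u / 2) = u by field.
have v0 : 0 <= 1 - u by rewrite subr_ge0.
have G0 : 0 < (k.-1)%:R * tau * B0 k a by apply: le_lt_trans AG.
have d1 : 1 - u <= 1 - (2 * k * k)%:R / w%:R by rewrite lerD2l lerN2.
have d2 : (1 - u) ^+ k.+1 <= (1 - k%:R / w%:R) ^+ k.+1.
  by apply: lerXn2r; rewrite ?nnegrE // ?lerD2l ?lerN2 // (le_trans v0) // lerD2l lerN2.
apply: (@lt_le_trans _ _ (((k.-1)%:R * tau * B0 k a) * ((1 - u) * (1 - u) ^+ k.+1 * (1 - u) ^+ (k + 5)))).
  have p1 : 0 < (1 + u) ^+ (k + 4) by rewrite exprn_gt0 // addr_gt0.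
  have p2 : (1 + u) ^+ (k + 4) * (1 - u) ^+ (k + 4) <= 1.
    by rewrite -exprMn exprn_ile1 //; [rewrite mulr_ge0 // addr_ge0 // ltW | nra].
  have := hu; rewrite -(ltr_pM2l p1) => h; apply: (lt_le_trans h).
  rewrite (exprD _ (1 + k.+1 + (k + 5))%N) (exprD _ (1 + k.+1)%N) (exprD _ 1%N) expr1.
  set Z := (1 - u) * _ * _; have Z0 : 0 <= (k.-1)%:R * tau * B0 k a * Z.
    by rewrite mulr_ge0 ?(ltW G0) // !mulr_ge0 ?exprn_ge0.
  rewrite [leLHS]mulrC mulrA -[leLHS]mulrA [_ ^+ _ * _ ^+ _]mulrC.
  by rewrite ler_piMr.
have -> : (k.-1)%:R * tau * ((1 - k%:R / w%:R) ^+ k.+1 * (1 - u) ^+ (k + 5) * B0 k a) =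
  (k.-1)%:R * tau * B0 k a * ((1 - k%:R / w%:R) ^+ k.+1 * (1 - u) ^+ (k + 5)) by ring.
rewrite [leRHS]mulrCA; apply: ler_wpM2l; first exact: ltW.
rewrite -mulrA; apply: ler_pM => //; first by rewrite mulr_ge0 ?exprn_ge0.
by apply: ler_wpM2r => //; rewrite exprn_ge0.
Qed.

(** With 1/k! pulled out, here and in [B0E], the two forms are compared as rational functions of k
    and no factorial has to be evaluated. *)
Lemma A0E (k : nat) (a : nat -> R) (x := k%:R : R) :
  A0 k a = k`!%:R^-1 * (a 0%N ^+ 2 + 2 * a 0%N * a 1%N / (x + 1) +
    (4 * a 0%N * a 2%N + 2 * a 1%N ^+ 2) / ((x + 1) * (x + 2)) +
    12 * a 1%N * a 2%N / ((x + 1) * (x + 2) * (x + 3)) +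
    24 * a 2%N ^+ 2 / ((x + 1) * (x + 2) * (x + 3) * (x + 4))).
Proof.
have x0 : 0 <= x by [].
have f0 : k`!%:R != 0 :> R by rewrite pnatr_eq0 -lt0n fact_gt0.
rewrite /A0 !big_ord_recr !big_ord0 /= !add0r.
rewrite !addSn !add0n !factS fact0 !natrM -!natr1 -/x.
move: (k`!%:R : R) (a 0%N) (a 1%N) (a 2%N) (x) f0 x0 => f a0 a1 a2 y f0 y0.
by field; rewrite f0; repeat (apply/andP; split => //); apply: lt0r_neq0; lra.
Qed.

Lemma B0E (k : nat) (a : nat -> R) (x := k%:R : R) :
  B0 k a = k`!%:R^-1 * (2 * a 0%N ^+ 2 / (x + 1) + 6 * a 0%N * a 1%N / ((x + 1) * (x + 2)) +
    (16 * a 0%N * a 2%N + 6 * a 1%N ^+ 2) / ((x + 1) * (x + 2) * (x + 3)) +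
    40 * a 1%N * a 2%N / ((x + 1) * (x + 2) * (x + 3) * (x + 4)) +
    80 * a 2%N ^+ 2 / ((x + 1) * (x + 2) * (x + 3) * (x + 4) * (x + 5))).
Proof.
have x0 : 0 <= x by [].
have f0 : k`!%:R != 0 :> R by rewrite pnatr_eq0 -lt0n fact_gt0.
rewrite /B0 !big_ord_recr !big_ord0 /= !add0r.
rewrite !addn1 !addSn !add0n !factS fact0 !natrM -!natr1 -/x.
move: (k`!%:R : R) (a 0%N) (a 1%N) (a 2%N) (x) f0 x0 => f a0 a1 a2 y f0 y0.
by field; rewrite f0; repeat (apply/andP; split => //); apply: lt0r_neq0; lra.
Qed.

(** Natural numbers, so that nonnegativity is immediate and the final check is integer
    arithmetic. *)
Definition coefs (b c d : nat) (i : nat) : R := (nth 0%N [:: b; c; d] i)%:R.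

(** The hypothesis is the first conclusion multiplied by k! q (x + 1)...(x + 5): for numerals it
    compares two integers. *)
Lemma numeric_check (k b c d p q : nat) (x := k%:R : R) : (0 < b)%N -> (0 < q)%N ->
  q%:R * (b%:R ^+ 2 * ((x + 1) * (x + 2) * (x + 3) * (x + 4) * (x + 5)) +
    2 * b%:R * c%:R * ((x + 2) * (x + 3) * (x + 4) * (x + 5)) +
    (4 * b%:R * d%:R + 2 * c%:R ^+ 2) * ((x + 3) * (x + 4) * (x + 5)) +
    12 * c%:R * d%:R * ((x + 4) * (x + 5)) + 24 * d%:R ^+ 2 * (x + 5)) <=
  (k.-1)%:R * p%:R * (2 * b%:R ^+ 2 * ((x + 2) * (x + 3) * (x + 4) * (x + 5)) +
    6 * b%:R * c%:R * ((x + 3) * (x + 4) * (x + 5)) +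
    (16 * b%:R * d%:R + 6 * c%:R ^+ 2) * ((x + 4) * (x + 5)) +
    40 * c%:R * d%:R * (x + 5) + 80 * d%:R ^+ 2) ->
  A0 k (coefs b c d) <= (k.-1)%:R * (p%:R / q%:R) * B0 k (coefs b c d) /\ 0 < B0 k (coefs b c d).
Proof.
move=> b0 q0 h; rewrite A0E B0E /= /coefs /= -/x.
have f0 : 0 < k`!%:R^-1 :> R by rewrite invr_gt0 ltr0n fact_gt0.
have x0 : 0 <= x by []; have bp : 0 < b%:R :> R by rewrite ltr0n.
have qp : 0 < q%:R :> R by rewrite ltr0n.
have xi (i : nat) : 0 < x + i.+1%:R by rewrite ltr_wpDl // ltr0n.
have [x1 x2 x3 x4 x5] := And5 (xi 0%N) (xi 1%N) (xi 2%N) (xi 3%N) (xi 4%N).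
split; last first.
  rewrite mulr_gt0 // -!addrA ltr_pwDl //; first by rewrite divr_gt0 ?mulr_gt0 ?exprn_gt0.
  by rewrite !addr_ge0 // divr_ge0 ?addr_ge0 ?mulr_ge0 ?sqr_ge0 ?(ltW x1) ?(ltW x2) ?(ltW x3) ?(ltW x4) ?(ltW x5).
rewrite [leRHS]mulrCA ler_pM2l //.
have P0 : 0 < q%:R * ((x + 1) * (x + 2) * (x + 3) * (x + 4) * (x + 5)) by rewrite !mulr_gt0.
rewrite -(ler_pM2r P0).
have [y1 [y2 [y3 [y4 [y5 y6]]]]] : x + 1 != 0 /\ x + 2 != 0 /\ x + 3 != 0 /\ x + 4 != 0 /\ x + 5 != 0 /\ q%:R != 0 :> R.
  by do !split; apply: lt0r_neq0.
move: h; move: (b%:R : R) (c%:R : R) (d%:R : R) (p%:R : R) (q%:R : R) ((k.-1)%:R : R) (x) y1 y2 y3 y4 y5 y6 => B C D P Q K X y1 y2 y3 y4 y5 y6 h.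
set l := (X in X <= _) in h; set r := (X in _ <= X) in h.
rewrite [leLHS](_ : _ = l); last by rewrite /l; field; rewrite y1 y2 y3 y4.
rewrite [leRHS](_ : _ = r) //; last by rewrite /r; field; rewrite y1 y2 y3 y4 y5 y6.
Qed.

(** At theta0 the numerical inequality is only weak. A tau strictly between theta0 and the smaller
    of theta and 1 makes it strict, because B0 > 0, and this strictness is the room for all error
    terms. *)
Lemma sieve_tuple (hs : seq nat) (hm D : nat) (a : nat -> R) (theta0 theta : R) :
  let k := size hs in
  uniq hs -> (1 < k)%N -> admissible_check hs -> hm \in hs ->
  {in hs &, forall x y, x <= y + D}%N -> (forall i, 0 <= a i) ->
  0 < theta0 < 1 -> A0 k a <= (k.-1)%:R * theta0 * B0 k a -> 0 < B0 k a ->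
  theta0 < theta -> level errA theta -> level errB theta ->
  (exists M, forall p q, prime p -> prime q -> (M <= p)%N -> (p < q)%N -> (p + D < q)%N) ->
  (forall (c : R) (b h : nat), 0 < c -> odd b -> h \in rem hm hs ->
    exists M, forall n, (M <= n)%N -> prime (n + h) -> c * lg (n + h) < lg (pdiv (n + hm)) ->
    bigOmega (n + hm) <> b) -> False.
Proof.
move=> k uhs k0 adm hmh diam a0 /andP[th0 th1] AB Bp tht lA lB gaps rough.
have [tau [t1 t2 t3]] : exists tau : R, [/\ theta0 < tau, tau < 1 & tau < theta].
  case: (lerP theta 1) => h1; [exists ((theta0 + theta) / 2) | exists ((theta0 + 1) / 2)];
    by split; lra.
have t0 : 0 < tau by lra.
have AG : A0 k a < (k.-1)%:R * tau * B0 k a.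
  apply: (le_lt_trans AB); rewrite ltr_pM2r // ltr_pM2l // ltr0n -subn1 subn_gt0 //.
have [w [u [w27 kw /andP[u0 u1] par]]] := choose_parameters k0 a0 AG.
have hw : {in hs, forall x, x < w}%N.
  by move=> h hh; apply: leq_trans w27; have /andP[/allP/(_ h hh)] := adm.
have [v0 hv] := exists_residue w (fun p pp => admissible_residue adm pp).
have dl0 : 0 < u / 2 by rewrite divr_gt0.
have dl1 : 2 * (u / 2) <= 1 by lra.
apply: (sieve_contradiction uhs hw k0 kw a0 dl0 dl1 t0 t2 t3 lA lB hmh hv u0 par).
by move=> c c0 c1; apply: (prime_bound_eventually uhs hmh diam (hv hm hmh) t0 gaps rough c0 c1).
Qed.

(** * The theorem *)

Definition good_tuple (hs : seq nat) (hm D6 D5 : nat) : bool :=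
  [&& uniq hs, (1 < size hs)%N, admissible_check hs, hm \in hs, all (fun x => ~~ odd x) hs,
      all (fun x => (x <= hm + D6) && (hm <= x + D6))%N hs &
      all (fun x => all (fun y => x <= y + D5)%N hs) hs].

(** Alternative (i) of the theorem up to conversion. *)
Definition rough_prime_shifts (D : nat) : Prop :=
  exists (C c : R) (b : nat) (d : Z),
    Rlt (IZR Z0) c /\ odd b /\ Rle (INR b) C /\ Z.Even d /\
    (Z.lt Z0 (Z.abs d) /\ Z.le (Z.abs d) (Z.of_nat D)) /\
    (forall M : nat, exists p : nat, (M <= p)%N /\ prime p /\
       Z.lt Z0 (Z.add (Z.of_nat p) d) /\
       Rlt (Rpower (INR p) c) (INR (pdiv (Z.to_nat (Z.add (Z.of_nat p) d)))) /\
       bigOmega (Z.to_nat (Z.add (Z.of_nat p) d)) = b).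

Lemma no_rough_prime_shifts (D h hm b : nat) (c : R) : ~~ odd h -> ~~ odd hm -> h <> hm ->
  (h <= hm + D)%N -> (hm <= h + D)%N -> 0 < c -> odd b -> ~ rough_prime_shifts D ->
  exists M, forall n, (M <= n)%N -> prime (n + h) -> c * lg (n + h) < lg (pdiv (n + hm)) ->
    bigOmega (n + hm) <> b.
Proof.
move=> oh ohm hne h1 h2 c0 ob ni; apply: NNPP => nM; apply: ni.
exists (INR b), c, b, (Z.sub (Z.of_nat hm) (Z.of_nat h)); split; first exact/RltP.
split=> //; split; first exact: Rle_refl.
have zE (x : nat) : ~~ odd x -> Z.Even (Z.of_nat x).
  by move=> ox; exists (Z.of_nat x./2); have := odd_double_half x; rewrite (negbTE ox) -muln2; lia.
split; first by case: (zE _ oh) => x ->; case: (zE _ ohm) => y ->; exists (Z.sub y x); ring.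
split; first by lia.
(* The threshold M + 1 forces n > 0, hence p + d > 0. *)
move=> M; apply: NNPP => nex; apply: nM; exists M.+1 => n Mn pn lt eb; apply: nex.
exists (n + h)%N.
have -> : Z.add (Z.of_nat (n + h)) (Z.sub (Z.of_nat hm) (Z.of_nat h)) = Z.of_nat (n + hm) by lia.
rewrite Nat2Z.id; split; first by apply: leq_trans (leq_addr _ _); apply: ltnW.
split=> //; split; first by lia.
split=> //; rewrite Rpower_lg; apply/RltP; rewrite INRE -(ex_lg (pdiv_gt0 _)).
by apply/RltP; apply: exp_increasing; apply/RltP.
Qed.

Lemma theorem8_of_tuple (hs : seq nat) (hm D6 D5 b c d p : nat) (theta : R) (k := size hs) :
  good_tuple hs hm D6 D5 -> (0 < p < 1000)%N ->
  A0 k (coefs b c d) <= (k.-1)%:R * (p%:R / 1000%:R) * B0 k (coefs b c d) /\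
    0 < B0 k (coefs b c d) ->
  Rlt (Rdiv (IZR (Z.of_nat p)) (IZR (Z.of_nat 1000))) theta -> condA theta -> condB theta ->
  ~ rough_prime_shifts D6 ->
  ~ Rbar_le (LimInf_seq (fun n => INR (nth_prime n.+2 - nth_prime n.+1)%N)) (INR D5) -> False.
Proof.
move=> /and5P[uhs k0 adm hmh /and3P[/allP ev /allP near /allP diam]] /andP[p0 p1] [AB Bp].
move=> ht /levelA lA /levelB lB nI nII; have gaps := gaps_of_liminf nII.
rewrite -!INR_IZR_INZ !INRE in ht; move/RltP in ht.
apply: (@sieve_tuple hs hm D5 (coefs b c d) (p%:R / 1000%:R) theta) => //.
- by move=> x y xh yh; have /allP := diam x xh; apply.
- by rewrite divr_gt0 ?ltr0n //= ltr_pdivrMr ?ltr0n // mul1r ltr_nat.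
move=> e q h e0 oq hh; have hh' := mem_rem hh; have /andP[n1 n2] := near h hh'.
apply: (@no_rough_prime_shifts D6) => //; [exact: ev | exact: ev | move=> eh].
by move: hh; rewrite eh mem_rem_uniqF.
Qed.

Local Close Scope ring_scope.
Delimit Scope Z_scope with Z.
Unset Implicit Arguments.
Open Scope R_scope.

Theorem theorem8 (theta0 : R) (D6 D5 : nat) :
  In (theta0, D6, D5)
    ((0.924, 4%nat, 6%nat) :: (0.739, 6%nat, 8%nat) :: (0.643, 6%nat, 12%nat) ::
     (0.584, 10%nat, 16%nat) :: (0.544, 12%nat, 20%nat) :: (0.516, 14%nat, 26%nat) :: nil) ->
  (exists theta : R, (theta0 < theta) /\ condA theta /\ condB theta) ->
  (exists (C c : R) (b : nat) (d : Z),
      (0 < c) /\ odd b /\ (INR b <= C) /\ Z.Even d /\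
      (0 < Z.abs d <= Z.of_nat D6)%Z /\
      (forall M : nat, exists p : nat, (M <= p)%N /\ prime p /\
          (0 < Z.of_nat p + d)%Z /\
          (Rpower (INR p) c < INR (pdiv (Z.to_nat (Z.of_nat p + d)))) /\
          bigOmega (Z.to_nat (Z.of_nat p + d)) = b))
  \/
  Rbar_le (LimInf_seq (fun n => INR (nth_prime n.+2 - nth_prime n.+1)%N)) (INR D5).
Proof.
move=> tIn [theta [ht [hA hB]]]; apply: NNPP => /not_or_and [nI nII].
case: tIn => [[et e6 e5]|[[et e6 e5]|[[et e6 e5]|[[et e6 e5]|[[et e6 e5]|[[et e6 e5]|[]]]]]]];
  move: ht nI nII; rewrite -et -e6 -e5 => ht nI nII.
(* The tuples are narrowest admissible ones with 3 to 8 members, of diameter D5, and h_m is a member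
   whose largest distance to the others is least, namely D6. Then follow the three polynomial
   coefficients and 1000 theta0. *)
- apply: (@theorem8_of_tuple [:: 0; 2; 6]%N 2 4 6 1 2 1 924 theta) => //.
  by apply: numeric_check => //=; lra.
- apply: (@theorem8_of_tuple [:: 0; 2; 6; 8]%N 2 6 8 1 3 4 739 theta) => //.
  by apply: numeric_check => //=; lra.
- apply: (@theorem8_of_tuple [:: 0; 2; 6; 8; 12]%N 6 6 12 1 3 8 643 theta) => //.
  by apply: numeric_check => //=; lra.
- apply: (@theorem8_of_tuple [:: 0; 4; 6; 10; 12; 16]%N 6 10 16 1 5 11 584 theta) => //.
  by apply: numeric_check => //=; lra.
- apply: (@theorem8_of_tuple [:: 0; 2; 6; 8; 12; 18; 20]%N 8 12 20 1 8 11 544 theta) => //.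
  by apply: numeric_check => //=; lra.
- apply: (@theorem8_of_tuple [:: 0; 2; 6; 8; 12; 18; 20; 26]%N 12 14 26 1 11 11 516 theta) => //.
  by apply: numeric_check => //=; lra.
Qed.
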